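(* Let $1<p<\infty$ and let $(\Omega,\Sigma,\mu)$ be a countably generated $\sigma$-finite measure space such that $L^{p,\infty}(\Omega,\Sigma,\mu)$ is infinite dimensional. Then $L^{p,\infty}(\Omega,\Sigma,\mu)$ is isomorphic to $\ell^{p,\infty}$ or to $\ell^\infty$.
   Context: For $1<p<\infty$, the weak $L^p$ space $L^{p,\infty}(\Omega,\Sigma,\mu)$ consists of all real-valued $\Sigma$-measurable functions $f$ (modulo a.e. equality) with $\|f\|=\sup_{t>0}t^{1/p}f^*(t)=\sup_{c>0}c\,(\mu\{|f|>c\})^{1/p}<\infty$, where $f^*$ is the decreasing rearrangement of $|f|$. The expression $\|\cdot\|$ is equivalent to a norm under which the space is a Banach space. $\ell^{p,\infty}$ is the weak $L^p$ space of $\mathbb{N}$ with counting measure, and $\ell^\infty$ is the space of bounded real sequences. ''Isomorphic'' means linearly homeomorphic. A measure space $(\Omega,\Sigma,\mu)$ is countably generated if there is a sequence $(A_n)_{n=1}^\infty$ in $\Sigma$ such that the smallest $\sigma$-algebra generated by the sets $A_n$ and the $\mu$-null sets is $\Sigma$. *)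

(* Defs.v *)
From HB Require Import structures.
From mathcomp Require Import all_boot all_order all_algebra.
From mathcomp Require Import all_classical all_reals all_analysis.
From mathcomp Require Import measurable_realfun ring.

Set Implicit Arguments.
Unset Strict Implicit.
Unset Printing Implicit Defensive.

Import Order.TTheory GRing.Theory Num.Theory.
Import numFieldNormedType.Exports.
Local Open Scope classical_set_scope.
Local Open Scope ring_scope.

Definition finite_dimensional (R : realType) (V : lmodType R) :=
  exists (n : nat) (e : 'I_n -> V), forall x : V,
    exists a : 'I_n -> R, x = \sum_(i < n) a i *: e i.

Definition isomorphic (R : realType) (E F : preTopologicalLmodType R) :=
  exists (f : {linear E -> F}) (g : F -> E),
    [/\ cancel f g, cancel g f, continuous f & continuous g].

(* Null sets are understood as members of the sigma-algebra of measure zero. *)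
Definition countably_generated d (T : measurableType d) (R : realType)
    (mu : {measure set T -> \bar R}) :=
  exists2 A : (set T)^nat, (forall n, measurable (A n)) &
    @measurable d T =
      <<s range A `|` [set N | measurable N /\ mu N = 0%E] >>.

Section weak_norm.
Context d (T : measurableType d) (R : realType).
Variables (mu : {measure set T -> \bar R}) (p : R).
Local Open Scope ereal_scope.

Definition weak_norm (f : T -> R) : \bar R :=
  ereal_sup [set c%:E * mu [set x | (c < `|f x|)%R] `^ p^-1
            | c in [set c : R | (0 < c)%R]].

Lemma weak_norm_ge0 f : 0 <= weak_norm f.
Proof.
apply: le_trans (ereal_sup_ubound _); last by exists 1%R => /=.
by rewrite mul1e poweR_ge0.
Qed.

Lemma weak_normN f : weak_norm (fun x => - f x)%R = weak_norm f.
Proof.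
rewrite /weak_norm; congr ereal_sup; congr image; apply/funext => c.
by under eq_set do rewrite normrN.
Qed.

Lemma weak_norm0 : (0 < p)%R -> weak_norm (fun=> 0%R) = 0.
Proof.
move=> p0; apply/eqP; rewrite eq_le weak_norm_ge0 andbT.
apply: ge_ereal_sup => _ [c /= c0 <-].
rewrite (_ : [set _ | _] = set0); last first.
  by apply/seteqP; split => // x /=; rewrite normr0 ltNge ltW.
by rewrite measure0 poweR0r ?mule0// gt_eqF// invr_gt0.
Qed.

Lemma weak_normZ_le a f : a != 0%R ->
  weak_norm (fun x => a * f x)%R <= `|a|%:E * weak_norm f.
Proof.
move=> a0; have na0 : (0 < `|a|)%R by rewrite normr_gt0.
apply: ge_ereal_sup => _ [c /= c0 <-].
rewrite [X in X%:E * _](_ : c = `|a| * (c / `|a|))%R; last first.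
  by rewrite mulrCA divff ?mulr1// gt_eqF.
rewrite EFinM -muleA lee_pmul2l//; apply: ereal_sup_ubound.
exists (c / `|a|)%R => /=; first by rewrite divr_gt0.
congr (_ * (mu _) `^ _); apply/seteqP; split => x /=;
  by rewrite normrM ltr_pdivrMr// mulrC.
Qed.

Lemma measurable_norm_gt (f : {mfun T >-> R}) c :
  measurable [set x | (c < `|f x|)%R].
Proof.
have mf : measurable_fun [set: T] (fun x => `|f x|%R).
  by apply: measurableT_comp => //.
have := mf measurableT _ (measurable_itv `]c, +oo[).
rewrite setTI; congr measurable; apply/seteqP; split => x /=;
  by rewrite in_itv/= andbT.
Qed.

Lemma weak_normD_le (f g : {mfun T >-> R}) : (1 < p)%R ->
  weak_norm (fun x => f x + g x)%R <= 4%:E * (weak_norm f + weak_norm g).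
Proof.
move=> p1; have p0 : (0 < p)%R by exact: lt_trans p1.
have q0 : (0 < p^-1)%R by rewrite invr_gt0.
have q1 : (p^-1 <= 1)%R by rewrite invf_le1// ltW.
apply: ge_ereal_sup => _ [c /= c0 <-].
pose A (h : T -> R) := [set x | (c / 2 < `|h x|)%R].
have mA (h : {mfun T >-> R}) : measurable (A h) by exact: measurable_norm_gt.
have mu_le : mu [set x | (c < `|f x + g x|)%R] <=
    2%:E * maxe (mu (A f)) (mu (A g)).
  apply: (@le_trans _ _ (mu (A f `|` A g))).
    rewrite le_measure ?inE//.
    - exact: (measurable_norm_gt (f + g)%R).
    - exact: measurableU.
    move=> x /=; rewrite /A /= => cfg.
    have [fx|fx] := ltP (c / 2)%R `|f x|%R; first by left.
    right; rewrite ltNge; apply/negP => gx.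
    have := lt_le_trans cfg (ler_normD _ _).
    by apply/negP; rewrite -leNgt [leRHS](splitr c) lerD.
  apply: le_trans (measureU2 _ (mA f) (mA g)) _.
  by rewrite mule_natl mule2n leeD// le_max lexx ?orbT.
have le_A (h : {mfun T >-> R}) : c%:E * mu (A h) `^ p^-1 <= 2%:E * weak_norm h.
  rewrite [X in X%:E * _](_ : c = 2 * (c / 2))%R; last first.
    by rewrite mulrCA divff ?mulr1.
  rewrite EFinM -muleA lee_pmul2l//; apply: ereal_sup_ubound.
  by exists (c / 2)%R => //=; rewrite divr_gt0.
have le_max_A : c%:E * maxe (mu (A f)) (mu (A g)) `^ p^-1 <=
    2%:E * (weak_norm f + weak_norm g).
  rewrite /maxe; case: ifP => _; apply: le_trans (le_A _) _;
    rewrite lee_pmul2l//.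
    by rewrite leeDr// weak_norm_ge0.
  by rewrite leeDl// weak_norm_ge0.
have max0 : 0 <= maxe (mu (A f)) (mu (A g)) by rewrite le_max measure_ge0.
apply: (@le_trans _ _ (c%:E * (2%:E * maxe (mu (A f)) (mu (A g)) `^ p^-1))).
  rewrite lee_pmul2l//.
  apply: (@le_trans _ _ ((2%:E * maxe (mu (A f)) (mu (A g))) `^ p^-1)).
    apply: gt0_ler_poweR => //; first exact: ltW.
    - by rewrite in_itv/= measure_ge0 leey.
    - by rewrite in_itv/= leey andbT mule_ge0.
  rewrite poweRM//; apply: lee_wpmul2r; first exact: poweR_ge0.
  rewrite poweR_EFin lee_fin -[leRHS]powRr1//.
  by apply: ler_powR => //; rewrite ler1n.
rewrite muleCA (_ : 4%:E = 2%:E * 2%:E); last by rewrite -EFinM -natrM.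
by rewrite -muleA lee_pmul2l.
Qed.

Lemma eq_weak_norm (f g : {mfun T >-> R}) :
  (\forall x \ae mu, f x = g x) -> weak_norm f = weak_norm g.
Proof.
move=> fg.
suff le_mu (h k : {mfun T >-> R}) c : (\forall x \ae mu, h x = k x) ->
    mu [set x | (c < `|h x|)%R] <= mu [set x | (c < `|k x|)%R].
  rewrite /weak_norm; congr ereal_sup; congr image; apply/funext => c.
  congr (_ * _ `^ _); apply/eqP; rewrite eq_le !le_mu//.
  by apply: filterS fg => x ->.
move=> [N [mN N0 hkN]].
apply: (@le_trans _ _ (mu ([set x | (c < `|k x|)%R] `|` N))).
  rewrite le_measure ?inE//.
  - exact: measurable_norm_gt.
  - by apply: measurableU => //; exact: measurable_norm_gt.
  move=> x /= cx; have [hk|hk] := pselect (h x = k x); first by left; rewrite -hk.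
  by right; exact: hkN.
apply: le_trans (measureU2 _ (measurable_norm_gt _ _) mN) _.
by rewrite [X in _ + X](N0 : mu N = 0) adde0.
Qed.

End weak_norm.

Section weakLfun.
Context d (T : measurableType d) (R : realType).
Variables (mu : {measure set T -> \bar R}) (p : R) (p1 : 1 < p).

(* The proof of 1 < p is a phantom argument: it is what makes the predicate
   closed under the vector space operations, so that it can carry the
   corresponding instance. *)
Definition weakLfun_pred of 1 < p : {pred {mfun T >-> R}} :=
  fun f => (weak_norm mu p f < +oo)%E.

Lemma weakLfun_submod_closed : submod_closed (weakLfun_pred p1).
Proof.
have p0 : 0 < p by exact: lt_trans p1.
split=> [|a f g]; rewrite !unfold_in.
  rewrite [ltLHS](_ : _ = 0%E) ?ltry//; exact: weak_norm0.
move=> foo goo; have [->|a0] := eqVneq a 0; first by rewrite scale0r add0r.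
apply: (le_lt_trans (weak_normD_le _ (a *: f) g p1)).
have afoo : (weak_norm mu p (a *: f) < +oo)%E.
  apply: (le_lt_trans (weak_normZ_le mu p f a0)).
  by rewrite lte_mul_pinfty ?lee_fin.
by rewrite lte_mul_pinfty ?lee_fin// lte_add_pinfty.
Qed.

HB.instance Definition _ := GRing.isSubmodClosed.Build R {mfun T >-> R}
  (weakLfun_pred p1) weakLfun_submod_closed.

Definition weakLfun := {f : {mfun T >-> R} | f \in weakLfun_pred p1}.
HB.instance Definition _ := Choice.on weakLfun.
HB.instance Definition _ := SubChoice.on weakLfun.
HB.instance Definition _ := [SubChoice_isSubLmodule of weakLfun by <:].

Lemma val_weakLfunP a (f g : weakLfun) x :
  val (a *: f + g) x = a * val f x + val g x.
Proof. by rewrite linearP. Qed.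

Lemma val_weakLfunZ a (f : weakLfun) x : val (a *: f) x = a * val f x.
Proof. by rewrite linearZ. Qed.

Lemma val_weakLfunB (f g : weakLfun) x : val (f - g) x = val f x - val g x.
Proof. by rewrite linearB. Qed.

Definition ae0_pred : {pred weakLfun} :=
  fun f => `[< \forall x \ae mu, val f x = 0 >].

Lemma ae0_submod_closed : submod_closed ae0_pred.
Proof.
split=> [|a f g /asboolP f0 /asboolP g0]; apply/asboolP.
  exact: aeW.
apply: filterS2 f0 g0 => x fx gx.
by rewrite val_weakLfunP fx gx mulr0 addr0.
Qed.

HB.instance Definition _ := GRing.isSubmodClosed.Build R weakLfun
  ae0_pred ae0_submod_closed.

(* Weak L^p: finite-weak-norm functions modulo almost everywhere equality
   (see weakL_eqP), with the topology of the quasi-norm weakL_norm. *)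
Definition weakL := Quotient.quot ae0_pred.
HB.instance Definition _ := Choice.on weakL.
HB.instance Definition _ := GRing.Zmodule.on weakL.
HB.instance Definition _ := EqQuotient.on weakL.

Local Open Scope quotient_scope.

Lemma weakL_eqP (f g : weakLfun) :
  reflect (\forall x \ae mu, val f x = val g x) (f == g %[mod weakL]).
Proof.
rewrite -Quotient.idealrBE unfold_in /ae0_pred.
apply: (iffP (asboolP _)); apply: filterS => x.
  by rewrite val_weakLfunB => /subr0_eq.
by rewrite val_weakLfunB => ->; rewrite subrr.
Qed.

Definition weakL_scale (a : R) (u : weakL) : weakL := \pi_weakL (a *: repr u).

Lemma weakL_scaleE a (f : weakLfun) :
  weakL_scale a (\pi_weakL f) = \pi_weakL (a *: f).
Proof.
apply/eqP/weakL_eqP.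
have /eqP/weakL_eqP : repr (\pi_weakL f) = f %[mod weakL] by rewrite reprK.
by apply: filterS => x fx; rewrite !val_weakLfunZ fx.
Qed.

Let scaleA a b (u : weakL) :
  weakL_scale a (weakL_scale b u) = weakL_scale (a * b) u.
Proof.
elim/quotW: u => f.
by rewrite (weakL_scaleE b) (weakL_scaleE a) (weakL_scaleE (a * b)) scalerA.
Qed.

Let scale1 : left_id 1 weakL_scale.
Proof. by elim/quotW => f; rewrite weakL_scaleE scale1r. Qed.

Let pi_add (f g : weakLfun) :
  \pi_weakL f + \pi_weakL g = \pi_weakL (f + g) :> weakL.
Proof. exact: (esym (Quotient.pi_add ae0_pred f g)). Qed.

Let pi_opp (f : weakLfun) : - \pi_weakL f = \pi_weakL (- f) :> weakL.
Proof. exact: (esym (Quotient.pi_opp ae0_pred f)). Qed.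

Let scaleDr : right_distributive weakL_scale +%R.
Proof.
move=> a; elim/quotW => f; elim/quotW => g.
by rewrite pi_add (weakL_scaleE a (f + g)) 2!(weakL_scaleE a) pi_add scalerDr.
Qed.

Let scaleDl u : {morph weakL_scale^~ u : a b / a + b}.
Proof.
by elim/quotW: u => f a b; rewrite 3!weakL_scaleE pi_add scalerDl.
Qed.

HB.instance Definition _ := GRing.Zmodule_isLmodule.Build R weakL
  scaleA scale1 scaleDr scaleDl.

Definition weakL_norm (u : weakL) : R := fine (weak_norm mu p (val (repr u))).

Lemma weakL_normE (f : weakLfun) :
  (weakL_norm (\pi_weakL f))%:E = weak_norm mu p (val f).
Proof.
rewrite /weakL_norm.
have -> : weak_norm mu p (val (repr (\pi_weakL f))) = weak_norm mu p (val f).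
  by apply: eq_weak_norm; apply/weakL_eqP; rewrite reprK.
by rewrite fineK// ge0_fin_numE ?weak_norm_ge0//; exact: (valP f).
Qed.

Lemma weakL_norm0 : weakL_norm 0 = 0.
Proof.
have -> : 0 = \pi_weakL 0 :> weakL.
  by rewrite -[LHS](subrr (\pi_weakL 0)) pi_opp pi_add subrr.
apply: EFin_inj; rewrite weakL_normE.
by apply: weak_norm0; exact: lt_trans p1.
Qed.

Lemma weakL_normN u : weakL_norm (- u) = weakL_norm u.
Proof.
elim/quotW: u => f; apply: EFin_inj.
by rewrite pi_opp !weakL_normE -[RHS]weak_normN.
Qed.

Lemma weakL_normD_le u v :
  weakL_norm (u + v) <= 4 * (weakL_norm u + weakL_norm v).
Proof.
have -> : u = \pi_weakL (repr u) by rewrite reprK.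
have -> : v = \pi_weakL (repr v) by rewrite reprK.
move: (repr u) (repr v) => f g.
rewrite pi_add -lee_fin EFinM [X in (_ * X)%E]EFinD.
rewrite (weakL_normE (f + g)) (weakL_normE f).
by rewrite (weakL_normE g); exact: (weak_normD_le mu (val f) (val g) p1).
Qed.

(* weak_norm is only a quasi-norm, hence a uniform structure rather than a
   normedModType: the sets {v | weakL_norm (v - u) < r}, r > 0, form a basis of
   neighborhoods of u. *)
Definition weakL_ent : set_system (weakL * weakL) :=
  filter_from [set r : R | 0 < r]
    (fun r => [set uv | weakL_norm (uv.2 - uv.1) < r]).

Let weakL_ent_filter : Filter weakL_ent.
Proof.
apply: filter_from_filter; first by exists 1 => /=.
move=> r s /= r0 s0; exists (Num.min r s); first by rewrite /= lt_min r0.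
by move=> uv /=; rewrite lt_min => /andP[].
Qed.

Let weakL_ent_diagonal A : weakL_ent A -> diagonal `<=` A.
Proof.
move=> [r /= r0 rA] [u v] /= uv; apply: rA => /=.
by rewrite (_ : v = u) ?subrr ?weakL_norm0.
Qed.

Let weakL_ent_inv A : weakL_ent A -> weakL_ent (A^-1)%relation.
Proof.
move=> [r r0 rA]; exists r => // -[u v] /= uv; apply: rA => /=.
by rewrite -opprB weakL_normN.
Qed.

Let weakL_ent_split A : weakL_ent A ->
  exists2 B, weakL_ent B & (B \; B)%relation `<=` A.
Proof.
move=> [r /= r0 rA].
exists [set uv | weakL_norm (uv.2 - uv.1) < r / 8].
  by exists (r / 8) => //=; rewrite divr_gt0.
move=> [u w] /= [v uv vw]; apply: rA => /=.
rewrite -(subrK v w) -addrA; apply: le_lt_trans (weakL_normD_le _ _) _.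
have -> : r = 4 * (r / 8 + r / 8) by field.
by rewrite ltr_pM2l// ltrD.
Qed.

HB.instance Definition _ := isUniform.Build weakL weakL_ent_filter
  weakL_ent_diagonal weakL_ent_inv weakL_ent_split.

End weakLfun.

Section linfty.
Variable R : realType.

Definition linfty_pred : {pred nat -> R} := mem (bounded_fun : set (nat -> R)).

Lemma linfty_predP (u : nat -> R) :
  reflect (exists M, forall n, `|u n| <= M) (u \in linfty_pred).
Proof.
apply: (iffP idP) => [|[M uM]]; rewrite inE.
  case=> A [_ uA]; exists (`|A| + 1) => n.
  by apply: (uA (`|A| + 1)) => //; rewrite (le_lt_trans (ler_norm A))// ltrDl.
exists M; split; first exact: num_real.
by move=> N MN n _; exact: le_trans (uM n) (ltW MN).
Qed.

Lemma linfty_submod_closed : submod_closed linfty_pred.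
Proof.
split=> [|a u v /linfty_predP[A uA] /linfty_predP[B vB]]; apply/linfty_predP.
  by exists 0 => n; rewrite normr0.
exists (`|a| * A + B) => n.
apply: le_trans (ler_normD _ _) _; apply: lerD => //.
by rewrite normrM ler_wpM2l.
Qed.

HB.instance Definition _ := GRing.isSubmodClosed.Build R (nat -> R)
  linfty_pred linfty_submod_closed.

Definition linfty := {u : nat -> R | u \in linfty_pred}.
HB.instance Definition _ := Choice.on linfty.
HB.instance Definition _ := SubChoice.on linfty.
HB.instance Definition _ := [SubChoice_isSubLmodule of linfty by <:].

Definition linfty_norm (u : linfty) : R := sup (range (fun n => `|val u n|)).

Let has_sup_linfty (u : linfty) : has_sup (range (fun n => `|val u n|)).
Proof.
split; first by exists `|val u 0%N|; exists 0%N.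
have /linfty_predP[M uM] := valP u.
by exists M => _ [n _ <-]; exact: uM.
Qed.

Lemma le_linfty_norm (u : linfty) n : `|val u n| <= linfty_norm u.
Proof. by apply: sup_upper_bound => //; exists n. Qed.

Lemma linfty_norm_le (u : linfty) (M : R) :
  (forall n, `|val u n| <= M) -> linfty_norm u <= M.
Proof.
move=> uM; apply: ge_sup; first by case: (has_sup_linfty u).
by move=> _ [n _ <-].
Qed.

Let ler_linfty_normD u v :
  linfty_norm (u + v) <= linfty_norm u + linfty_norm v.
Proof.
apply: linfty_norm_le => n; apply: le_trans (ler_normD _ _) _.
by apply: lerD; exact: le_linfty_norm.
Qed.

Let linfty_normZ a u : linfty_norm (a *: u) = `|a| * linfty_norm u.
Proof.
have le_normZ b v : linfty_norm (b *: v) <= `|b| * linfty_norm v.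
  apply: linfty_norm_le => n; rewrite [leLHS]normrM.
  by rewrite ler_wpM2l// le_linfty_norm.
apply/eqP; rewrite eq_le le_normZ/=.
have [->|a0] := eqVneq a 0.
  rewrite normr0 mul0r; apply: le_trans (le_linfty_norm _ 0); exact: normr_ge0.
rewrite -ler_pdivlMl ?normr_gt0// -normfV.
by apply: le_trans (le_normZ _ _); rewrite scalerA mulVf// scale1r.
Qed.

Let linfty_norm_eq0 u : linfty_norm u = 0 -> u = 0.
Proof.
move=> u0; apply/val_inj/funext => n; apply/eqP.
by rewrite -normr_le0 -u0 le_linfty_norm.
Qed.

HB.instance Definition _ := Lmodule_isNormed.Build R linfty
  ler_linfty_normD linfty_normZ linfty_norm_eq0.

End linfty.

(* Main.v *)
Require Import Defs.
From HB Require Import structures.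
From mathcomp Require Import all_boot all_order all_algebra.
From mathcomp Require Import all_classical all_reals all_analysis.
From mathcomp Require Import measurable_realfun ring lra zify.
Set Implicit Arguments.
Unset Strict Implicit.
Unset Printing Implicit Defensive.
Import Order.TTheory GRing.Theory Num.Theory.
Import numFieldNormedType.Exports.
Local Open Scope classical_set_scope.
Local Open Scope ring_scope.

(** Write V for the weak L^p space of mu and q for 1 - 1/p. The isomorphism type
of V depends only on how many disjoint sets of comparable measure mu has.

Let X be the space of families of functions, one on each finite set 'I_n with
counting measure, whose weak l^p norms are uniformly bounded (gblocks), write
l^oo(E) for the bounded sequences in E (gseq), and let W be l^oo(l^oo(X)).

First, V is a complemented subspace of l^oo(X) (gretract_blocks). A countable
family of generators cuts the space into finer and finer finite partitions. A
function is sent to the sequence of its averages over the cells of these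
partitions; a cell is repeated a number of times proportional to its measure, up
to a factor 2, so that the averages become functions on finite sets with counting
measure. Backwards, a bounded sequence of functions on these finite sets gives a
sequence of set functions; their limit along an ultrafilter is bounded by
a multiple of mu(A)^q, hence is a charge, and its Radon-Nikodym derivative
belongs to V. For the averages of f the limit is the integral of f, because this
holds on the cells. This route avoids weak-star compactness and martingales.

Second, call mu rich if it has blocks of n disjoint sets of measure close to e,
for every n, the scales [e, n e] of different blocks being far apart. Then W is
complemented in V (gretract_rich): at a given height the measures of the blocks
that matter form a series dominated by a geometric one, so that the weak L^p norm
of a function carried by the blocks is equivalent to the supremum of its norms on
the blocks.

Third, if V is complemented in E and l^oo(E) in V, then V and l^oo(E) are
isomorphic (pelczynski_decomposition). Counting measure on nat is rich, so for a
rich mu both V and l^{p,oo} are isomorphic to W.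

It remains to treat a measure that is not rich (giso_dichotomy). The cells around
a point decrease to a set that no measurable set splits, here called its atom. If
the points with null atoms had positive measure, or if arbitrarily many atoms had
comparable masses, mu would be rich. Otherwise mu is purely atomic, and for some N
at most N atoms have mass in any interval [e, 2e]. The atoms of mass at most L then
have total mass at most 2 N L, so the weak L^p norm of f is equivalent to the
supremum of |f| m^(1/p) over the atoms, m being their mass, and V is isomorphic to
l^oo, unless there are finitely many atoms and V is finite dimensional.

The estimate behind all this is Kolmogorov's inequality: the integral of |f| phi is
at most a constant times the weak norm of f times (the integral of phi)^q, whenever
0 <= phi <= 1 (kolmogorov). *)

(** * Bounded linear maps and the decomposition method *)

(** Quasi-norms enter only through their balls. Keeping the radius as a parameter
lets spaces of bounded sequences be carried by all sequences: the bounded ones are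
singled out by gbounded, and maps need to be linear only there. The constants K
absorb the defect of the triangle inequality. *)
Record gauged (R : realType) := Gauged {
  gcar :> lmodType R;
  gball : R -> gcar -> Prop;
  gball_le : forall M M' x, M <= M' -> gball M x -> gball M' x;
  gball0 : forall M, 0 < M -> gball M 0;
  gballD : exists2 K, 0 < K & forall M x y, 0 < M ->
    gball M x -> gball M y -> gball (K * M) (x + y);
  gballZ : forall a, exists2 K, 0 < K & forall M x, 0 < M ->
    gball M x -> gball (K * M) (a *: x) }.

Section bounded_maps.
Variable R : realType.
Implicit Types E F G : gauged R.

Definition gbounded E (x : E) := exists2 M, 0 < M & gball M x.

Definition bounded_linear E F (f : E -> F) :=
  (forall a x y, gbounded x -> gbounded y ->
    f (a *: x + y) = a *: f x + f y) /\
  (exists2 K, 0 < K & forall M x, 0 < M -> gball M x -> gball (K * M) (f x)).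

Lemma gbounded0 E : gbounded (0 : E).
Proof. by exists 1 => //; exact: gball0. Qed.

Lemma gboundedZ E a (x : E) : gbounded x -> gbounded (a *: x).
Proof.
move=> [M M0 Mx]; have [K K0 KM] := gballZ E a.
by exists (K * M); [exact: mulr_gt0|exact: KM].
Qed.

Lemma gboundedD E (x y : E) : gbounded x -> gbounded y -> gbounded (x + y).
Proof.
move=> [M M0 Mx] [N N0 Ny]; have [K K0 KD] := gballD E.
have MN0 : 0 < M + N by exact: addr_gt0.
exists (K * (M + N)); first exact: mulr_gt0.
by apply: KD => //; [apply: gball_le Mx|apply: gball_le Ny];
  rewrite ?lerDl ?lerDr ltW.
Qed.

Lemma gbounded_linear E F (f : E -> F) x : bounded_linear f ->
  gbounded x -> gbounded (f x).
Proof.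
move=> [_ [K K0 Kf]] [M M0 Mx].
by exists (K * M); [exact: mulr_gt0|exact: Kf].
Qed.

Section linearity.
Context E F (f : E -> F) (bf : bounded_linear f).

Lemma bounded_linear0 : f 0 = 0.
Proof.
have := bf.1 1 0 0 (gbounded0 E) (gbounded0 E).
by rewrite !scale1r addr0 -[LHS]addr0 => /addrI.
Qed.

Lemma bounded_linearD x y : gbounded x -> gbounded y -> f (x + y) = f x + f y.
Proof. by move=> bx by_; have := bf.1 1 x y bx by_; rewrite !scale1r. Qed.

Lemma bounded_linearZ a x : gbounded x -> f (a *: x) = a *: f x.
Proof.
move=> bx; have := bf.1 a x 0 bx (gbounded0 E).
by rewrite bounded_linear0 !addr0.
Qed.

Lemma bounded_linearB x y : gbounded x -> gbounded y -> f (x - y) = f x - f y.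
Proof.
move=> bx by_; rewrite -scaleN1r bounded_linearD//; last exact: gboundedZ.
by rewrite bounded_linearZ// scaleN1r.
Qed.

End linearity.

Lemma bounded_linear_id E : bounded_linear (@id E).
Proof. by split => //; exists 1 => // M x _; rewrite mul1r. Qed.

Lemma bounded_linear_comp E F G (g : F -> G) (f : E -> F) :
  bounded_linear g -> bounded_linear f -> bounded_linear (g \o f).
Proof.
move=> bg bf; split=> [a x y bx by_|].
  by rewrite /= bf.1// bg.1//; exact: gbounded_linear.
have [[_ [K K0 Kf]] [_ [L L0 Lg]]] := (bf, bg).
exists (L * K) => [|M x M0 Mx]; first exact: mulr_gt0.
by rewrite -mulrA; apply: Lg; [exact: mulr_gt0|exact: Kf].
Qed.

Lemma bounded_linear_add E F (f g : E -> F) :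
  bounded_linear f -> bounded_linear g -> bounded_linear (fun x => f x + g x).
Proof.
move=> bf bg; split=> [a x y bx by_|].
  by rewrite bf.1// bg.1// scalerDr addrACA.
have [[_ [K K0 Kf]] [_ [L L0 Lg]]] := (bf, bg).
have [C C0 CD] := gballD F.
have KL0 : 0 < K + L by exact: addr_gt0.
exists (C * (K + L)) => [|M x M0 Mx]; first exact: mulr_gt0.
rewrite -mulrA; apply: CD; first exact: mulr_gt0.
  by apply: gball_le (Kf _ _ M0 Mx); rewrite ler_pM2r// lerDl ltW.
by apply: gball_le (Lg _ _ M0 Mx); rewrite ler_pM2r// lerDr ltW.
Qed.

Lemma bounded_linear_sub E F (f g : E -> F) :
  bounded_linear f -> bounded_linear g -> bounded_linear (fun x => f x - g x).
Proof.
move=> bf bg; apply: bounded_linear_add => //; split=> [a x y bx by_|].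
  by rewrite bg.1// opprD scalerN.
have [_ [L L0 Lg]] := bg; have [C C0 CN] := gballZ F (-1).
exists (C * L) => [|M x M0 Mx]; first exact: mulr_gt0.
by rewrite -scaleN1r -mulrA; apply: CN; [exact: mulr_gt0|exact: Lg].
Qed.

(** A retract is an isomorphic copy of E that is complemented in F. *)
Definition gretract E F := exists (s : E -> F) (r : F -> E),
  [/\ bounded_linear s, bounded_linear r & forall x, gbounded x -> r (s x) = x].

Definition giso E F := exists (f : E -> F) (g : F -> E),
  [/\ bounded_linear f, bounded_linear g,
      forall x, gbounded x -> g (f x) = x & forall y, gbounded y -> f (g y) = y].

Lemma giso_sym E F : giso E F -> giso F E.
Proof. by move=> [f [g [bf bg gf fg]]]; exists g, f. Qed.

Lemma giso_trans E F G : giso E F -> giso F G -> giso E G.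
Proof.
move=> [f [g [bf bg gf fg]]] [h [k [bh bk kh hk]]].
exists (h \o f), (g \o k); split=> [|||y by_]; [exact: bounded_linear_comp..| |].
  by move=> x bx /=; rewrite kh ?gf//; exact: gbounded_linear.
by rewrite /= fg ?hk//; exact: gbounded_linear.
Qed.

Section product.
Variables E F : gauged R.
Let pball M (x : E * F) := gball M x.1 /\ gball M x.2.

Let pball_le M M' x : M <= M' -> pball M x -> pball M' x.
Proof. by move=> MM' [? ?]; split; apply: gball_le MM' _. Qed.

Let pball0 M : 0 < M -> pball M 0.
Proof. by move=> M0; split; exact: gball0. Qed.

Let pballD : exists2 K, 0 < K & forall M x y, 0 < M ->
    pball M x -> pball M y -> pball (K * M) (x + y).
Proof.
have [[K K0 KE] [L L0 LF]] := (gballD E, gballD F).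
exists (K + L) => [|M x y M0 [x1 x2] [y1 y2]]; first exact: addr_gt0.
by split; [apply: gball_le (KE _ _ _ M0 x1 y1)|
  apply: gball_le (LF _ _ _ M0 x2 y2)];
  rewrite ler_pM2r// ?lerDl ?lerDr ltW.
Qed.

Let pballZ a : exists2 K, 0 < K & forall M x, 0 < M ->
    pball M x -> pball (K * M) (a *: x).
Proof.
have [[K K0 KE] [L L0 LF]] := (gballZ E a, gballZ F a).
exists (K + L) => [|M x M0 [x1 x2]]; first exact: addr_gt0.
by split; [apply: gball_le (KE _ _ M0 x1)|apply: gball_le (LF _ _ M0 x2)];
  rewrite ler_pM2r// ?lerDl ?lerDr ltW.
Qed.

Definition gprod := Gauged pball_le pball0 pballD pballZ.

End product.

Lemma bounded_linear_fst E F : bounded_linear (fst : gprod E F -> E).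
Proof. by split=> //; exists 1 => // M x _ [x1 _]; rewrite mul1r. Qed.

Lemma bounded_linear_snd E F : bounded_linear (snd : gprod E F -> F).
Proof. by split=> //; exists 1 => // M x _ [_ x2]; rewrite mul1r. Qed.

Lemma bounded_linear_pair E F G (f : E -> F) (g : E -> G) :
  bounded_linear f -> bounded_linear g ->
  bounded_linear (fun x => (f x, g x) : gprod F G).
Proof.
move=> bf bg; split=> [a x y bx by_|]; first by rewrite bf.1// bg.1.
have [[_ [K K0 Kf]] [_ [L L0 Lg]]] := (bf, bg).
exists (K + L) => [|M x M0 Mx]; first exact: addr_gt0.
by split; [apply: gball_le (Kf _ _ M0 Mx)|apply: gball_le (Lg _ _ M0 Mx)];
  rewrite ler_pM2r// ?lerDl ?lerDr ltW.
Qed.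

Section sequences.
Variable E : gauged R.
Let sball M (z : nat -> E) := forall n, gball M (z n).

Let sball_le M M' x : M <= M' -> sball M x -> sball M' x.
Proof. by move=> MM' Mx n; apply: gball_le MM' _. Qed.

Let sball0 M : 0 < M -> sball M 0.
Proof. by move=> M0 n; exact: gball0. Qed.

Let sballD : exists2 K, 0 < K & forall M x y, 0 < M ->
    sball M x -> sball M y -> sball (K * M) (x + y).
Proof. by have [K K0 KE] := gballD E; exists K => // M x y M0 Mx My n; apply: KE. Qed.

Let sballZ a : exists2 K, 0 < K & forall M x, 0 < M ->
    sball M x -> sball (K * M) (a *: x).
Proof. by have [K K0 KE] := gballZ E a; exists K => // M x M0 Mx n; apply: KE. Qed.

Definition gseq := Gauged sball_le sball0 sballD sballZ.

Lemma gball_seqE M (z : gseq) : gball M z = forall n, gball M (z n).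
Proof. by []. Qed.

Lemma gbounded_seq (z : gseq) n : gbounded z -> gbounded (z n).
Proof. by move=> [M M0 Mz]; exists M. Qed.

Lemma bounded_linear_coord n : bounded_linear ((fun z => z n) : gseq -> E).
Proof. by split=> //; exists 1 => // M z _ Mz; rewrite mul1r. Qed.

Lemma bounded_linear_reindex (h : nat -> nat) :
  bounded_linear ((fun z => z \o h) : gseq -> gseq).
Proof. by split=> //; exists 1 => // M z _ Mz n; rewrite mul1r; exact: Mz. Qed.

End sequences.

Lemma bounded_linear_map E F (f : E -> F) : bounded_linear f ->
  bounded_linear ((fun z n => f (z n)) : gseq E -> gseq F).
Proof.
move=> bf; split=> [a x y bx by_|].
  apply/funext => n.
  exact: (bf.1 a _ _ (gbounded_seq n bx) (gbounded_seq n by_)).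
by have [_ [K K0 Kf]] := bf; exists K => // M x M0 Mx; rewrite gball_seqE => n; exact: Kf.
Qed.

Definition scons E (x : E) (z : gseq E) : gseq E :=
  fun n => if n is n'.+1 then z n' else x.

Lemma bounded_linear_scons E F (f : E -> F) (g : E -> gseq F) :
  bounded_linear f -> bounded_linear g ->
  bounded_linear (fun x => scons (f x) (g x)).
Proof.
move=> bf bg; split=> [a x y bx by_|].
  by apply/funext => -[|n]; rewrite /scons/= ?bf.1 ?bg.1.
have [[_ [K K0 Kf]] [_ [L L0 Lg]]] := (bf, bg).
exists (K + L) => [|M x M0 Mx]; first exact: addr_gt0.
rewrite gball_seqE.
by case=> [|n]; [apply: gball_le (Kf _ _ M0 Mx)|apply: gball_le (Lg _ _ M0 Mx n)];
  rewrite ler_pM2r// ?lerDl ?lerDr ltW.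
Qed.

Definition smerge E (x y : gseq E) : gseq E :=
  fun n => if odd n then y n./2 else x n./2.

Lemma bounded_linear_smerge E F (f g : E -> gseq F) :
  bounded_linear f -> bounded_linear g ->
  bounded_linear (fun x => smerge (f x) (g x)).
Proof.
move=> bf bg; split=> [a x y bx by_|].
  rewrite bf.1// bg.1//; apply/funext => n.
  rewrite [RHS](_ : _ = a *: smerge (f x) (g x) n + smerge (f y) (g y) n)//.
  by rewrite /smerge; case: ifP.
have [[_ [K K0 Kf]] [_ [L L0 Lg]]] := (bf, bg).
exists (K + L) => [|M x M0 Mx]; first exact: addr_gt0.
rewrite gball_seqE => n; rewrite /smerge; case: ifP => _;
  [apply: gball_le (Lg _ _ M0 Mx _)|apply: gball_le (Kf _ _ M0 Mx _)];
  by rewrite ler_pM2r// ?lerDl ?lerDr ltW.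
Qed.

(** The complemented copy of l^oo(E) in V can be split into its even and odd terms
without changing the rest of V: the odd terms take the place of the whole sequence
and the even terms become the second factor. *)
Lemma giso_absorb_seq (V E : gauged R) :
  gretract (gseq E) V -> giso V (gprod V (gseq E)).
Proof.
move=> [J [Q [bJ bQ QJ]]].
pose ev (z : gseq E) : gseq E := z \o double.
pose od (z : gseq E) : gseq E := z \o (fun n => n.*2.+1).
have bev : bounded_linear ev by exact: bounded_linear_reindex.
have bod : bounded_linear od by exact: bounded_linear_reindex.
exists (fun v => (v - J (Q v) + J (od (Q v)), ev (Q v)) : gprod V (gseq E)).
exists (fun w => w.1 - J (Q w.1) + J (smerge w.2 (Q w.1))).
have bJQ := bounded_linear_comp bJ bQ.
have b1 := @bounded_linear_fst V (gseq E).
have b2 := @bounded_linear_snd V (gseq E).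
have bQ1 := bounded_linear_comp bQ b1.
have bm : bounded_linear (fun w : gprod V (gseq E) => smerge w.2 (Q w.1)).
  exact: bounded_linear_smerge.
have bOQ := bounded_linear_comp bod bQ.
split.
- apply: bounded_linear_pair; last exact: bounded_linear_comp bev bQ.
  apply: bounded_linear_add; last exact: bounded_linear_comp bJ bOQ.
  by apply: bounded_linear_sub => //; exact: bounded_linear_id.
- apply: bounded_linear_add; last exact: bounded_linear_comp bJ bm.
  by apply: bounded_linear_sub => //; exact: bounded_linear_comp bJ bQ1.
- move=> v bv /=.
  have bQv := gbounded_linear bQ bv.
  have bov := gbounded_linear bod bQv.
  have QE : Q (v - J (Q v) + J (od (Q v))) = od (Q v).
    rewrite (bounded_linearD bQ) ?(bounded_linearB bQ)//.
    - by rewrite !QJ// subrr add0r.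
    - exact: gbounded_linear.
    - by apply: gboundedD => //; rewrite -scaleN1r; apply/gboundedZ/gbounded_linear.
    - exact: gbounded_linear.
  rewrite QE addrK (_ : smerge _ _ = Q v) ?subrK//.
  apply/funext => n; rewrite /smerge /ev /od /=; case: ifPn => on.
    by have := odd_double_half n; rewrite on add1n => ->.
  by rewrite even_halfK.
- move=> [v z] [M M0 [/= Mv Mz]] /=.
  have bv : gbounded v by exists M.
  have bz : gbounded z by exists M.
  have bQv := gbounded_linear bQ bv.
  have bvz : gbounded ((v, z) : gprod V (gseq E)) by exists M.
  have bmz : gbounded (smerge z (Q v)) := gbounded_linear bm bvz.
  have QE : Q (v - J (Q v) + J (smerge z (Q v))) = smerge z (Q v).
    rewrite (bounded_linearD bQ) ?(bounded_linearB bQ)//.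
    - by rewrite !QJ// subrr add0r.
    - exact: gbounded_linear.
    - by apply: gboundedD => //; rewrite -scaleN1r; apply/gboundedZ/gbounded_linear.
    - exact: gbounded_linear.
  rewrite QE addrK; congr (_, _).
    rewrite (_ : od _ = Q v) ?subrK//; apply/funext => n.
    by rewrite /od /smerge /= odd_double /= uphalf_double.
  by apply/funext => n; rewrite /ev /smerge /= odd_double doubleK.
Qed.

(** Each term of a sequence in E splits into its component in V and a remainder.
The map shifts the V-components by one place and leaves the remainders alone, so
that the component of the first term comes out as a separate factor. *)
Lemma giso_seq_absorb (V E : gauged R) :
  gretract V E -> giso (gprod V (gseq E)) (gseq E).
Proof.
move=> [S [Q [bS bQ QS]]].
pose P (z : gseq E) : gseq E := fun n => S (Q (z n)).
have bP : bounded_linear P.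
  exact: bounded_linear_map (bounded_linear_comp bS bQ).
pose sh (z : gseq E) : gseq E := fun n => z n.+1.
have bsh : bounded_linear (sh : gseq E -> gseq E).
  exact: (@bounded_linear_reindex E succn).
have b1 := @bounded_linear_fst V (gseq E).
have b2 := @bounded_linear_snd V (gseq E).
have b0 := @bounded_linear_coord E 0%N.
apply: giso_sym.
exists (fun z => (Q (z 0%N), z - P z + P (sh z)) : gprod V (gseq E)).
exists (fun w => w.2 - P w.2 + scons (S w.1) (P w.2)).
have bP2 := bounded_linear_comp bP b2.
split.
- apply: bounded_linear_pair; first exact: bounded_linear_comp bQ b0.
  apply: bounded_linear_add; last exact: bounded_linear_comp bP bsh.
  by apply: bounded_linear_sub => //; exact: bounded_linear_id.
- apply: bounded_linear_add; first exact: bounded_linear_sub.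
  by apply: bounded_linear_scons => //; exact: bounded_linear_comp.
- move=> z bz /=.
  have PE : P (z - P z + P (sh z)) = P (sh z).
    apply/funext => n.
    have bn k : gbounded (z k) by exact: gbounded_seq.
    have bSQ k : gbounded (S (Q (z k))) by do 2 apply: gbounded_linear => //.
    have -> : P (z - P z + P (sh z)) n = S (Q (z n - S (Q (z n)) + S (Q (z n.+1)))).
      by [].
    rewrite (bounded_linearD bQ)// ?(bounded_linearB bQ)//.
      by rewrite !QS ?subrr ?add0r//; exact: gbounded_linear.
    by apply: gboundedD => //; rewrite -scaleN1r; exact: gboundedZ.
  rewrite PE addrK (_ : scons _ _ = P z) ?subrK//.
  by apply/funext => -[|n].
- move=> [v z] [M M0 [/= Mv Mz]] /=.
  have bv : gbounded v by exists M.
  have bn k : gbounded (z k) by exists M.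
  have bSQ k : gbounded (S (Q (z k))) by do 2 apply: gbounded_linear => //.
  have bSv : gbounded (S v) by exact: gbounded_linear.
  pose w := z - P z + scons (S v) (P z).
  have wE n : Q (w n) = Q (scons (S v) (P z) n).
    have -> : w n = z n - S (Q (z n)) + scons (S v) (P z) n by [].
    have bc : gbounded (scons (S v) (P z) n) by case: n.
    rewrite (bounded_linearD bQ)// ?(bounded_linearB bQ)//.
      by rewrite QS ?subrr ?add0r//; exact: gbounded_linear.
    by apply: gboundedD => //; rewrite -scaleN1r; exact: gboundedZ.
  have PwE : P w = scons (S v) (P z).
    apply/funext => n; rewrite /P wE; case: n => [|n] /=; first by rewrite QS.
    by rewrite QS//; exact: gbounded_linear.
  have PsE : P (sh w) = P z.
    by have := congr1 sh PwE.
  rewrite -/w PwE PsE wE /= QS//; congr (_, _).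
  by rewrite /w addrK subrK.
Qed.

Theorem pelczynski_decomposition (V E : gauged R) :
  gretract V E -> gretract (gseq E) V -> giso V (gseq E).
Proof.
by move=> /giso_seq_absorb VE /giso_absorb_seq EV; exact: giso_trans EV VE.
Qed.

End bounded_maps.

(** * The weak L^p space as a space with balls *)

Section weakL_space.
Context d (T : measurableType d) (R : realType).
Variables (mu : {measure set T -> \bar R}) (p : R) (p1 : 1 < p).

Local Open Scope quotient_scope.

(** A chosen representative, which is linear in the class only almost everywhere. *)
Definition weakL_fun (u : weakL mu p1) : {mfun T >-> R} := val (repr u).

Lemma weakL_funP a u v :
  \forall x \ae mu, weakL_fun (a *: u + v) x = a * weakL_fun u x + weakL_fun v x.
Proof.
pose W := weakL mu p1.
have E : repr (a *: u + v) = a *: repr u + repr v %[mod W].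
  rewrite reprK -[in LHS](reprK u) -[in LHS](reprK v) [_ *: _]weakL_scaleE.
  exact: esym (Quotient.pi_add _ _ _).
have := elimT (weakL_eqP (repr (a *: u + v)) (a *: repr u + repr v)) (introT eqP E).
by apply: filterS => x; rewrite val_weakLfunP.
Qed.

Lemma weak_norm_fun u : weak_norm mu p (weakL_fun u) = (weakL_norm u)%:E.
Proof. by rewrite -[in RHS](reprK u) weakL_normE. Qed.

Lemma weakL_fun_inj u v :
  (\forall x \ae mu, weakL_fun u x = weakL_fun v x) -> u = v.
Proof.
by move=> /(introT (weakL_eqP (repr u) (repr v)))/eqP; rewrite !reprK.
Qed.

Lemma weakL_fun_onto (f : {mfun T >-> R}) : (weak_norm mu p f < +oo)%E ->
  exists u, \forall x \ae mu, weakL_fun u x = f x.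
Proof.
move=> foo; have fW : f \in weakLfun_pred mu p1 by rewrite unfold_in.
pose W := weakL mu p1.
exists (\pi_W (exist _ f fW)).
apply: (elimT (weakL_eqP (repr (\pi_W (exist _ f fW))) (exist _ f fW))).
by rewrite reprK.
Qed.

Lemma weakL_norm_ge0 (u : weakL mu p1) : 0 <= weakL_norm u.
Proof. by rewrite -lee_fin -weak_norm_fun weak_norm_ge0. Qed.

Lemma weakL_normZ_le a (u : weakL mu p1) :
  weakL_norm (a *: u) <= `|a| * weakL_norm u.
Proof.
have [->|a0] := eqVneq a 0; first by rewrite scale0r weakL_norm0 normr0 mul0r.
rewrite -lee_fin EFinM -!weak_norm_fun.
have -> : weak_norm mu p (weakL_fun (a *: u)) =
    weak_norm mu p (fun x => a * weakL_fun u x).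
  apply: (@eq_weak_norm _ _ _ _ _ _ (a *: weakL_fun u)).
  have := weakL_funP a u 0; have := weakL_funP (-1) 0 0.
  rewrite scaler0 !addr0; apply: filterS2 => x.
  by rewrite mulN1r addNr => -> ->; rewrite addr0.
exact: weak_normZ_le.
Qed.

Definition weakL_ball M (u : weakL mu p1) := weakL_norm u <= M.

Lemma weakL_ball_le M M' u : M <= M' -> weakL_ball M u -> weakL_ball M' u.
Proof. by move=> MM' /le_trans; exact. Qed.

Lemma weakL_ball0 M : 0 < M -> weakL_ball M 0.
Proof. by move=> M0; rewrite /weakL_ball weakL_norm0 ltW. Qed.

Lemma weakL_ballD : exists2 K, 0 < K & forall M u v, 0 < M ->
  weakL_ball M u -> weakL_ball M v -> weakL_ball (K * M) (u + v).
Proof.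
exists 8 => // M u v M0 uM vM; apply: le_trans (weakL_normD_le _ _) _.
rewrite /weakL_ball in uM vM.
by move: (weakL_norm u) (weakL_norm v) uM vM => m n ? ?; lra.
Qed.

Lemma weakL_ballZ a : exists2 K, 0 < K & forall M u, 0 < M ->
  weakL_ball M u -> weakL_ball (K * M) (a *: u).
Proof.
have a0 := normr_ge0 a; exists (`|a| + 1) => [|M u M0 uM]; first by lra.
have u0 := weakL_norm_ge0 u; rewrite /weakL_ball in uM *.
apply: le_trans (weakL_normZ_le a u) _.
move: (weakL_norm u) u0 uM => n n0 nM; apply: ler_pM => //; lra.
Qed.

Definition gweakL : gauged R :=
  Gauged weakL_ball_le weakL_ball0 weakL_ballD weakL_ballZ.

Lemma gbounded_weakL (u : gweakL) : gbounded u.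
Proof.
have := weakL_norm_ge0 u => u0.
exists (weakL_norm u + 1); first by rewrite ltr_wpDl.
by rewrite /= /weakL_ball lerDl.
Qed.

Lemma nbhs_weakLP (u : weakL mu p1) (A : set (weakL mu p1)) :
  nbhs u A <-> exists2 r, 0 < r & forall v, weakL_norm (v - u) <= r -> A v.
Proof.
rewrite -nbhs_entourageE; split => [[B [r /= r0 rB] BA]|[r r0 rA]].
  exists (r / 2) => [|v uv]; first by rewrite divr_gt0.
  apply: BA; rewrite /xsection/= inE; apply: rB => /=.
  by rewrite (le_lt_trans uv)// ltr_pdivrMr// ltr_pMr// ltr1n.
exists [set uv : weakL mu p1 * weakL mu p1 | weakL_norm (uv.2 - uv.1) < r].
  by exists r.
by move=> v; rewrite /xsection/= inE/= => /ltW; exact: rA.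
Qed.

End weakL_space.

Section linfty_space.
Variable R : realType.

Definition linfty_ball M (u : linfty R) := `|u| <= M.

Lemma linfty_ball_le M M' u : M <= M' -> linfty_ball M u -> linfty_ball M' u.
Proof. by move=> MM' /le_trans; exact. Qed.

Lemma linfty_ball0 M : 0 < M -> linfty_ball M 0.
Proof. by move=> M0; rewrite /linfty_ball normr0 ltW. Qed.

Lemma linfty_ballD : exists2 K, 0 < K & forall M u v, 0 < M ->
  linfty_ball M u -> linfty_ball M v -> linfty_ball (K * M) (u + v).
Proof.
exists 2 => // M u v M0 uM vM; apply: le_trans (ler_normD _ _) _.
rewrite /linfty_ball in uM vM; lra.
Qed.

Lemma linfty_ballZ a : exists2 K, 0 < K & forall M u, 0 < M ->
  linfty_ball M u -> linfty_ball (K * M) (a *: u).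
Proof.
have a0 := normr_ge0 a; exists (`|a| + 1) => [|M u M0 uM]; first by lra.
rewrite /linfty_ball normrZ; apply: ler_pM => //; lra.
Qed.

Definition glinfty : gauged R :=
  Gauged linfty_ball_le linfty_ball0 linfty_ballD linfty_ballZ.

Lemma gbounded_linfty (u : glinfty) : gbounded u.
Proof.
have := normr_ge0 (u : linfty R) => u0.
by exists (`|u : linfty R| + 1); rewrite /= /linfty_ball; lra.
Qed.

Lemma nbhs_linftyP (u : linfty R) (A : set (linfty R)) :
  nbhs u A <-> exists2 r, 0 < r & forall v, `|v - u| <= r -> A v.
Proof.
have nP := @nbhs_normP R (linfty R) u A.
split=> [/nP[r /= r0 rA]|[r r0 rA]].
  exists (r / 2) => [|v uv]; first by rewrite divr_gt0.
  apply: rA => /=; rewrite distrC.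
  by rewrite (le_lt_trans uv)// ltr_pdivrMr// ltr_pMr// ltr1n.
apply/nP; exists r => //= v; rewrite /ball_/= distrC => /ltW.
exact: rA.
Qed.

End linfty_space.

Section isomorphic_of_bounded.
Variable R : realType.

(** The hypotheses on NE and NF say that their balls are a basis of neighborhoods. *)
Lemma bounded_linear_continuous (E F : preTopologicalLmodType R)
    (NE : E -> R) (NF : F -> R) (f : E -> F) :
  (forall u A, nbhs u A <-> exists2 r, 0 < r & forall v, NE (v - u) <= r -> A v) ->
  (forall u A, nbhs u A <-> exists2 r, 0 < r & forall v, NF (v - u) <= r -> A v) ->
  linear f ->
  (exists2 K, 0 < K & forall M x, 0 < M -> NE x <= M -> NF (f x) <= K * M) ->
  continuous f.
Proof.
move=> nE nF lf [K K0 Kf] u A /nF[r r0 rA]; apply/nE.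
exists (r / K) => [|v uv]; first exact: divr_gt0.
apply: rA; have -> : f v - f u = f (v - u).
  by rewrite -scaleN1r addrC -lf scaleN1r addrC.
have := Kf _ _ (divr_gt0 r0 K0) uv.
by rewrite mulrCA divff ?mulr1// gt_eqF.
Qed.

Lemma isomorphic_of_bounded (E F : preTopologicalLmodType R)
    (NE : E -> R) (NF : F -> R) (f : E -> F) (g : F -> E) :
  (forall u A, nbhs u A <-> exists2 r, 0 < r & forall v, NE (v - u) <= r -> A v) ->
  (forall u A, nbhs u A <-> exists2 r, 0 < r & forall v, NF (v - u) <= r -> A v) ->
  linear f -> linear g ->
  (exists2 K, 0 < K & forall M x, 0 < M -> NE x <= M -> NF (f x) <= K * M) ->
  (exists2 K, 0 < K & forall M x, 0 < M -> NF x <= M -> NE (g x) <= K * M) ->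
  cancel f g -> cancel g f -> isomorphic E F.
Proof.
move=> nE nF lf lg bf bg fK gK.
pose f' : {linear E -> F} := HB.pack f (GRing.isLinear.Build R E F _ f lf).
exists f', g; split => //.
  exact: bounded_linear_continuous nE nF lf bf.
exact: bounded_linear_continuous nF nE lg bg.
Qed.

Section weakL_iso.
Context d (T : measurableType d) (mu : {measure set T -> \bar R}) (p : R) (p1 : 1 < p).

Lemma isomorphic_weakL d' (T' : measurableType d')
    (mu' : {measure set T' -> \bar R}) :
  giso (gweakL mu p1) (gweakL mu' p1) -> isomorphic (weakL mu p1) (weakL mu' p1).
Proof.
move=> [f [g [[lf bf] [lg bg] gf fg]]].
apply: (@isomorphic_of_bounded _ _ (@weakL_norm _ _ _ mu p p1)
   (@weakL_norm _ _ _ mu' p p1) f g) => //.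
- exact: nbhs_weakLP.
- exact: nbhs_weakLP.
- by move=> a x y; apply: lf; exact: gbounded_weakL.
- by move=> a x y; apply: lg; exact: gbounded_weakL.
- by move=> x; apply: gf; exact: gbounded_weakL.
- by move=> x; apply: fg; exact: gbounded_weakL.
Qed.

Lemma isomorphic_weakL_linfty :
  giso (gweakL mu p1) (glinfty R) -> isomorphic (weakL mu p1) (linfty R).
Proof.
move=> [f [g [[lf bf] [lg bg] gf fg]]].
apply: (@isomorphic_of_bounded _ _ (@weakL_norm _ _ _ mu p p1)
   (fun u : linfty R => `|u|) f g) => //.
- exact: nbhs_weakLP.
- exact: nbhs_linftyP.
- by move=> a x y; apply: lf; exact: gbounded_weakL.
- by move=> a x y; apply: lg; exact: gbounded_linfty.
- by move=> x; apply: gf; exact: gbounded_weakL.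
- by move=> x; apply: fg; exact: gbounded_linfty.
Qed.

End weakL_iso.

End isomorphic_of_bounded.

(** * Kolmogorov's inequality *)

Lemma inv_expr_powR (R : realType) (a p : R) k : 0 < a ->
  (a ^+ k)^-1 `^ p = (a `^ (- p)) ^+ k.
Proof.
move=> a0; elim: k => [|k IH]; first by rewrite !expr0 invr1 powR1.
rewrite !exprS invfM powRM ?invr_ge0 ?exprn_ge0 ?(ltW a0)// IH; congr (_ * _).
by rewrite -[in LHS](powR_inv1 (ltW a0)) -powRrM mulN1r.
Qed.

Section kolmogorov.
Context d (T : measurableType d) (R : realType).
Variables (mu : {measure set T -> \bar R}) (p : R) (p1 : 1 < p).

Let p0 : 0 < p. Proof. exact: lt_trans p1. Qed.

Lemma weak_norm_leP (f : T -> R) (M : R) : 0 < M ->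
  (weak_norm mu p f <= M%:E)%E <->
  (forall c : R, 0 < c -> (mu [set x | c < `|f x|]%R <= ((M / c) `^ p)%:E)%E).
Proof.
move=> M0; split=> [fM c c0|fM].
  have : (c%:E * mu [set x | (c < `|f x|)%R] `^ p^-1 <= M%:E)%E.
    by apply: le_trans fM; apply: ereal_sup_ubound; exists c.
  have : (0 <= mu [set x | (c < `|f x|)%R])%E by [].
  case: (mu _) => [m m0| |//].
    rewrite poweR_EFin -EFinM !lee_fin -ler_pdivlMl// => cm.
    have {}m0 : 0 <= m by rewrite -lee_fin.
    have -> : m = (m `^ p^-1) `^ p by rewrite -powRrM mulVf ?powRr1// gt_eqF.
    apply: ge0_ler_powR; rewrite ?nnegrE ?powR_ge0 ?(ltW p0)//.
      exact/ltW/divr_gt0.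
    by rewrite mulrC.
  by rewrite poweRyr ?invr_eq0 ?gt_eqF// gt0_muley ?lte_fin.
apply: ge_ereal_sup => _ [c /= c0 <-].
have := fM c c0; have : (0 <= mu [set x | (c < `|f x|)%R])%E by [].
case: (mu _) => [m| |]//; rewrite poweR_EFin -EFinM !lee_fin => m0 cm.
rewrite -ler_pdivlMl// mulrC.
have -> : M / c = ((M / c) `^ p) `^ p^-1.
  by rewrite -powRrM mulfV ?gt_eqF// powRr1// ltW// divr_gt0.
by apply: ge0_ler_powR; rewrite ?nnegrE ?powR_ge0// invr_ge0 ltW.
Qed.

Let r := 2 `^ (1 - p) :> R.

Let r01 : 0 < r < 1.
Proof.
rewrite powR_gt0//= -[ltRHS](powRr0 2) /r /powR pnatr_eq0/= ltr_expR.
by rewrite ltr_pM2r ?subr_lt0// ln_gt0// ltr1n.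
Qed.

(** The set where |f| > c is cut along the levels c 2^k. On the k-th slice the
integral of |f| is at most 2 c 2^k (M / (c 2^k))^p, the general term of a geometric
series of ratio 2^(1-p) < 1. *)
Lemma weak_tail_le (f : {mfun T >-> R}) (M c : R) : 0 < M -> 0 < c ->
  (weak_norm mu p f <= M%:E)%E ->
  (\int[mu]_(x in [set x | c < `|f x|]%R) `|f x|%:E <=
    (2 * c * (M / c) `^ p / (1 - r))%:E)%E.
Proof.
move=> M0 c0 /(weak_norm_leP _ M0) fM.
pose ck k : R := c * 2 ^+ k.
have ck0 k : 0 < ck k by rewrite mulr_gt0// exprn_gt0.
have ckle i j : (i <= j)%N -> ck i <= ck j.
  by move=> ij; rewrite ler_pM2l// ler_weXn2l// ler1n.
pose F k := [set x | ck k < `|f x|] `\` [set x | ck k.+1 < `|f x|].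
have mF k : measurable (F k) by apply: measurableD; exact: measurable_norm_gt.
have mf : measurable_fun setT (fun x => `|f x|%:E).
  by apply/measurable_EFinP; exact: measurableT_comp.
have FE : [set x | c < `|f x|] = \bigcup_k F k.
  apply/seteqP; split=> [x /= cf|x [k _ [/= kf _]]]; last first.
    apply: le_lt_trans kf; by have := ckle 0%N k isT; rewrite {1}/ck expr0 mulr1.
  have [n nf] : exists n, `|f x| <= ck n.
    pose n := (Num.truncn (`|f x| / c)).+1; exists n.
    rewrite /ck mulrC -ler_pdivrMr//.
    apply: (@le_trans _ _ n%:R); first by rewrite ltW// truncnS_gt.
    by rewrite -natrX ler_nat ltnW// ltn_expl.
  have exP : exists n, `|f x| <= ck n by exists n.
  case: (ex_minnP exP) => -[|m] fm mmin.
    by move: fm; rewrite /ck expr0 mulr1 leNgt cf.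
  exists m => //; split => /=; last by rewrite ltNge fm.
  by rewrite ltNge; apply/negP => /mmin; rewrite ltnn.
rewrite FE ge0_integral_bigcup//; last 2 first.
- exact: measurable_funTS.
- apply: ltn_trivIset => j i ij; apply/seteqP; split=> // x [[_ /= +] [/= + _]].
  move=> /negP; rewrite -leNgt => fi fj.
  by have := le_lt_trans (le_trans fi (ckle _ _ ij)) fj; rewrite ltxx.
apply: lime_le; first by apply: is_cvg_nneseries => n _ _; exact: integral_ge0.
apply: nearW => n.
pose u := 2 `^ (- p) : R.
have ru : r = 2 * u by rewrite /r powRD ?powRr1// pnatr_eq0 implybT.
have termE k : ck k.+1 * (M / ck k) `^ p = 2 * c * (M / c) `^ p * r ^+ k.
  rewrite /ck invfM mulrA powRM ?ltW ?divr_gt0 ?invr_gt0 ?exprn_gt0//.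
  have -> : ((2 ^+ k)^-1 : R) `^ p = u ^+ k.
    exact: inv_expr_powR.
  by rewrite ru exprMn exprS; ring.
have int_le k : (\int[mu]_(x in F k) `|f x|%:E <=
    (geometric (2 * c * (M / c) `^ p) r k)%:E)%E.
  apply: (@le_trans _ _ (\int[mu]_(x in F k) (cst (ck k.+1)%:E) x)%E).
    apply: ge0_le_integral => //; first exact: measurable_funTS.
    by move=> x [_ /= /negP]; rewrite -leNgt lee_fin.
  rewrite integral_cst//= -termE [leRHS]EFinM lee_pmul2l ?lte_fin//.
  apply: le_trans (fM _ (ck0 k)); rewrite le_measure ?inE//.
    exact: measurable_norm_gt.
  by move=> x [].
apply: (@le_trans _ _ (\sum_(0 <= k < n) (geometric (2 * c * (M / c) `^ p) r k)%:E)%E).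
  exact: lee_sum.
rewrite sumEFin lee_fin; apply: geometric_le_lim.
- by rewrite !mulr_ge0 ?powR_ge0 ?ltW.
- by case/andP: r01.
- by case/andP: r01 => ? ?; rewrite gtr0_norm.
Qed.

Definition kolmogorov_cst := 1 + 2 / (1 - 2 `^ (1 - p)).

Lemma kolmogorov_cst_gt0 : 0 < kolmogorov_cst.
Proof.
have /andP[_ r1] := r01; rewrite /kolmogorov_cst -/r.
by rewrite addr_gt0// divr_gt0// subr_gt0.
Qed.

(** Below the height c = M t^(-1/p) the integral is at most c t, above it the tail
estimate applies; this c makes both contributions multiples of M t^(1-1/p). *)
Lemma kolmogorov (f : {mfun T >-> R}) (phi : T -> R) (M t : R) :
  0 < M -> 0 < t -> (weak_norm mu p f <= M%:E)%E ->
  measurable_fun setT phi -> (forall x, 0 <= phi x <= 1) ->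
  (\int[mu]_x (phi x)%:E <= t%:E)%E ->
  (\int[mu]_x (`|f x| * phi x)%:E <= (kolmogorov_cst * M * t `^ (1 - p^-1))%:E)%E.
Proof.
move=> M0 t0 fM mphi phi01 phit.
have phi0 x : 0 <= phi x by case/andP: (phi01 x).
pose c := M / t `^ p^-1.
have c0 : 0 < c by rewrite divr_gt0// powR_gt0.
have ctE : c * t = M * t `^ (1 - p^-1).
  rewrite /c powRB; last by rewrite (gt_eqF t0) implybT.
  by rewrite powRr1 ?(ltW t0)// mulrA mulrAC.
have McE : (M / c) `^ p = t.
  rewrite /c invf_div mulrCA divff ?gt_eqF// mulr1 -powRrM mulVf ?gt_eqF//.
  by rewrite powRr1 ?ltW.
pose A := [set x | c < `|f x|].
have mA : measurable A by exact: measurable_norm_gt.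
have mf : measurable_fun setT (fun x => `|f x|) by exact: measurableT_comp.
have mfA : measurable_fun setT (fun x => `|f x| * \1_A x).
  by apply: measurable_funM.
have bound : (\int[mu]_x (`|f x| * phi x)%:E <=
    \int[mu]_x ((c * phi x)%:E + (`|f x| * \1_A x)%:E))%E.
  apply: ge0_le_integral => //.
  - by move=> x _; rewrite lee_fin mulr_ge0.
  - by apply/measurable_EFinP; exact: measurable_funM.
  - by apply: emeasurable_funD; apply/measurable_EFinP => //; exact: measurable_funM.
  move=> x _; rewrite lee_fin indicE; have /andP[_ phi1] := phi01 x.
  have [cf|fc] := ltP c `|f x|; last first.
    rewrite memNset ?mulr0 ?addr0 ?ler_wpM2r//.
    by rewrite /A /=; apply/negP; rewrite -leNgt.
  rewrite mem_set//= mulr1; apply: (@le_trans _ _ `|f x|); first by rewrite ler_piMr.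
  by rewrite lerDr mulr_ge0 // ltW.
apply: le_trans bound _; rewrite ge0_integralD//; last 3 first.
- by move=> x _; rewrite lee_fin mulr_ge0 // ltW.
- by apply/measurable_EFinP; exact: measurable_funM.
- exact/measurable_EFinP.
have -> : (kolmogorov_cst * M * t `^ (1 - p^-1))%:E =
    ((c * t)%:E + (2 * c * (M / c) `^ p / (1 - r))%:E)%E.
  rewrite McE -EFinD; congr EFin; rewrite /kolmogorov_cst -/r -mulrA -ctE.
  ring.
apply: leeD.
  under eq_integral do rewrite EFinM.
  rewrite ge0_integralZl//; last 3 first.
  - exact/measurable_EFinP.
  - by move=> x _; rewrite lee_fin.
  - by rewrite lee_fin ltW.
  by rewrite [leRHS]EFinM lee_pmul2l ?lte_fin.
rewrite (_ : \int[mu]_x _ = \int[mu]_(x in A) `|f x|%:E)%E.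
  exact: weak_tail_le.
rewrite [RHS]integral_mkcond; apply: eq_integral => x _.
rewrite /patch indicE; case: ifP => _; by rewrite ?mulr1 ?mulr0.
Qed.

End kolmogorov.

(** * Functions on finite blocks *)

Definition bidx n (i : 'I_n) : {n : nat & 'I_n} := Tagged (fun n => 'I_n) i.

Lemma le_powR_of_mul (R : realType) (p M c N : R) : 0 < p -> 0 < M -> 0 < c ->
  0 <= N -> c * N <= M * N `^ (1 - p^-1) -> N <= (M / c) `^ p.
Proof.
move=> p0 M0 c0; rewrite le_eqVlt => /predU1P[<- _|N0 cN]; first exact: powR_ge0.
have -> : N = (N `^ p^-1) `^ p.
  by rewrite -powRrM mulVf ?powRr1 ?(ltW N0)// gt_eqF.
apply: ge0_ler_powR; rewrite ?nnegrE ?powR_ge0 ?(ltW p0)//.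
  exact/ltW/divr_gt0.
rewrite ler_pdivlMr// mulrC -(@ler_pM2r _ (N `^ (1 - p^-1))) ?powR_gt0//.
apply: le_trans cN; rewrite -mulrA -powRD ?(gt_eqF N0) ?implybT//.
by rewrite addrCA subrr addr0 powRr1// ltW.
Qed.

(** The norm of a block is defined by duality, testing against functions with
values in [0, 1]; by Kolmogorov's inequality it is equivalent to the weak l^p norm
for counting measure, but it satisfies the triangle inequality, and weights t
between 0 and 1 are what averages over cells produce. *)
Section blocks.
Variables (R : realType) (p : R) (p1 : 1 < p).
Let p0 : 0 < p. Proof. exact: lt_trans p1. Qed.
Let blocks := {n : nat & 'I_n} -> R.

Let bball M (y : blocks) := forall n (t : 'I_n -> R),
  (forall i, 0 <= t i <= 1) ->
  `|\sum_i y (bidx i) * t i| <= M * (\sum_i t i) `^ (1 - p^-1).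

Let bball_le M M' y : M <= M' -> bball M y -> bball M' y.
Proof.
move=> MM' My n t t01; apply: le_trans (My n t t01) _.
by rewrite ler_wpM2r// powR_ge0.
Qed.

Let bball0 M : 0 < M -> bball M 0.
Proof.
move=> M0 n t t01; rewrite big1 ?normr0 ?mulr_ge0 ?powR_ge0 ?ltW//.
by move=> i _; exact: mul0r.
Qed.

Let bballD : exists2 K, 0 < K & forall M x y, 0 < M ->
  bball M x -> bball M y -> bball (K * M) (x + y).
Proof.
exists 2 => // M x y M0 Mx My n t t01.
under eq_bigr do rewrite [(x + y) _]/(x _ + y _) mulrDl.
rewrite big_split/=; apply: le_trans (ler_normD _ _) _.
by rewrite mulr_natl mulr2n mulrDl; apply: lerD; [exact: Mx|exact: My].
Qed.

Let bballZ a : exists2 K, 0 < K & forall M x, 0 < M ->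
  bball M x -> bball (K * M) (a *: x).
Proof.
have a0 := normr_ge0 a; exists (`|a| + 1) => [|M x M0 Mx n t t01]; first by lra.
under eq_bigr do rewrite [(a *: x) _]/(a * x _) -mulrA.
rewrite -mulr_sumr normrM -mulrA; apply: ler_pM => //; last exact: Mx.
by rewrite lerDl.
Qed.

Definition gblocks : gauged R := Gauged bball_le bball0 bballD bballZ.

Lemma gball_blocksE M (y : gblocks) : gball M y =
  forall n (t : 'I_n -> R), (forall i, 0 <= t i <= 1) ->
  `|\sum_i y (bidx i) * t i| <= M * (\sum_i t i) `^ (1 - p^-1).
Proof. by []. Qed.

(** Testing against the indicator of the set A where y > c gives
c #|A| <= M #|A|^(1-1/p); the factor 2 accounts for the two signs of y. *)
Lemma card_blocks_gt (y : gblocks) (M c : R) n : 0 < M -> 0 < c -> gball M y ->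
  #|[set i : 'I_n | c < `|y (bidx i)|]%SET|%:R <= 2 * (M / c) `^ p.
Proof.
move=> M0 c0 My.
have half (A : {set 'I_n}) : (forall i, i \in A -> c < y (bidx i)) \/
    (forall i, i \in A -> c < - y (bidx i)) -> #|A|%:R <= (M / c) `^ p.
  move=> cA; apply: le_powR_of_mul => //.
  have t01 (i : 'I_n) : 0 <= ((i \in A)%:R : R) <= 1 by case: (i \in A) => /=; rewrite ?lexx ?ler01.
  have := My n _ t01.
  have -> : \sum_(i < n) (i \in A)%:R = #|A|%:R :> R.
    rewrite -sum1_card natr_sum [RHS]big_mkcond; apply: eq_bigr => i _.
    by case: (i \in A).
  apply: le_trans.
  have -> : \sum_i y (bidx i) * (i \in A)%:R = \sum_(i in A) y (bidx i).
    by rewrite [RHS]big_mkcond; apply: eq_bigr => i _; case: ifP; rewrite ?mulr1 ?mulr0.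
  rewrite mulr_natr -sumr_const.
  case: cA => cA; last rewrite -normrN -sumrN.
    by apply: le_trans (ler_norm _); apply: ler_sum => i /cA/ltW.
  by apply: le_trans (ler_norm _); apply: ler_sum => i /cA/ltW.
have -> : ([set i : 'I_n | (c < `|y (bidx i)|)%R] =
    [set i : 'I_n | (c < y (bidx i))%R] :|: [set i : 'I_n | (c < - y (bidx i))%R])%SET.
  by apply/setP => i; rewrite !inE ltr_normr.
apply: (@le_trans _ _ (#|[set i : 'I_n | c < y (bidx i)]%SET|%:R +
    #|[set i : 'I_n | c < - y (bidx i)]%SET|%:R)).
  by rewrite -natrD ler_nat cardsU leq_subr.
rewrite mulr_natl mulr2n; apply: lerD; apply: half.
  by left => i; rewrite inE.
by right => i; rewrite inE.
Qed.

End blocks.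

Section averages.
Context d (T : measurableType d) (R : realType).
Variables (mu : {measure set T -> \bar R}) (p : R) (p1 : 1 < p).

(** Kolmogorov's inequality for the combination of indicators with coefficients
a j * t j; it bounds simultaneously all the block norms of the averages of f. *)
Lemma test_sets_le (f : {mfun T >-> R}) (M e : R) n
    (B : 'I_n -> set T) (a t : 'I_n -> R) :
  0 < M -> 0 < e -> (weak_norm mu p f <= M%:E)%E ->
  (forall j, measurable (B j)) -> (forall j, 0 <= a j) ->
  (forall x, \sum_j a j * \1_(B j) x <= 1) ->
  (forall j, (a j)%:E * mu (B j) <= e%:E)%E ->
  (forall j, 0 <= t j <= 1) ->
  \sum_j t j * (a j * `|\int[mu]_(x in B j) f x|) <=
    kolmogorov_cst p * M * (e * \sum_j t j) `^ (1 - p^-1).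
Proof.
move=> M0 e0 fM mB a0 a1 ae t01.
have t0 j : 0 <= t j by case/andP: (t01 j).
have K0 := kolmogorov_cst_gt0 p1.
have : 0 <= \sum_j t j by exact: sumr_ge0.
rewrite le_eqVlt => /predU1P[/esym st0|st0].
  rewrite big1 ?mulr_ge0 ?powR_ge0 ?(ltW M0) ?(ltW K0)// => j _.
  have /eqP := st0; rewrite psumr_eq0 => [/allP/(_ j)|i _]; last exact: t0.
  by rewrite mem_index_enum => /(_ isT)/eqP ->; rewrite mul0r.
pose phi x := \sum_j t j * (a j * \1_(B j) x).
have aB0 j x : 0 <= a j * \1_(B j) x by rewrite mulr_ge0.
have phi01 x : 0 <= phi x <= 1.
  rewrite sumr_ge0 => [/=|j _]; last by rewrite mulr_ge0.
  apply: le_trans (a1 x); apply: ler_sum => j _.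
  by rewrite ler_piMl//; case/andP: (t01 j).
have mterm j : measurable_fun setT (fun x => t j * (a j * \1_(B j) x)).
  by do 2 apply: measurable_funM => //.
have mphi : measurable_fun setT phi by exact: measurable_sum.
have int_phi : (\int[mu]_x (phi x)%:E <= (e * \sum_j t j)%:E)%E.
  rewrite /phi; under eq_integral do rewrite -sumEFin.
  rewrite ge0_integral_sum//; last 2 first.
  - by move=> j; exact/measurable_EFinP.
  - by move=> j x _; rewrite lee_fin mulr_ge0.
  rewrite mulr_sumr -sumEFin; apply: lee_sum => j _.
  under eq_integral do rewrite EFinM EFinM.
  rewrite ge0_integralZl//; last 3 first.
  - by apply: emeasurable_funM => //; exact/measurable_EFinP.
  - by move=> x _; rewrite -EFinM lee_fin.
  - by rewrite lee_fin.
  rewrite ge0_integralZl//; last 2 first.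
  - exact/measurable_EFinP.
  - by rewrite lee_fin.
  rewrite integral_indic// setIT mulrC EFinM; apply: lee_wpmul2l; rewrite ?lee_fin//.
have := kolmogorov p1 M0 (mulr_gt0 e0 st0) fM mphi phi01 int_phi.
rewrite -lee_fin; apply: le_trans.
have mf : measurable_fun setT (fun x => `|f x|) by exact: measurableT_comp.
have mfterm j : measurable_fun setT (fun x => `|f x| * (t j * (a j * \1_(B j) x))).
  exact: measurable_funM.
rewrite -sumEFin /phi; under [leRHS]eq_integral do rewrite mulr_sumr -sumEFin.
rewrite ge0_integral_sum//; last 2 first.
- by move=> j; exact/measurable_EFinP.
- by move=> j x _; rewrite lee_fin !mulr_ge0.
apply: lee_sum => j _.
rewrite (_ : \int[mu]_x _ = (t j * a j)%:E * \int[mu]_(x in B j) `|f x|%:E)%E.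
  rewrite mulrA EFinM lee_wpmul2l ?lee_fin ?mulr_ge0//.
  rewrite /Rintegral; set I := integral _ _ _.
  have mfB : measurable_fun (B j) (fun x => (f x)%:E).
    by apply/measurable_EFinP; apply: measurable_funTS.
  have := le_abse_integral mu (mB j) mfB; rewrite -/I; apply: le_trans.
  by case: I => [r| |]//=; rewrite normr0 leey.
rewrite [in RHS]integral_mkcond -ge0_integralZl//; last 3 first.
- apply/(measurable_restrictT _ _).1 => //.
  by apply/measurable_EFinP; exact: measurable_funTS.
- by move=> x _; rewrite erestrict_ge0.
- by rewrite lee_fin mulr_ge0.
apply: eq_integral => x _; rewrite /patch indicE; case: ifP => _ /=.
  by rewrite -EFinM mulr1 mulrC.
by rewrite !mulr0 mule0.
Qed.

Lemma weak_integrable (f : {mfun T >-> R}) (B : set T) :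
  (weak_norm mu p f < +oo)%E -> measurable B -> (mu B < +oo)%E ->
  mu.-integrable B (EFin \o f).
Proof.
move=> foo mB Boo; apply/integrableP; split.
  by apply/measurable_EFinP; exact: measurable_funTS.
have fm : (fine (weak_norm mu p f))%:E = weak_norm mu p f.
  by rewrite fineK// ge0_fin_numE// weak_norm_ge0.
have m0 : (fine (mu B))%:E = mu B by rewrite fineK// ge0_fin_numE.
have M0 : 0 < fine (weak_norm mu p f) + 1.
  by rewrite ltr_wpDl// fine_ge0// weak_norm_ge0.
have t0 : 0 < fine (mu B) + 1 by rewrite ltr_wpDl// fine_ge0.
have mf : measurable_fun setT (fun x => `|f x|) by exact: measurableT_comp.
rewrite (_ : integral _ _ _ = \int[mu]_x (`|f x| * \1_B x)%:E)%E; last first.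
  rewrite integral_mkcond; apply: eq_integral => x _.
  by rewrite /patch indicE; case: ifP => _ /=; rewrite ?mulr1 ?mulr0.
apply: le_lt_trans (kolmogorov p1 M0 t0 _ _ _ _) (ltry _) => //.
- by rewrite EFinD fm leeDl.
- by move=> x; rewrite indicE; case: (x \in B); rewrite ?lexx ?ler01.
- by rewrite integral_indic// setIT EFinD m0 leeDl.
Qed.

End averages.

(** At most N terms exceed half of the largest one and they add up to at most N
times the largest; the others are at most half of it, so that the induction
hypothesis bounds their sum by N times the largest as well. *)
Lemma sparse_sum (R : realType) (s : seq nat) (y : nat -> R) (N : nat) (L : R) :
  0 <= L -> (forall i, i \in s -> 0 < y i <= L) ->
  (forall e : R, 0 < e -> (count (fun i => (e <= y i <= 2 * e)%R) s <= N)%N) ->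
  \sum_(i <- s) y i <= 2 * N%:R * L.
Proof.
move=> L0 + sN; have [n] := ubnP (size s).
elim: n s L L0 sN => // n IH s L L0 sN; rewrite ltnS => sn yL.
have [->|s0] := eqVneq s [::]; first by rewrite big_nil !mulr_ge0.
have [i0 i0s i0max] : exists2 i0, i0 \in s & forall i, i \in s -> y i <= y i0.
    elim: (s) s0 => // a l IHl _; have [->|l0] := eqVneq l [::].
      by exists a; rewrite ?mem_head// => j; rewrite inE => /eqP ->.
    have [i il iM] := IHl l0; have [ai|ia] := leP (y a) (y i).
      exists i; first by rewrite inE il orbT.
      by move=> j; rewrite inE => /predU1P[->//|/iM].
    exists a; first exact: mem_head.
    move=> j; rewrite inE => /predU1P[->//|/iM jM].
    exact: le_trans jM (ltW ia).
have /andP[y00 y0L] := yL _ i0s.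
pose big i := y i0 / 2 <= y i.
have h0 : 0 < y i0 / 2 by rewrite divr_gt0.
rewrite (bigID big)/=.
have bigs : \sum_(i <- s | big i) y i <= N%:R * y i0.
  apply: (@le_trans _ _ (\sum_(i <- s | big i) y i0)).
    by rewrite big_seq_cond [leRHS]big_seq_cond; apply: ler_sum => i /andP[/i0max].
  rewrite big_const_seq iter_addr_0 -[leLHS]mulr_natl ler_wpM2r ?(ltW y00)// ler_nat.
  apply: leq_trans (sN _ h0); rewrite -!size_filter.
  rewrite -(@eq_in_filter _ (fun i => y i0 / 2 <= y i <= 2 * (y i0 / 2)))//.
  move=> i /i0max; rewrite /big mulrCA divff ?mulr1// => ->.
  by rewrite andbT.
have smalls : \sum_(i <- s | ~~ big i) y i <= 2 * N%:R * (y i0 / 2).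
  rewrite -big_filter; apply: IH; first exact: ltW.
  - move=> e e0; apply: leq_trans (sN _ e0).
    by rewrite count_filter; apply: sub_count => i /andP[].
  - rewrite size_filter; apply: leq_trans sn.
    rewrite -(count_predC big s) -[X in (X < _)%N]add0n ltn_add2r -has_count.
    apply/hasP; exists i0 => //.
    by rewrite /big ler_pdivrMr// ler_peMr ?(ltW y00)// ler1n.
  - move=> i; rewrite mem_filter /big -ltNge => /andP[yi /yL/andP[yi0 _]].
    by rewrite yi0/= ltW.
have : N%:R * y i0 <= N%:R * L by rewrite ler_wpM2l.
lra.
Qed.

(** ** Functions defined piecewise on disjoint sets *)

Section glue.
Context d (T : measurableType d) (R : realType).
Variables (D : nat -> set T) (h : nat -> T -> R).

Definition glue x : R :=
  if pselect (exists k, D k x) is left H then h (projT1 (cid H)) x else 0.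

Hypothesis tD : trivIset setT D.

Lemma glueE k x : D k x -> glue x = h k x.
Proof.
move=> Dkx; rewrite /glue; case: pselect => [H|[]]; last by exists k.
case: cid => j /= Djx; congr h; apply: tD => //.
by exists x; split.
Qed.

Lemma glue_out x : (forall k, ~ D k x) -> glue x = 0.
Proof.
move=> nD; rewrite /glue; case: pselect => // H.
by case: (nD (projT1 (cid H))); case: cid.
Qed.

Hypothesis mD : forall k, measurable (D k).
Hypothesis mh : forall k, measurable_fun (D k) (h k).

Lemma measurable_glue : measurable_fun setT glue.
Proof.
rewrite -(setUv (\bigcup_k D k)); apply/measurable_funU.
- exact: bigcup_measurable.
- by apply: measurableC; exact: bigcup_measurable.
split.
  apply/measurable_fun_bigcup => // k; apply: (eq_measurable_fun (h k)) => // x.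
  by rewrite inE => /glueE ->.
apply: (eq_measurable_fun (fun=> 0 : R)) => // x; rewrite inE => nDx.
by rewrite glue_out// => k Dkx; apply: nDx; exists k.
Qed.

HB.instance Definition _ := isMeasurableFun.Build _ _ _ _ glue measurable_glue.

Definition glue_mfun : {mfun T >-> R} := glue.

Variables (mu : {measure set T -> \bar R}) (p : R).
Hypothesis p1 : 1 < p.

Lemma weak_norm_glue (M : R) : 0 < M ->
  (forall c : R, 0 < c -> forall K,
    (\sum_(k < K) mu (D k `&` [set x | (c < `|h k x|)%R]) <= ((M / c) `^ p)%:E)%E) ->
  (weak_norm mu p glue <= M%:E)%E.
Proof.
move=> M0 hM; apply/(weak_norm_leP _ p1 _ M0) => c c0.
pose A k := D k `&` [set x | c < `|h k x|].
have mA k : measurable (A k).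
  have : measurable_fun (D k) (fun x => `|h k x|) by exact: measurableT_comp.
  move=> /(_ (mD k) _ (measurable_itv `]c, +oo[)); congr measurable.
  by apply/seteqP; split=> x /=; rewrite in_itv/= andbT.
have sub : [set x | c < `|glue x|] `<=` \bigcup_k A k.
  move=> x /= cx; have [[k Dkx]|nD] := pselect (exists k, D k x).
    by exists k => //; split=> //=; rewrite -(glueE Dkx).
  by move: cx; rewrite glue_out ?normr0 ?ltNge ?(ltW c0)// => k Dkx; apply: nD; exists k.
apply: le_trans (measure_sigma_subadditive _ _ _ sub) _ => //.
  exact: (measurable_norm_gt glue_mfun).
apply: lime_le; first exact: is_cvg_nneseries.
by apply: nearW => K; rewrite big_mkord; exact: hM.
Qed.

End glue.

Section weakL_integral.
Context d (T : measurableType d) (R : realType).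
Variables (mu : {measure set T -> \bar R}) (p : R) (p1 : 1 < p).
Implicit Types (u v : weakL mu p1) (B : set T).

(** The value 0 outside the weak L^p space makes the map total. *)
Definition to_weakL (f : {mfun T >-> R}) : weakL mu p1 :=
  if pselect (weak_norm mu p f < +oo)%E is left H
  then projT1 (cid (weakL_fun_onto p1 H)) else 0.

Lemma to_weakLE (f : {mfun T >-> R}) : (weak_norm mu p f < +oo)%E ->
  \forall x \ae mu, weakL_fun (to_weakL f) x = f x.
Proof. by move=> foo; rewrite /to_weakL; case: pselect => // ?; case: cid. Qed.

Lemma to_weakL_norm (f : {mfun T >-> R}) : (weak_norm mu p f < +oo)%E ->
  (weakL_norm (to_weakL f))%:E = weak_norm mu p f.
Proof. by move=> foo; rewrite -weak_norm_fun; exact/eq_weak_norm/to_weakLE. Qed.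

Lemma to_weakL_linear a (f g h : {mfun T >-> R}) :
  (weak_norm mu p f < +oo)%E -> (weak_norm mu p g < +oo)%E ->
  (weak_norm mu p h < +oo)%E -> (forall x, h x = a * f x + g x) ->
  to_weakL h = a *: to_weakL f + to_weakL g.
Proof.
move=> foo goo hoo hE; apply: weakL_fun_inj.
have fg : \forall x \ae mu, weakL_fun (to_weakL f) x = f x /\ weakL_fun (to_weakL g) x = g x.
  by apply: filterS2 (to_weakLE foo) (to_weakLE goo).
have := weakL_funP a (to_weakL f) (to_weakL g).
by apply: filterS3 fg (to_weakLE hoo) => x [-> ->] -> ->.
Qed.

Definition weakL_int u B : R := \int[mu]_(x in B) weakL_fun u x.

Lemma weakL_fun_lty u : (weak_norm mu p (weakL_fun u) < +oo)%E.
Proof. by rewrite weak_norm_fun ltry. Qed.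

Lemma weakL_integrable u B : measurable B -> (mu B < +oo)%E ->
  mu.-integrable B (EFin \o weakL_fun u).
Proof. by move=> mB Boo; apply: (weak_integrable p1) => //; exact: weakL_fun_lty. Qed.

Lemma weakL_int_ae u (f : T -> R) B : measurable B -> measurable_fun B f ->
  (\forall x \ae mu, weakL_fun u x = f x) -> weakL_int u B = \int[mu]_(x in B) f x.
Proof.
move=> mB mf uf; congr fine; apply: ae_eq_integral => //.
- by apply/measurable_EFinP; exact: measurable_funTS.
- exact/measurable_EFinP.
- by apply: filterS uf => x -> _.
Qed.

Lemma weakL_int_linear a u v B : measurable B -> (mu B < +oo)%E ->
  weakL_int (a *: u + v) B = a * weakL_int u B + weakL_int v B.
Proof.
move=> mB Boo; rewrite (weakL_int_ae mB _ (weakL_funP a u v)); last first.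
  by apply: measurable_funTS; apply: measurable_funD => //; exact: measurable_funM.
rewrite RintegralD//; last 2 first.
- exact: (integrableZl mB a (weakL_integrable u mB Boo)).
- exact: weakL_integrable.
by rewrite RintegralZl//; exact: weakL_integrable.
Qed.

(** The exponent of e is the one for which averages over sets of measure e become
values on atoms of mass 1. *)
Lemma weakL_int_test_le u M (e : R) n (B : 'I_n -> set T) (a t : 'I_n -> R) :
  0 < M -> 0 < e -> weakL_norm u <= M ->
  (forall j, measurable (B j)) -> (forall j, 0 <= a j) ->
  (forall x, \sum_j a j * \1_(B j) x <= 1) ->
  (forall j, (a j)%:E * mu (B j) <= e%:E)%E ->
  (forall j, 0 <= t j <= 1) ->
  `|\sum_j e `^ (p^-1 - 1) * (a j * weakL_int u (B j)) * t j| <=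
    kolmogorov_cst p * M * (\sum_j t j) `^ (1 - p^-1).
Proof.
move=> M0 e0 uM mB a0 a1 ae t01; apply: le_trans (ler_norm_sum _ _ _) _.
have t0 j : 0 <= t j by case/andP: (t01 j).
have /= := test_sets_le p1 (f := weakL_fun u) M0 e0 _ mB a0 a1 ae t01.
rewrite weak_norm_fun lee_fin => /(_ uM); rewrite powRM ?(ltW e0) ?sumr_ge0//.
rewrite mulrCA -ler_pdivrMl ?powR_gt0// -powRN opprB mulr_sumr.
apply: le_trans; apply: ler_sum => j _.
rewrite !normrM (ger0_norm (t0 j)) (ger0_norm (a0 j)) (ger0_norm (powR_ge0 _ _)).
by rewrite -mulrA ler_wpM2l ?powR_ge0// mulrC.
Qed.

End weakL_integral.

Lemma measure_bigsetU_le d (T : measurableType d) (R : realType)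
    (mu : {measure set T -> \bar R}) (I : Type) (s : seq I) (P : pred I)
    (B : I -> set T) : (forall i, measurable (B i)) ->
  (mu (\big[setU/set0]_(i <- s | P i) B i) <= \sum_(i <- s | P i) mu (B i))%E.
Proof.
move=> mB; elim: s => [|i s IH]; first by rewrite !big_nil measure0.
rewrite !big_cons; case: ifP => // _.
apply: le_trans (measureU2 _ _ _) _ => //; last by rewrite leeD2l.
exact: bigsetU_measurable.
Qed.

Lemma mem_bigsetU (T : Type) (I : eqType) (s : seq I) (P : pred I)
    (B : I -> set T) i x : i \in s -> P i -> B i x ->
  (\big[setU/set0]_(j <- s | P j) B j) x.
Proof.
move=> + Pi Bi; elim: s => // a s IH; rewrite inE big_cons => /predU1P[<-|/IH is_].
  by rewrite Pi; left.
by case: ifP => // _; right.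
Qed.

Section rich.
Context d (T : measurableType d) (R : realType).
Variables (mu : {measure set T -> \bar R}) (p : R) (p1 : 1 < p).

(** The sets B k i with i < sz k form the k-th block, of scale between e k and
sz k * e k. The last clause separates the scales of distinct nonempty blocks. *)
Definition rich := forall sz : nat -> nat,
  exists (e : nat -> R) (B : nat -> nat -> set T),
  [/\ forall k, 0 < e k,
      forall k i, measurable (B k i),
      forall k i, (i < sz k)%N -> ((e k)%:E <= mu (B k i) <= (2 * e k)%:E)%E,
      forall k i l j x, (i < sz k)%N -> (j < sz l)%N -> B k i x -> B l j x ->
        k = l /\ i = j &
      forall k l, k <> l -> (0 < sz k)%N -> (0 < sz l)%N ->
        2 * ((sz k)%:R * e k) < e l \/ 2 * ((sz l)%:R * e l) < e k].

(** The blocks are numbered by triples: the block of code (a, b, n) receives the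
component of size n of the term (a, b) of a double sequence. Codes of no triple
decode to size 0, hence to an empty block. *)
Definition block_decode (k : nat) : nat * nat * nat := odflt (0, 0, 0)%N (unpickle k).

Lemma block_decodeK c : block_decode (pickle c) = c.
Proof. by rewrite /block_decode pickleK. Qed.

(** The embedding spreads each component, suitably rescaled, over its block; the
retraction takes averages over the sets of the blocks. The separation of the scales
bounds the embedding. *)
Lemma gretract_rich : rich -> gretract (gseq (gseq (gblocks p))) (gweakL mu p1).
Proof.
have p0 : 0 < p by exact: lt_trans p1.
pose sz k := (block_decode k).2; move=> /(_ sz).
move=> [e [B [e0 mB muB dB sepB]]].
pose Z := gseq (gseq (gblocks p)).
have Boo k i : (i < sz k)%N -> (mu (B k i) < +oo)%E.
  by move=> ik; have /andP[_ /le_lt_trans->//] := muB k i ik; rewrite ltry.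
pose zc (z : Z) k (i : 'I_(sz k)) : R :=
  z (block_decode k).1.1 (block_decode k).1.2 (bidx i).
pose D k := \bigcup_(i in [set i | (i < sz k)%N]) B k i.
pose h (z : Z) k x : R := \sum_(i < sz k) e k `^ (- p^-1) * zc z k i * \1_(B k i) x.
have mD k : measurable (D k) by apply: bigcup_measurable.
have mh z k : measurable_fun (D k) (h z k).
  by apply: measurable_sum => i; apply: measurable_funM => //; exact: measurable_funTS.
have tD : trivIset setT D.
  move=> k l _ _ [x [[i ik ix] [j jl jx]]].
  by have [] := dB _ _ _ _ _ ik jl ix jx.
have hE z k (i : 'I_(sz k)) x : B k i x -> h z k x = e k `^ (- p^-1) * zc z k i.
  move=> ix; rewrite /h (bigD1 i)//= indicE mem_set// mulr1 big1 ?addr0// => j ji.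
  rewrite indicE memNset ?mulr0// => jx.
  by have [_ /val_inj ij] := dB _ _ _ _ _ (ltn_ord j) (ltn_ord i) jx ix; rewrite ij eqxx in ji.
pose F z : {mfun T >-> R} := glue_mfun tD mD (mh z).
have F_le : forall M z, 0 < M -> gball M z -> (weak_norm mu p (F z) <= (8 * M)%:E)%E.
  move=> M z M0 Mz; have M80 : 0 < 8 * M by rewrite mulr_gt0.
  apply: (weak_norm_glue tD mD (mh z) p1 M80) => c c0 K.
  pose L := (M / c) `^ p.
  have L0 : 0 < L by rewrite powR_gt0// divr_gt0.
  (* The number of values above the height c is at most sz k, and at most 2 L / e k;
     so the measure of the k-th block that counts is at most 2 y k, and 0 if
     e k > 2 L. Separation makes at most one y k fall in each [w, 2 w]. *)
  pose y k := Num.min ((sz k)%:R * e k) (2 * L).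
  pose good k := (0 < sz k)%N && (e k <= 2 * L).
  have y0 k : (0 < sz k)%N -> 0 < y k.
    by move=> k0; rewrite lt_min !mulr_gt0// ltr0n.
  have ge1 k : (0 < sz k)%N -> e k <= (sz k)%:R * e k.
    by move=> k0; rewrite ler_peMl ?(ltW (e0 k))// ler1n.
  have mu_le k : (mu (D k `&` [set x | (c < `|h z k x|)%R]) <=
      (2 * (if good k then y k else 0))%:E)%E.
    have ek := e0 k; have epk : 0 < e k `^ p^-1 by exact: powR_gt0.
    pose A := [set i : 'I_(sz k) | c * e k `^ p^-1 < `|zc z k i|]%SET.
    have Asz : #|A|%:R * e k <= (sz k)%:R * e k.
      by rewrite ler_pM2r// ler_nat -[leqRHS]card_ord max_card.
    have AL : #|A|%:R * e k <= 2 * L.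
      have := card_blocks_gt p1 (sz k) M0 (mulr_gt0 c0 epk) (Mz _ _).
      move=> /(_ (block_decode k).1.1 (block_decode k).1.2).
      rewrite -/(zc z k) -ler_pdivlMr// => /le_trans -> //.
      rewrite invfM mulrA powRM ?invr_ge0 ?divr_ge0 ?(ltW epk) ?(ltW M0) ?(ltW c0)//.
      rewrite -/L -powRN -powRrM mulNr mulVf ?gt_eqF// powR_inv1 ?mulrA//.
      exact: ltW.
    have Agood : #|A|%:R * e k <= if good k then y k else 0.
      have [A0|] := posnP #|A|; first by rewrite A0 mul0r; case: ifP => // /andP[/y0/ltW].
      move=> A0; have k0 : (0 < sz k)%N.
        by apply: leq_trans A0 _; rewrite -[leqRHS]card_ord max_card.
      rewrite /good k0/= (le_trans _ AL) ?ler_peMl ?(ltW ek)// ?ler1n//.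
      by rewrite le_min Asz AL.
    apply: (@le_trans _ _ (mu (\big[setU/set0]_(i in A) B k i))).
      rewrite le_measure ?inE//.
      - have : measurable_fun (D k) (fun x => `|h z k x|) by exact: measurableT_comp.
        move=> /(_ (mD k) _ (measurable_itv `]c, +oo[)); congr measurable.
        by apply/seteqP; split=> x /=; rewrite in_itv/= andbT.
      - exact: bigsetU_measurable.
      move=> x [[i ik ix]] /=; rewrite (hE z k (Ordinal ik))// normrM.
      rewrite (ger0_norm (powR_ge0 _ _)) powRN ltr_pdivlMl// mulrC => zi.
      apply: (mem_bigsetU (i := Ordinal ik)) => //; first exact: mem_index_enum.
      by rewrite inE.
    apply: le_trans (measure_bigsetU_le _ _ _ _) _ => //.
    apply: (@le_trans _ _ (\sum_(i in A) (2 * e k)%:E)).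
      by apply: lee_sum => i _; case/andP: (muB k i (ltn_ord i)).
    rewrite sumEFin lee_fin sumr_const -[leLHS]mulr_natl mulrCA.
    by rewrite ler_pM2l.
  apply: (@le_trans _ _ (\sum_(k < K) (2 * (if good k then y k else 0))%:E)).
    exact: lee_sum.
  rewrite sumEFin lee_fin -mulr_sumr -big_mkcond/=.
  rewrite -(big_mkord good y) /index_iota subn0 -big_filter.
  have spsum := @sparse_sum R [seq k <- iota 0 K | good k] y 1 (2 * L).
  apply: (@le_trans _ _ (2 * (2 * 1 * (2 * L)))).
    rewrite ler_pM2l//; apply: spsum.
    - by rewrite mulr_ge0// ltW.
    - move=> k; rewrite mem_filter => /andP[/andP[k0 kL] _].
      by rewrite y0//= ge_min lexx orbT.
    - move=> w w0; rewrite leqNgt -size_filter; apply/negP.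
      set s := [seq k <- [seq k <- iota 0 K | good k] | _].
      have us : uniq s by rewrite !filter_uniq ?iota_uniq.
      have sP k : k \in s -> [/\ (0 < sz k)%N, e k <= 2 * L & w <= y k <= 2 * w].
        by rewrite !mem_filter => /andP[ykw /andP[/andP[? ?] _]].
      have sep k l : k \in s -> l \in s -> ~ 2 * ((sz k)%:R * e k) < e l.
        move=> /sP[k0 _ /andP[yk _]] /sP[l0 el /andP[_ yl]] kl.
        have ely : e l <= y l by rewrite le_min ge1// el.
        have yks : y k <= (sz k)%:R * e k by rewrite ge_min lexx.
        lra.
      case: s us sP sep => [|k [|l s]]//= /andP[+ _] sP sep _.
      rewrite inE negb_or => /andP[/eqP kl _].
      have ks : k \in [:: k, l & s] by rewrite mem_head.
      have ls : l \in [:: k, l & s] by rewrite !inE eqxx orbT.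
      have [[k0 _ _] [l0 _ _]] := (sP _ ks, sP _ ls).
      by have [|] := sepB _ _ kl k0 l0; apply: sep.
  have -> : (8 * M / c) `^ p = 8 `^ p * L.
    by rewrite -mulrA powRM// divr_ge0 ?(ltW M0) ?(ltW c0).
  have -> : 2 * (2 * 1 * (2 * L)) = 8 * L by ring.
  by rewrite ler_pM2r// le1r_powR ?(ltW p1)// ler1n.
have FP a z w x : F (a *: z + w) x = a * F z x + F w x.
  have [[k Dx]|nD] := pselect (exists k, D k x); last first.
    by rewrite /= !glue_out ?mulr0 ?addr0// => k Dx; apply: nD; exists k.
  rewrite /= !(glueE _ tD Dx) /h mulr_sumr -big_split/=; apply: eq_bigr => i _.
  rewrite [zc (a *: z + w) k i](_ : _ = a * zc z k i + zc w k i)//.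
  by rewrite mulrDr mulrDl; congr (_ + _); ring.
have Foo z : gbounded z -> (weak_norm mu p (F z) < +oo)%E.
  by move=> [M M0 Mz]; apply: le_lt_trans (F_le M z M0 Mz) (ltry _).
pose J (z : Z) : gweakL mu p1 := to_weakL mu p1 (F z).
have bJ : bounded_linear J.
  split=> [a z w bz bw|].
    apply: to_weakL_linear; [exact: Foo..| |exact: FP].
    by apply/Foo/gboundedD => //; exact: gboundedZ.
  exists 8 => // M z M0 Mz.
  rewrite /= /weakL_ball -lee_fin to_weakL_norm; first exact: F_le.
  by apply: Foo; exists M.
pose q k i : R := (fine (mu (B k i)))^-1 * e k.
pose Q (u : gweakL mu p1) : Z := fun a b w =>
  let k := pickle (a, b, tag w) in
  e k `^ (p^-1 - 1) * (q k (tagged w) * weakL_int u (B k (tagged w))).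
have muE k i : (i < sz k)%N -> [/\ (fine (mu (B k i)))%:E = mu (B k i),
    0 < fine (mu (B k i)) & e k <= fine (mu (B k i))].
  move=> ik; have muf : (fine (mu (B k i)))%:E = mu (B k i).
    by rewrite fineK// ge0_fin_numE// Boo.
  have /andP[+ _] := muB k i ik; rewrite -muf lee_fin => ek.
  by split => //; exact: lt_le_trans ek.
have szE (a b n : nat) : sz (pickle (a, b, n)) = n by rewrite /sz block_decodeK.
have bQ : bounded_linear Q.
  split=> [a u v _ _|].
    apply/funext => i; apply/funext => j; apply/funext => -[n w].
    rewrite [RHS](_ : _ = a * Q u i j (Tagged _ w) + Q v i j (Tagged _ w))//.
    rewrite /Q /= weakL_int_linear//; last by apply: Boo; rewrite szE.
    ring.
  exists (kolmogorov_cst p); first exact: kolmogorov_cst_gt0.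
  move=> M u M0 uM.
  rewrite !gball_seqE => a; rewrite gball_seqE => b; rewrite gball_blocksE => n t t01.
  rewrite /Q /=; set k := pickle _.
  have kn : sz k = n by exact: szE.
  have := @weakL_int_test_le _ _ _ mu p p1 u M (e k) n (fun j => B k j) (fun j => q k j) t
    M0 (e0 k) uM.
  apply => //.
  - by move=> j; rewrite /q mulr_ge0 ?invr_ge0 ?(ltW (e0 k))// fine_ge0.
  - move=> x.
    have [[i ix]|nx] := pselect (exists i : 'I_n, B k i x); last first.
      rewrite big1// => i _; rewrite indicE memNset ?mulr0// => ix.
      by apply: nx; exists i.
    rewrite (bigD1 i)//= indicE mem_set// mulr1 big1 ?addr0.
      have [_ m0 em] := muE k i (eq_ind_r (fun m => (i < m)%N) (ltn_ord i) kn).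
      by rewrite /q mulrC ler_pdivrMr// mul1r.
    move=> j ji; rewrite indicE memNset ?mulr0// => jx.
    have [||_ /val_inj ij] := dB k j k i x _ _ jx ix; rewrite ?kn//.
    by rewrite ij eqxx in ji.
  - move=> j.
    have [<- m0 em] := muE k j (eq_ind_r (fun m => (j < m)%N) (ltn_ord j) kn).
    by rewrite -EFinM /q mulrAC mulVf ?mul1r// gt_eqF.
exists J, Q; split=> // z bz.
apply/funext => a; apply/funext => b; apply/funext => -[n i].
rewrite /Q /=; set k := pickle _.
have kn : sz k = n by exact: szE.
have ik : (i < sz k)%N by rewrite kn.
have [mf m0 em] := muE k i ik.
rewrite (weakL_int_ae (mB k i) _ (to_weakLE p1 (Foo z bz))); last exact: measurable_funTS.
rewrite (@eq_Rintegral _ _ _ mu (B k i) (fun=> e k `^ (- p^-1) * z a b (Tagged _ i))).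
  rewrite Rintegral_cst// /q powRB ?powRr1 ?(gt_eqF (e0 k)) ?implybT ?(ltW (e0 k))//.
  rewrite powRN; have := e0 k; have : 0 < e k `^ p^-1 by exact: powR_gt0.
  move=> ep ek; set m := fine _ in m0 *; set zz := z a b _.
  by field; rewrite !gt_eqF.
move=> x; rewrite inE => ix /=.
have Dx : D k x by exists i.
rewrite (glueE _ tD Dx) (hE z k (Ordinal ik))//; congr (_ * _).
(* The index i has a type depending on the size of the block, so the decoding of k is
   generalized before it is computed. *)
have dec c (cE : c = (a, b, n)) (ic : (i < c.2)%N) :
    z c.1.1 c.1.2 (bidx (Ordinal ic)) = z a b (Tagged _ i).
  subst c; congr (z a b _); rewrite /bidx; congr (Tagged _ _).
  exact: val_inj.
exact: (dec _ (block_decodeK _)).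
Qed.

End rich.

(** * Measures with many sets of comparable size *)

Section rich_greedy.
Context d (T : measurableType d) (R : realType).
Variable (mu : {measure set T -> \bar R}).

Definition is_block (U : set T) n (a b e : R) (B : nat -> set T) :=
  [/\ 0 < e,
      forall i, measurable (B i),
      forall i, (i < n)%N -> (e%:E <= mu (B i) <= (2 * e)%:E)%E,
      forall i j x, (i < n)%N -> (j < n)%N -> B i x -> B j x -> i = j &
      (forall i x, (i < n)%N -> B i x -> ~ U x) /\
      (2 * (n%:R * e) < a \/ b < e)].

(** Blocks are chosen one after the other. The bounds a and b record the smallest e
and the largest 2 n e used so far, U the points already used, and adm is an
invariant that keeps enough room outside U. *)
Lemma rich_greedy (adm : set T -> Prop) : adm set0 ->
  (forall U n a b, adm U -> 0 < a -> 0 < b ->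
    exists e B, is_block U n a b e B /\
      adm (U `|` \bigcup_(i in [set i | (i < n)%N]) B i)) ->
  rich mu.
Proof.
move=> adm0 admS sz.
pose state := (set T * R * R)%type.
pose valid (s : state) := [/\ adm s.1.1, 0 < s.1.2 & 0 < s.2].
pose next (s : state) n (y : R * (nat -> set T)) : state :=
  (s.1.1 `|` \bigcup_(i in [set i | (i < n)%N]) y.2 i,
   Num.min s.1.2 y.1, Num.max s.2 (2 * (n%:R * y.1))).
pose good (sn : state * nat) y := valid sn.1 ->
  is_block sn.1.1.1 sn.2 sn.1.1.2 sn.1.2 y.1 y.2 /\ valid (next sn.1 sn.2 y).
have /choice[f fP] : forall sn, exists y, good sn y.
  move=> [[[U a] b] n]; rewrite /good /=.
  have [[Ua a0 b0]|nv] := pselect (valid (U, a, b)); last first.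
    by exists (1, fun=> set0) => /nv.
  have [e [B [blk Ub]]] := admS U n a b Ua a0 b0.
  exists (e, B) => _; split => //; split => //=.
    by case: blk => e0 *; rewrite lt_min a0.
  by rewrite lt_max b0.
pose st := fix st k : state :=
  if k is k'.+1 then next (st k') (sz k') (f (st k', sz k')) else (set0, 1, 1).
have stV k : valid (st k).
  by elim: k => [|k IH]; [split => //=|have [_] := fP (st k, sz k) IH].
have blk k := (fP (st k, sz k) (stV k)).1.
pose e k := (f (st k, sz k)).1; pose B k := (f (st k, sz k)).2.
have mono l k : (l < k)%N -> [/\ (st k).1.2 <= e l, 2 * ((sz l)%:R * e l) <= (st k).2 &
    forall i x, (i < sz l)%N -> B l i x -> (st k).1.1 x].
  elim: k => // k IH; rewrite ltnS leq_eqVlt => /predU1P[->|/IH[ae be UB]].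
    split=> /=; first by rewrite ge_min lexx orbT.
      by rewrite le_max lexx orbT.
    by move=> i x ik Bx; right; exists i.
  split=> /=; first by rewrite ge_min ae.
    by rewrite le_max be.
  by move=> i x il Bx; left; exact: UB Bx.
exists e, B; split.
- by move=> k; case: (blk k).
- by move=> k; case: (blk k).
- by move=> k; case: (blk k).
- move=> k i l j x ik jl ix jx.
  have dk : forall k l i j,
      (l < k)%N -> (i < sz k)%N -> (j < sz l)%N -> B k i x -> B l j x -> False.
    move=> {i j ik jl ix jx}k {}l i j lk ik jl ix jx.
    have [_ _ UB] := mono _ _ lk; have [_ _ _ _ [nU _]] := blk k.
    exact: nU ik ix (UB _ _ jl jx).
  have [kl|lk|kl] := ltngtP k l.
  - by case: (dk _ _ _ _ kl jl ik jx ix).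
  - by case: (dk _ _ _ _ lk ik jl ix jx).
  subst l; split => //; have [_ _ _ dB _] := blk k.
  exact: dB jx.
- have sep : forall k l, (l < k)%N ->
      2 * ((sz k)%:R * e k) < e l \/ 2 * ((sz l)%:R * e l) < e k.
    move=> k l lk; have [ae be _] := mono _ _ lk; have [_ _ _ _ [_ [h|h]]] := blk k.
      by left; exact: lt_le_trans h ae.
    by right; exact: le_lt_trans be h.
  move=> k l /eqP; rewrite neq_ltn => /orP[/sep|/sep].
    by case=> ?; [right|left].
  by case=> ?; [left|right].
Qed.

End rich_greedy.

Section rich_family.
Context d (T : measurableType d) (R : realType).
Variable (mu : {measure set T -> \bar R}).
Variables (C : nat -> set T) (c : nat -> R).
Hypothesis mC : forall j, measurable (C j).
Hypothesis tC : trivIset setT C.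
Hypothesis muC : forall j, mu (C j) = (c j)%:E.

(** The interval from a to b is covered by finitely many dyadic windows. *)
Lemma finite_window : (forall e : R, 0 < e -> exists N, forall j, (N <= j)%N ->
    ~ (e <= c j <= 2 * e)) ->
  forall a b : R, 0 < a -> exists N, forall j, (N <= j)%N -> c j < a \/ b < c j.
Proof.
move=> few a b a0.
have dy K : exists N, forall j, (N <= j)%N -> c j < a \/ a * 2 ^+ K < c j.
  elim: K => [|K [N NP]].
    have [N NP] := few _ a0; exists N => j /NP.
    have [|ac] := ltP (c j) a; first by left.
    by rewrite expr0 mulr1 => ca; right; rewrite ltNge; apply/negP => cja; apply: ca; lra.
  have [N' NP'] := few _ (mulr_gt0 a0 (exprn_gt0 K (ltr0Sn R 1))).
  exists (maxn N N') => j; rewrite geq_max => /andP[/NP cj /NP' nw].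
  case: cj => [|cj]; first by left.
  right; rewrite ltNge; apply/negP => cja; apply: nw.
  by rewrite (ltW cj)/= mulrCA -exprS.
have [K bK] : exists K, b <= a * 2 ^+ K.
  exists (Num.truncn (b / a)).+1; rewrite mulrC -ler_pdivrMr//.
  apply: le_trans (ltW (truncnS_gt _)) _.
  by rewrite -natrX ler_nat ltnW// ltn_expl.
have [N NP] := dy K; exists N => j /NP[|cj]; [by left|right].
exact: le_lt_trans bK cj.
Qed.

Let adm (U : set T) : Prop := exists m, forall j, (m <= j)%N -> forall x, C j x -> ~ U x.

(** If infinitely many masses lie in one window [e0, 2 e0], unions of g of these
sets provide blocks at the arbitrarily large scale g e0. Otherwise every interval
contains finitely many masses, so a window with sufficiently many masses must lie
beyond any prescribed bounds. *)
Lemma rich_family : (forall N, exists2 e : R, 0 < e & exists s : seq nat,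
    [/\ uniq s, size s = N & forall j, j \in s -> e <= c j <= 2 * e]) ->
  rich mu.
Proof.
move=> many; apply: (@rich_greedy _ _ _ mu adm); first by exists 0%N => j _ x _ [].
move=> U n a b [m Um] a0 b0.
have disj i j x : C i x -> C j x -> i = j.
  by move=> ix jx; apply: tC => //; exists x.
have [[e0 e00 A]|few] := pselect (exists2 e : R, 0 < e & forall N,
    exists2 j, (N <= j)%N & e <= c j <= 2 * e); last first.
  have [N NP] : exists N, forall j, (N <= j)%N ->
      c j < a / (2 * n%:R + 1) \/ 2 * b < c j.
    apply: finite_window => [e e0|]; last by rewrite divr_gt0// ltr_wpDl// mulr_ge0.
    apply: contrapT => /forallNP nN; apply: few; exists e => // N.
    have /existsNP[j /not_implyP[Nj /contrapT]] := nN N.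
    by exists j.
  (* At most maxn N m of these indices are below maxn N m; the other ones, at least n,
     have masses outside the forbidden interval and sets that are still unused. *)
  have [e e0 [s [us ss sP]]] := many (maxn N m + n)%N.
  pose P j := (maxn N m <= j)%N; pose s' := [seq j <- s | P j].
  have sz' : (n <= size s')%N.
    have : (size [seq j <- s | predC P j] <= maxn N m)%N.
      rewrite -[leqRHS](size_iota 0); apply: uniq_leq_size.
        exact: filter_uniq.
      by move=> j; rewrite mem_filter mem_iota/= /P -ltnNge add0n => /andP[].
    rewrite !size_filter; have := count_predC P s; rewrite ss.
    by move: (count _ s) (count _ s) => u v; lia.
  have s'P i : (i < n)%N -> [/\ (N <= nth 0%N s' i)%N, (m <= nth 0%N s' i)%N &
      e <= c (nth 0%N s' i) <= 2 * e].
    move=> i_n; have : nth 0%N s' i \in s' by rewrite mem_nth// (leq_trans i_n).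
    by rewrite mem_filter /P geq_max => /andP[/andP[? ?] /sP].
  have us' : uniq s' by exact: filter_uniq.
  exists e, (fun i => C (nth 0%N s' i)); split.
    split => //.
    - by move=> i /s'P[_ _]; rewrite muC !lee_fin.
    - move=> i j x i_n j_n ix jx; have /eqP := disj _ _ _ ix jx.
      by rewrite nth_uniq// ?(leq_trans _ sz')// => /eqP.
    - split => [i x /s'P[_ mi _] ix|]; first exact: Um ix.
      have [->|n0] := posnP n; first by left; rewrite mul0r mulr0.
      have [Ni _ /andP[e1 e2]] := s'P _ n0.
      case: (NP _ Ni) => h; [left|right]; last by lra.
      have := le_lt_trans e1 h; rewrite ltr_pdivlMr; last by rewrite ltr_wpDl// mulr_ge0.
      nra.
  exists (maxn m (\max_(j <- s') j).+1) => j; rewrite geq_max => /andP[mj sj] x jx.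
  case=> [|[i /= i_n ix]]; first exact: Um mj _ jx.
  have : (nth 0%N s' i <= \max_(j <- s') j)%N.
    by apply: (@leq_bigmax_seq _ s' xpredT id); rewrite ?mem_nth ?(leq_trans i_n).
  by rewrite -(disj _ _ _ jx ix); lia.
have {}A N : exists j, (N <= j)%N /\ e0 <= c j <= 2 * e0.
  by have [j] := A N; exists j.
have [nx nxP] := choice A.
pose phi := fix phi k := if k is k'.+1 then nx (phi k').+1 else nx m.
have phiS k : (phi k < phi k.+1)%N by have [] := nxP (phi k).+1.
have phi_mono k l : (k < l)%N -> (phi k < phi l)%N.
  elim: l => // l IH; rewrite ltnS leq_eqVlt => /predU1P[->|/IH kl]; first exact: phiS.
  exact: ltn_trans (phiS l).
have phi_inj : injective phi.
  by move=> k l kl; have [/phi_mono|/phi_mono|//] := ltngtP k l; rewrite kl ltnn.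
have phi_m k : (m <= phi k)%N.
  elim: k => [|k IH]; first by have [] := nxP m.
  exact: leq_trans IH (ltnW (phiS k)).
have phi_w k : e0 <= c (phi k) <= 2 * e0 by case: k => [|k]; apply: (nxP _).2.
(* Groups of g sets of the chosen window reach the scale g e0 > b. *)
pose g := (Num.truncn (b / e0)).+1.
have gb : b < g%:R * e0 by rewrite -ltr_pdivrMr// truncnS_gt.
pose B i := \big[setU/set0]_(r < g) C (phi (i * g + r)%N).
have BP i x : B i x <-> exists2 r, (r < g)%N & C (phi (i * g + r)%N) x.
  rewrite /B -(bigcup_mkord g (fun r => C (phi (i * g + r)%N))).
  split=> [[r rg rx]|[r rg rx]]; exists r => //.
have B_disj i j x : B i x -> B j x -> i = j.
  move=> /BP[r rg rx] /BP[q qg qx]; have /phi_inj E := disj _ _ _ rx qx.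
  have := congr1 (fun k => (k %/ g)%N) E.
  by rewrite !divnMDl// !divn_small// !addn0.
exists (g%:R * e0), B; split.
  split.
  - by rewrite mulr_gt0.
  - by move=> i; exact: bigsetU_measurable.
  - move=> i _; rewrite /B measure_bigsetU_ord//; last first.
      move=> r q _ _ [x [rx qx]]; have /phi_inj /addnI := disj _ _ _ rx qx.
      exact: val_inj.
    rewrite (eq_bigr (fun r : 'I_g => (c (phi (i * g + r)%N))%:E)) => [|r _]; last exact: muC.
    have sc (x : R) : g%:R * x = \sum_(r < g) x by rewrite sumr_const card_ord mulr_natl.
    rewrite sumEFin !lee_fin mulrCA !sc.
    by apply/andP; split; apply: ler_sum => r _; case/andP: (phi_w (i * g + r)%N).
  - by move=> i j x _ _; exact: B_disj.
  - split=> [i x _ /BP[r _ rx]|]; last by right.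
    exact: Um (phi_m _) _ rx.
exists (phi (n * g)%N) => j nj x jx [|[i /= i_n /BP[r rg rx]]].
  exact: Um (leq_trans (phi_m _) nj) _ jx.
move: nj; rewrite (disj _ _ _ jx rx) leqNgt phi_mono//.
by apply: leq_trans (leq_mul i_n (leqnn g)); rewrite mulSn addnC ltn_add2r.
Qed.

End rich_family.

Section divisible.
Context d (T : measurableType d) (R : realType).
Variable (mu : {measure set T -> \bar R}).

(** Smallness of the pieces is measured inside G, so that it passes to subsets of
G; the pieces need not be disjoint. *)
Definition divisible (G : set T) := forall e : R, 0 < e ->
  exists (K : nat) (P : nat -> set T), [/\ forall i, measurable (P i),
    G `<=` \bigcup_(i in [set i | (i < K)%N]) P i &
    forall i, (i < K)%N -> (mu (G `&` P i) <= e%:E)%E].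

Lemma divisibleS G H : measurable G -> measurable H -> H `<=` G ->
  divisible G -> divisible H.
Proof.
move=> mG mH HG dG e e0; have [K [P [mP GP muP]]] := dG e e0.
exists K, P; split=> //; first exact: subset_trans GP.
move=> i iK; apply: le_trans (muP i iK); rewrite le_measure ?inE//.
- exact: measurableI.
- exact: measurableI.
- exact: setSI.
Qed.

(** Pieces of measure at most e are added one at a time, until the measure of the
union first reaches e; the last step adds at most e. *)
Lemma divisible_window H (e : R) : measurable H -> divisible H -> 0 < e ->
  (e%:E <= mu H)%E ->
  exists2 A, measurable A /\ A `<=` H & (e%:E <= mu A <= (2 * e)%:E)%E.
Proof.
move=> mH dH e0 eH; have [K [P [mP HP muP]]] := dH e e0.
pose U k := H `&` \big[setU/set0]_(i < k) P i.
have mU k : measurable (U k) by apply: measurableI => //; exact: bigsetU_measurable.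
have : (e%:E <= mu (U K))%E.
  by rewrite /U setIidl// => x /HP; rewrite bigcup_mkord.
have : forall i, (i < K)%N -> (mu (H `&` P i) <= e%:E)%E by [].
elim: K {HP muP} => [|K IH] muP.
  by rewrite /U big_ord0 setI0 measure0 lee_fin leNgt e0.
have [eK _|Ke eK] := leP e%:E (mu (U K)).
  by apply: IH eK => i iK; apply: muP; exact: ltnW.
exists (U K.+1); first by split => //; exact: subIsetl.
rewrite eK/= /U big_ord_recr/= setIUr.
apply: le_trans (measureU2 _ (mU K) (measurableI _ _ mH (mP K))) _.
rewrite mulr_natl mulr2n EFinD; apply: leeD; first exact: ltW.
exact: muP.
Qed.

Lemma divisible_windows (e : R) n H : measurable H -> divisible H -> 0 < e ->
  ((2 * n%:R * e)%:E <= mu H)%E -> exists B : nat -> set T,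
    [/\ forall i, measurable (B i), forall i, B i `<=` H,
      forall i, (i < n)%N -> (e%:E <= mu (B i) <= (2 * e)%:E)%E &
      forall i j x, (i < n)%N -> (j < n)%N -> B i x -> B j x -> i = j].
Proof.
move=> + + e0; elim: n H => [|n IH] H mH dH nH.
  by exists (fun=> set0); split=> // i; exact: sub0set.
have [A [mA AH] eA] : exists2 A, measurable A /\ A `<=` H &
    (e%:E <= mu A <= (2 * e)%:E)%E.
  apply: divisible_window => //; apply: le_trans nH; rewrite lee_fin.
  rewrite -[leLHS]mul1r ler_pM2r// -natrM ler1n; lia.
have mHA : measurable (H `\` A) by exact: measurableD.
have [|B [mB BH eB dB]] := IH _ mHA (divisibleS mH mHA (@subDsetl _ _ _) dH).
  have : (mu H <= mu A + mu (H `\` A))%E.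
    rewrite -{1}(setDUK AH); exact: measureU2.
  have /andP[_ A2] := eA => /(le_trans nH) HA.
  have {HA} : ((2 * n.+1%:R * e)%:E <= (2 * e)%:E + mu (H `\` A))%E.
    by apply: le_trans HA _; rewrite leeD2r.
  rewrite -leeBlDl// -EFinB; apply: le_trans; rewrite lee_fin -natr1; lra.
exists (fun i => if i is i'.+1 then B i' else A); split.
- by case.
- by case=> // i; apply: subset_trans (BH i) _; exact: subDsetl.
- by case=> // i; rewrite ltnS; exact: eB.
- move=> [|i] [|j] x //=; rewrite ?ltnS.
  + by move=> _ _ Ax /BH[].
  + by move=> _ _ /BH[].
  + by move=> ik jk ix jx; rewrite (dB i j x).
Qed.

(** The sets of a new block have measure about min(a, h) / (2 n + 1), where h is the
measure of the unused part of G: this is below the previous scales and does not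
exhaust G. *)
Lemma rich_divisible G : measurable G -> (0 < mu G < +oo)%E -> divisible G ->
  rich mu.
Proof.
move=> mG /andP[G0 Goo] dG.
pose adm U := measurable U /\ (0 < mu (G `\` U))%E.
apply: (@rich_greedy _ _ _ mu adm); first by split; rewrite ?setD0.
move=> U n a b [mU U0] a0 b0.
have mGU : measurable (G `\` U) by exact: measurableD.
have GUoo : (mu (G `\` U) < +oo)%E.
  by apply: le_lt_trans Goo; rewrite le_measure ?inE.
have hE : (fine (mu (G `\` U)))%:E = mu (G `\` U) by rewrite fineK// ge0_fin_numE.
set h := fine _ in hE.
have h0 : 0 < h by rewrite -lte_fin hE.
have n0 : 0 <= n%:R :> R by [].
pose e := Num.min a h / (2 * n%:R + 1).
have n1 : 0 < 2 * n%:R + 1 :> R by lra.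
have e0 : 0 < e by rewrite divr_gt0// lt_min a0.
have eE : (2 * n%:R + 1) * e = Num.min a h by rewrite mulrC divfK// gt_eqF.
have ea : 2 * (n%:R * e) < a.
  have : Num.min a h <= a by rewrite ge_min lexx.
  by rewrite -eE; lra.
have eh : 2 * n%:R * e < h.
  have : Num.min a h <= h by rewrite ge_min lexx orbT.
  by rewrite -eE; lra.
have [|B [mB BG eB dB]] := @divisible_windows e n (G `\` U) mGU
    (divisibleS mG mGU (@subDsetl _ _ _) dG) e0.
  by rewrite -hE lee_fin ltW.
exists e, B; split.
  split=> //; split; last by left.
  by move=> i x _ /BG[].
have mBU : measurable (\bigcup_(i in [set i | (i < n)%N]) B i) by exact: bigcup_measurable.
split; first exact: measurableU.
set V := \bigcup_(i in _) _ in mBU *.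
rewrite -setDDl ltNge; apply/negP => V0.
have muV : (mu V <= (2 * n%:R * e)%:E)%E.
  rewrite /V bigcup_mkord; apply: le_trans (measure_bigsetU_le _ _ _ _) _ => //.
  apply: (@le_trans _ _ (\sum_(i < n) (2 * e)%:E)%E).
    by apply: lee_sum => i _; case/andP: (eB i (ltn_ord i)).
  by rewrite sumEFin sumr_const card_ord lee_fin -[leLHS]mulr_natl; lra.
have : (mu (G `\` U) <= mu V + mu ((G `\` U) `\` V))%E.
  apply: le_trans (measureU2 _ _ _) => //; last exact: measurableD.
  rewrite le_measure ?inE//; first by apply: measurableU => //; exact: measurableD.
  by move=> x Gx; have [Vx|nVx] := pselect (V x); [left|right].
rewrite -hE leNgt => /negP; apply.
apply: (@le_lt_trans _ _ ((2 * n%:R * e)%:E + 0)%E); first exact: leeD.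
by rewrite adde0 lte_fin.
Qed.

End divisible.

(** * Limits of set functions *)

(** The limit along a nonprincipal ultrafilter. *)
Lemma generalized_limit (R : realType) : exists L : (nat -> R) -> R,
  [/\ forall u (M : R), (forall n, `|u n| <= M) -> `|L u| <= M,
      forall a u v (M M' : R), (forall n, `|u n| <= M) -> (forall n, `|v n| <= M') ->
        L (fun n => a * u n + v n) = a * L u + L v &
      forall u c N, (forall n, (N <= n)%N -> u n = c) -> L u = c].
Proof.
have [U [UU ooU]] := @ultraFilterLemma nat \oo _.
have cvgU (u : nat -> R) (M : R) : (forall n, `|u n| <= M) ->
    exists2 l : R, `|l| <= M & u @ U --> l.
  move=> uM; have FU : UltraFilter (u @ U).
    split=> [|G GG uG]; first exact: fmap_proper_filter.
    apply/seteqP; split=> // A GA.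
    have [|UnA] := @in_ultra_setVsetC _ U (u @^-1` A) UU; first by [].
    have GnA : G (~` A) by apply: uG.
    have := filterI GA GnA; rewrite setICr => G0.
    by case: (@filter_not_empty _ G _ (G0 _)).
  have := @segment_compact R (- M) M; rewrite compact_ultra => /(_ _ FU).
  case=> [|l [/= lM ul]].
    by apply: (@filterE _ U _) => n; rewrite /= in_itv /= -ler_norml.
  by exists l => //; rewrite ler_norml; move: lM; rewrite in_itv.
exists (fun u => lim (u @ U)); split.
- move=> u M /cvgU[l lM ul]; by rewrite (cvg_lim _ ul).
- move=> a u v M M' /cvgU[l _ ul] /cvgU[l' _ vl'].
  rewrite (cvg_lim _ ul)// (cvg_lim _ vl')//; apply: cvg_lim => //.
  by apply: cvgD => //; apply: cvgM => //; exact: cvg_cst.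
- move=> u c N uc; apply: cvg_lim => //; apply: (@cvg_trans _ (u @ \oo)).
    by move=> A uA; exact: ooU.
  by apply: cvg_near_cst; exists N => // n /= /uc ->.
Qed.

Section sigma_finite_copy.
Context d (T : measurableType d) (R : realType) (mu : {measure set T -> \bar R}).

(** A copy of mu that can carry the structure required by the Radon-Nikodym
theorem. *)
Definition sigma_finite_copy (_ : sigma_finite [set: T] mu) : set T -> \bar R := mu.

Variable sf : sigma_finite [set: T] mu.

HB.instance Definition _ := isMeasure.Build _ _ _ (sigma_finite_copy sf)
  (measure0 mu) (measure_ge0 mu) (@measure_semi_sigma_additive _ _ _ mu).
HB.instance Definition _ :=
  Measure_isSigmaFinite.Build _ _ _ (sigma_finite_copy sf) sf.

End sigma_finite_copy.

(** The bound by a power of mu(A) makes a finitely additive function countably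
additive and absolutely continuous at once. *)
Section density.
Context d (T : measurableType d) (R : realType).
Variables (mu : {measure set T -> \bar R}) (D : set T) (K q : R) (nu : set T -> R).
Hypotheses (mD : measurable D) (Doo : (mu D < +oo)%E) (q0 : 0 < q).
Hypothesis nuD : forall A B, measurable A -> measurable B ->
  A `<=` D -> B `<=` D -> A `&` B = set0 -> nu (A `|` B) = nu A + nu B.
Hypothesis nu_le : forall A, measurable A -> A `<=` D ->
  `|nu A| <= K * fine (mu A) `^ q.

Let nu0 : nu set0 = 0.
Proof.
have := nu_le measurable0 (@sub0set _ D).
by rewrite measure0/= powR0 ?gt_eqF// mulr0 normr_le0 => /eqP.
Qed.

Definition restricted_charge (A : set T) : \bar R := (nu (A `&` D))%:E.

Let charge0 : restricted_charge set0 = 0%E.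
Proof. by rewrite /restricted_charge set0I nu0. Qed.

Let charge_fin A : measurable A -> restricted_charge A \is a fin_num.
Proof. by []. Qed.

Let charge_sigma_additive : semi_sigma_additive restricted_charge.
Proof.
move=> F mF tF mUF; rewrite /restricted_charge.
pose V n := \bigcup_(i in [set i | (n <= i)%N]) F i `&` D.
have mV n : measurable (V n) by apply: measurableI => //; exact: bigcup_measurable.
have VD n : V n `<=` D by exact: subIsetr.
have mFD n : measurable (F n `&` D) by exact: measurableI.
have FD n : F n `&` D `<=` D by exact: subIsetr.
have VS n : V n = (F n `&` D) `|` V n.+1.
  apply/seteqP; split=> [x [[i /= ni ix] Dx]|x [[Fx Dx]|[[i /= ni ix] Dx]]].
  - move: ni; rewrite leq_eqVlt => /predU1P[->|ni]; first by left.
    by right; split=> //; exists i.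
  - by split=> //; exists n => /=.
  - by split=> //; exists i => //=; exact: ltnW.
have FV n : F n `&` D `&` V n.+1 = set0.
  apply/seteqP; split=> // x [[Fx _] [[i /= ni ix] _]].
  have ni' : n = i by apply: tF => //; exists x.
  by rewrite ni' ltnn in ni.
have nuE n : nu (\bigcup_i F i `&` D) = \sum_(0 <= i < n) nu (F i `&` D) + nu (V n).
  elim: n => [|n ->]; first by rewrite big_geq// add0r; congr nu; rewrite /V set_true.
  rewrite big_nat_recr//= -addrA; congr (_ + _).
  by rewrite VS nuD.
have nuV : nu (V n) @[n --> \oo] --> (0 : R).
  have Vcvg : mu (V n) @[n --> \oo] --> mu (\bigcap_n V n).
    apply: nonincreasing_cvg_mu => //.
    - by apply: le_lt_trans Doo; rewrite le_measure ?inE.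
    - exact: bigcap_measurable.
    - apply/nonincreasing_seqP => n; apply/subsetPset; rewrite [X in _ `<=` X]VS.
      exact: subsetUr.
  have V0 : \bigcap_n V n = set0.
    apply/seteqP; split=> // x Vx; have [[i _ ix] _] := Vx 0%N I.
    have [[j /= ij jx] _] := Vx i.+1 I.
    have ij' : i = j by apply: tF => //; exists x.
    by rewrite ij' ltnn in ij.
  rewrite V0 measure0 in Vcvg.
  have fV : fine (mu (V n)) @[n --> \oo] --> (0 : R) by exact: (fine_cvg Vcvg).
  apply/cvgr0Pnorm_lt => e e0.
  have K1 : 0 < `|K| + 1 by rewrite ltr_wpDl.
  pose dl := (e / (`|K| + 1)) `^ q^-1.
  have dl0 : 0 < dl by rewrite powR_gt0// divr_gt0.
  move/cvgr0Pnorm_lt : fV => /(_ _ dl0); apply: filterS => n mn.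
  apply: le_lt_trans (nu_le (mV n) (VD n)) _.
  apply: (@le_lt_trans _ _ ((`|K| + 1) * fine (mu (V n)) `^ q)).
    by rewrite ler_wpM2r ?powR_ge0// (le_trans (ler_norm K))// lerDl.
  rewrite -ltr_pdivlMl// mulrC.
  have -> : e / (`|K| + 1) = dl `^ q.
    by rewrite -powRrM mulVf ?gt_eqF// powRr1// ltW// divr_gt0.
  apply: gt0_ltr_powR; rewrite ?nnegrE ?fine_ge0 ?(ltW dl0)//.
  by rewrite (le_lt_trans (ler_norm _)).
rewrite (_ : (fun n => _) = (fun n => (\sum_(0 <= i < n) nu (F i `&` D))%:E)); last first.
  by apply/funext => n; rewrite sumEFin.
apply: cvg_EFin; first by apply: nearW.
rewrite (_ : _ \o _ = (fun n => nu (\bigcup_i F i `&` D) - nu (V n))); last first.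
  by apply/funext => n /=; rewrite (nuE n) addrK.
rewrite -[X in _ --> X]subr0; apply: cvgB => //; exact: cvg_cst.
Qed.

HB.instance Definition _ := isCharge.Build _ T R restricted_charge
  charge0 charge_fin charge_sigma_additive.

Lemma restricted_charge_bigcup0 F : (forall i : nat, measurable (F i)) ->
  trivIset setT F -> (forall i, nu (F i `&` D) = 0) -> nu (\bigcup_i F i `&` D) = 0.
Proof.
move=> mF tF F0; have mU : measurable (\bigcup_i F i) by exact: bigcup_measurable.
have := charge_sigma_additive mF tF mU.
rewrite (_ : (fun n => _) = cst 0%E); last first.
  apply/funext => n; rewrite big1// => i _; by rewrite /restricted_charge F0.
move=> /(cvg_unique (@ereal_hausdorff R) (cvg_cst _)); by case.
Qed.

Lemma density_of_charge : sigma_finite [set: T] mu ->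
  exists h : T -> R, [/\ measurable_fun setT h, mu.-integrable D (EFin \o h) &
    forall A, measurable A -> A `<=` D -> nu A = \int[mu]_(x in A) h x].
Proof.
move=> sf.
pose mu' : {sigma_finite_measure set T -> \bar R} := sigma_finite_copy sf.
have dom : restricted_charge `<< mu'.
  move=> N N0 A mA AN; rewrite /restricted_charge.
  have mAD : measurable (A `&` D) by exact: measurableI.
  have AD0 : mu (A `&` D) = 0%E by apply: N0 => //; exact: subset_trans (@subIsetl _ _ _) AN.
  have := nu_le mAD (@subIsetr _ _ _).
  by rewrite AD0 powR0 ?gt_eqF// mulr0 normr_le0 => /eqP ->.
pose g := Radon_Nikodym restricted_charge mu'.
have gint : mu.-integrable setT g := Radon_Nikodym_integrable dom.
have gfin x : g x \is a fin_num := Radon_Nikodym_fin_num x dom.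
have gE : EFin \o (fine \o g) = g by apply/funext => x /=; rewrite fineK.
exists (fine \o g); split.
- apply/measurable_EFinP; rewrite gE; exact: measurable_int gint.
- rewrite gE; exact: integrableS gint.
- move=> A mA AD.
  have nuA : restricted_charge A = (\int[mu]_(x in A) g x)%E :=
    Radon_Nikodym_integral dom mA.
  rewrite /restricted_charge setIidl// in nuA.
  rewrite /Rintegral; have -> : (fun x => ((fine \o g) x)%:E) = g := gE.
  by rewrite -[LHS]/(fine (nu A)%:E) nuA.
Qed.

End density.

(** * The finite partitions given by the generators *)

Section cells.
Context d (T : measurableType d) (R : realType).
Variables (mu : {measure set T -> \bar R}) (G : nat -> set T).
Hypothesis mG : forall i, measurable (G i).

Definition code l x : {ffun 'I_l -> bool} := [ffun i => `[< G (nat_of_ord i) x >]].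

Definition cell l (s : {ffun 'I_l -> bool}) : set T := [set x | code l x = s].

Lemma codeP l x y : code l x = code l y <->
  forall i, (i < l)%N -> (G i x <-> G i y).
Proof.
split=> [xy i il|xy].
  have := congr1 (fun f : {ffun 'I_l -> bool} => f (Ordinal il)) xy.
  by rewrite /code !ffunE /= => E; exact: asbool_eq_equiv E.
apply/ffunP => i; rewrite /code !ffunE; apply/asbool_equiv_eq; exact: xy.
Qed.

Lemma code_le k l x y : (k <= l)%N -> code l x = code l y -> code k x = code k y.
Proof.
move=> kl /codeP xy; apply/codeP => i ik; apply: xy.
exact: leq_trans kl.
Qed.

Lemma measurable_cell l s : measurable (@cell l s).
Proof.
have -> : cell s = \bigcap_(i : 'I_l) (if s i then G i else ~` G i).
  apply/seteqP; split=> x /=.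
    by move=> <- i _; rewrite /code ffunE; case: asboolP.
  move=> xs; apply/ffunP => i; rewrite /code ffunE; have := xs i I.
  by case: (s i) => Gx; apply/asboolP.
apply: fin_bigcap_measurable => // i _; case: (s i) => //; exact: measurableC.
Qed.

Lemma measurable_code l (P : {ffun 'I_l -> bool} -> Prop) :
  measurable [set x | P (code l x)].
Proof.
have -> : [set x | P (code l x)] = \bigcup_(s in [set s | P s]) cell s.
  by apply/seteqP; split=> [x /= Px|x [s /= + xs]]; [exists (code l x)|rewrite -xs].
by apply: fin_bigcup_measurable => // s _; exact: measurable_cell.
Qed.

Definition positive_cell l (s : {ffun 'I_l -> bool}) := `[< (0 < mu (cell s) < +oo)%E >].

Definition weight l (s : {ffun 'I_l -> bool}) : R := fine (mu (cell s)).

Lemma positive_cell_weight l (s : {ffun 'I_l -> bool}) : positive_cell s ->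
  0 < weight s /\ mu (cell s) = (weight s)%:E.
Proof.
move=> /asboolP/andP[s0 soo].
have sE : mu (cell s) = (weight s)%:E by rewrite /weight fineK// ge0_fin_numE// ltW.
by rewrite sE lte_fin in s0 *.
Qed.

Lemma mesh_exists l : exists2 e : R, 0 < e &
  forall s : {ffun 'I_l -> bool}, positive_cell s -> e <= weight s.
Proof.
suff [e e0 eP] : exists2 e : R, 0 < e & forall s, s \in enum {: {ffun 'I_l -> bool}} ->
    positive_cell s -> e <= weight s.
  by exists e => // s; apply: eP; rewrite mem_enum.
elim: (enum _) => [|s ss [e e0 eP]]; first by exists 1.
have [gs|ngs] := boolP (positive_cell s); last first.
  exists e => // s'; rewrite inE => /predU1P[->|]; last exact: eP.
  by rewrite (negbTE ngs).
have [w0 _] := positive_cell_weight gs.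
exists (Num.min e (weight s)); first by rewrite lt_min e0.
move=> s'; rewrite inE => /predU1P[->|s's] gs'; first by rewrite ge_min lexx orbT.
by rewrite ge_min eP.
Qed.

(** A unit of mass that does not exceed the measures of all cells of positive finite measure. *)
Definition mesh l : R := projT1 (cid2 (mesh_exists l)).

Lemma mesh_gt0 l : 0 < mesh l.
Proof. by rewrite /mesh; case: cid2. Qed.

Lemma mesh_le l (s : {ffun 'I_l -> bool}) : positive_cell s -> mesh l <= weight s.
Proof. by rewrite /mesh; case: cid2 => /= e _ eP; exact: eP. Qed.

(** Cells that are null or of infinite measure get no copy. *)
Definition ncopies l (s : {ffun 'I_l -> bool}) : nat :=
  if positive_cell s then Num.truncn (weight s / mesh l) else 0.

Lemma ncopiesP l (s : {ffun 'I_l -> bool}) : positive_cell s ->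
  [/\ (0 < ncopies s)%N, (ncopies s)%:R * mesh l <= weight s &
    weight s <= 2 * (ncopies s)%:R * mesh l].
Proof.
move=> gs; have e0 := mesh_gt0 l; have ew := mesh_le gs.
have w0 : 0 <= weight s / mesh l by rewrite divr_ge0 ?(ltW e0)//; lra.
have /andP[tl tu] := truncn_itv w0.
have m0 : (0 < ncopies s)%N.
  by rewrite /ncopies gs truncn_gt0 ler_pdivlMr// mul1r.
move: tl tu m0; rewrite /ncopies gs; set t := Num.truncn _ => tl tu t0.
rewrite ler_pdivlMr// in tl; split=> //.
move: tu; rewrite ltr_pdivrMr// -natr1 => /ltW/le_trans; apply.
rewrite ler_pM2r//; have : 1 <= t%:R :> R by rewrite ler1n.
lra.
Qed.

Definition copies l : seq {ffun 'I_l -> bool} :=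
  flatten [seq nseq (ncopies s) s | s <- enum {: {ffun 'I_l -> bool}}].

Definition copy l j := nth [ffun=> false] (copies l) j.

Lemma sum_copies l (F : {ffun 'I_l -> bool} -> R) :
  \sum_(j < size (copies l)) F (copy l j) = \sum_s (ncopies s)%:R * F s.
Proof.
rewrite -(big_mkord xpredT (fun j => F (copy l j))) -(big_nth _ xpredT F).
rewrite /copies big_flatten big_map big_enum/=; apply: eq_bigr => s _.
by rewrite big_nseq iter_addr_0 mulr_natl.
Qed.

Lemma positive_cell_copy l j : (j < size (copies l))%N -> positive_cell (copy l j).
Proof.
move=> /(mem_nth [ffun=> false]); rewrite -/(copy l j).
move: (copy l j) => s /flattenP[_ /mapP[s' _ ->]].
by rewrite mem_nseq => /andP[+ /eqP ->]; rewrite /ncopies; case: ifP.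
Qed.

Lemma sum_indic_cells l (a : {ffun 'I_l -> bool} -> R) x :
  \sum_s a s * \1_(cell s) x = a (code l x).
Proof.
rewrite (bigD1 (code l x))//= indicE mem_set//= mulr1 big1 ?addr0// => s sx.
rewrite indicE memNset ?mulr0// => /esym/eqP; exact/negP.
Qed.

Lemma sum_measure_cells l A : measurable A -> (mu A < +oo)%E ->
  \sum_s fine (mu (A `&` @cell l s)) = fine (mu A).
Proof.
move=> mA Aoo.
have Acell s : measurable (A `&` @cell l s).
  by apply: measurableI => //; exact: measurable_cell.
have fin s : mu (A `&` @cell l s) \is a fin_num.
  rewrite ge0_fin_numE//; apply: le_lt_trans Aoo.
  by rewrite le_measure ?inE//; exact: subIsetl.
apply: EFin_inj; rewrite -sumEFin fineK ?ge0_fin_numE//.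
under eq_bigr do rewrite fineK//.
rewrite [in RHS](_ : A = \bigcup_(s in [set: {ffun 'I_l -> bool}]) (A `&` cell s)); last first.
  by apply/seteqP; split=> [x Ax|x [s _ []]//]; exists (code l x).
rewrite measure_fin_bigcup//; last 2 first.
- exact: finite_finset.
- by move=> s t _ _ [x [[_ <-] [_ <-]]].
rewrite (fsbigE (index_enum _)) ?index_enum_uniq//; last first.
  by move=> i _; rewrite mem_index_enum.
by apply: eq_bigl => s; rewrite in_setT.
Qed.

End cells.

(** Generators G together with a partition D into sets of finite measure, each of
which is one of the generators, so that fine cells lie inside the pieces D m. *)
Definition generating d (T : measurableType d) (R : realType)
    (mu : {measure set T -> \bar R}) (G D : nat -> set T) :=
  [/\ forall i, measurable (G i), forall m, measurable (D m) /\ (mu (D m) < +oo)%E,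
      trivIset setT D, \bigcup_m D m = setT &
      (forall m, exists i, D m = G i) /\
      (@measurable d T `<=`
        <<s range G `|` [set N | measurable N /\ mu N = 0%E] >>)].

Lemma generating_exists d (T : measurableType d) (R : realType)
    (mu : {measure set T -> \bar R}) : sigma_finite [set: T] mu ->
  countably_generated mu -> exists G D, generating mu G D.
Proof.
move=> [F FT Ffin] [A mA mE].
pose D := seqDU F.
have mD m : measurable (D m).
  by apply: seqDU_measurable => i; have [] := Ffin i.
exists (fun k => if odd k then D k./2 else A k./2), D; split.
- by move=> i; case: ifP.
- move=> m; split => //; apply: le_lt_trans (Ffin m).2.
  by rewrite le_measure ?inE//; [have [] := Ffin m|exact: subset_seqDU].
- exact: trivIset_seqDU.
- by rewrite -seqDU_bigcup_eq.
split=> [m|]; first by exists m.*2.+1; rewrite /= odd_double /= uphalf_double.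
rewrite {1}mE; apply: sub_smallest2r; first exact: smallest_sigma_algebra.
apply: setSU => _ [n _ <-]; exists n.*2 => //.
by rewrite odd_double doubleK.
Qed.

Section agreement.
Context d (T : measurableType d) (R : realType).
Variables (mu : {measure set T -> \bar R}) (G D0 : nat -> set T).
Hypothesis gen : generating mu G D0.

Let mG i : measurable (G i). Proof. by have [] := gen. Qed.

Variables (D : set T) (K q : R) (nu : set T -> R).
Hypotheses (mD : measurable D) (Doo : (mu D < +oo)%E) (q0 : 0 < q).
Hypothesis nuD : forall A B, measurable A -> measurable B ->
  A `<=` D -> B `<=` D -> A `&` B = set0 -> nu (A `|` B) = nu A + nu B.
Hypothesis nu_le : forall A, measurable A -> A `<=` D ->
  `|nu A| <= K * fine (mu A) `^ q.
Hypothesis nu_cell : forall k (P : {ffun 'I_k -> bool} -> Prop),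
  nu ([set x | P (code G k x)] `&` D) = 0.

(** A pi-lambda argument: the sets equal up to a null set to a union of cells are
closed under intersection and generate the sigma-algebra. The bound on nu makes it
vanish on null sets and continuous along increasing sequences. *)
Lemma charge_eq0 A : measurable A -> A `<=` D -> nu A = 0.
Proof.
move=> mA AD.
pose Pi := [set B | measurable B /\ exists k (P : {ffun 'I_k -> bool} -> Prop) N,
  [/\ measurable N, mu N = 0%E & forall x, ~ N x -> (B x <-> P (code G k x))]].
pose L := [set B | measurable B /\ nu (B `&` D) = 0].
have nuDD B C : measurable B -> measurable C -> B `&` C = set0 ->
    nu ((B `|` C) `&` D) = nu (B `&` D) + nu (C `&` D).
  move=> mB mC BC; rewrite setIUl nuD//; try exact: measurableI.
  by rewrite setIACA BC set0I.
have nuN N : measurable N -> mu N = 0%E -> nu (N `&` D) = 0.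
  move=> mN N0; have mND : measurable (N `&` D) by exact: measurableI.
  have ND0 : mu (N `&` D) = 0%E.
    by apply: (subset_measure0 _ _ _ N0) => //; exact: subIsetl.
  have := nu_le mND (@subIsetr _ _ _).
  by rewrite ND0 powR0 ?gt_eqF// mulr0 normr_le0 => /eqP.
have PiL : Pi `<=` L.
  move=> B [mB [k [P [N [mN N0 BP]]]]]; split => //.
  pose C := [set x | P (code G k x)].
  have mC : measurable C by exact: measurable_code.
  have split_N E : measurable E -> nu (E `&` D) = nu ((E `\` N) `&` D).
    move=> mE; rewrite -{1}(setUIDK E N) nuDD//.
    - rewrite nuN ?add0r//; first exact: measurableI.
      by apply: (subset_measure0 _ _ _ N0) => //; exact: measurableI.
    - exact: measurableI.
    - exact: measurableD.
    - by apply/seteqP; split=> // x [[_ Nx] [_ nN]].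
  rewrite split_N// (_ : B `\` N = C `\` N) -?split_N//; first exact: nu_cell.
  by apply/seteqP; split=> x [Bx Nx]; split => //; apply/(BP x Nx).
have PiI : setI_closed Pi.
  move=> B C [mB [k [P [N [mN N0 BP]]]]] [mC [l [Q [N' [mN' N0' CQ]]]]].
  split; first exact: measurableI.
  exists (maxn k l).
  exists (fun s => exists x, [/\ code G (maxn k l) x = s, P (code G k x) & Q (code G l x)]).
  exists (N `|` N'); split; first exact: measurableU.
    by rewrite measureU0.
  move=> x /not_orP[Nx N'x]; split=> [[Bx Cx]|[y [xy Py Qy]]].
    by exists x; split; [|exact/(BP x Nx)|exact/(CQ x N'x)].
  by split; [apply/(BP x Nx)|apply/(CQ x N'x)];
    [rewrite -(code_le (leq_maxl k l) xy)|rewrite -(code_le (leq_maxr k l) xy)].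
have L_lambda : lambda_system setT L.
  split=> //.
  - split=> //; have := nu_cell (fun _ : {ffun 'I_0 -> bool} => True).
    by rewrite (_ : [set x | True] = setT).
  - move=> B C CB [mB B0] [mC C0]; split; first exact: measurableD.
    have := nuDD C (B `\` C) mC (measurableD mB mC).
    by rewrite setDUK// setDIK B0 C0 add0r => <-.
  - move=> F ndF FL; have mF n : measurable (F n) by case: (FL n).
    split; first exact: bigcup_measurable.
    rewrite -eq_bigcup_seqD.
    apply: (restricted_charge_bigcup0 mD Doo q0 nuD nu_le).
    - by case=> [|i] /=; [exact: mF|exact: measurableD].
    - exact: trivIset_seqD.
    move=> [|i]/=; first by case: (FL 0%N).
    have FS : F i `<=` F i.+1 by apply/subsetPset; exact: ndF.
    have := nuDD _ _ (mF i) (measurableD (mF i.+1) (mF i)).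
    by rewrite setDUK// setDIK (FL i).2 (FL i.+1).2 add0r => <-.
have [mA' ] : L A; last by rewrite setIidl.
have [_ _ _ _ [_ msub]] := gen.
have /(_ A) := @lambda_system_subset _ Pi PiI setT L L_lambda PiL (fun _ _ _ _ => I).
apply; have := msub A mA; apply: sub_smallest2r; first exact: smallest_sigma_algebra.
move=> B [[i _ <-]|[mB B0]].
  split => //; exists i.+1, (fun s => s ord_max), set0.
  split => // x _; rewrite /code ffunE; split=> [Gx|/asboolP//].
  exact/asboolP.
split=> //; exists 0%N, (fun=> False), B; split => //.
Qed.

End agreement.

(** * Weak L^p is complemented in a space of bounded sequences of blocks *)

Section embedding.
Context d (T : measurableType d) (R : realType).
Variables (mu : {measure set T -> \bar R}) (p : R) (p1 : 1 < p).
Variables (G D : nat -> set T).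
Hypothesis gen : generating mu G D.

Let p0 : 0 < p. Proof. exact: lt_trans p1. Qed.
Let mG i : measurable (G i). Proof. by have [] := gen. Qed.
Let mD m : measurable (D m). Proof. by have [_ /(_ m)[]] := gen. Qed.
Let Doo m : (mu (D m) < +oo)%E. Proof. by have [_ /(_ m)[]] := gen. Qed.
Let tD : trivIset setT D. Proof. by have [] := gen. Qed.
Let covD x : exists m, D m x.
Proof. by have [_ _ _ DT _] := gen; have : setT x by []; rewrite -DT => -[m _]; exists m. Qed.

Let q := 1 - p^-1.
Let q0 : 0 < q. Proof. by rewrite subr_gt0 invf_lt1. Qed.

Let Z := gseq (gblocks p).
Let V := gweakL mu p1.
Implicit Types (z : Z) (u : V).

Let N l := size (copies mu G l).
Let cp l j := copy mu G l j.
Let e l := mesh mu G l.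
Let e0 l : 0 < e l. Proof. exact: mesh_gt0. Qed.

(** The l-th term has a single nonzero component, of size N l: the averages over the
cells of level l, repeated, in units for which each copy has mass 1. *)
Definition cell_averages (u : V) : Z := fun l w =>
  if tag w == N l then
    e l `^ (p^-1 - 1) *
    (e l / weight mu G (cp l (tagged w)) * weakL_int u (cell G (cp l (tagged w))))
  else 0.

(** The set function whose density is the step function encoded by the component of
size N l of z l: its value on a cell is the mean of z over the copies of the cell. *)
Definition step_charge l (z : Z) (A : set T) : R :=
  \sum_(j < N l) e l `^ (- p^-1) * (z l (bidx j) *
    (fine (mu (A `&` cell G (cp l j))) / (ncopies mu G (cp l j))%:R)).

Lemma bounded_linear_cell_averages : bounded_linear cell_averages.
Proof.
split=> [a u v _ _|].
  apply/funext => l; apply/funext => w.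
  rewrite [RHS](_ : _ = a * cell_averages u l w + cell_averages v l w)//.
  rewrite /cell_averages; case: eqP => [wN|_]; last by rewrite mulr0 addr0.
  have gw : positive_cell mu G (cp l (tagged w)).
    by apply: positive_cell_copy; rewrite -/(N l) -wN; exact: ltn_ord.
  rewrite weakL_int_linear; first ring.
    exact: measurable_cell.
  by have [_ ->] := positive_cell_weight gw; rewrite ltry.
exists (kolmogorov_cst p); first exact: kolmogorov_cst_gt0.
move=> M u M0 uM; rewrite gball_seqE => l; rewrite gball_blocksE => n t t01.
rewrite /cell_averages /=; case: eqP => [|_]; last first.
  rewrite big1 ?normr0 ?mulr_ge0 ?powR_ge0 ?(ltW M0) ?(ltW (kolmogorov_cst_gt0 p1))//.
  by move=> i _; rewrite mul0r.
move=> nN; subst n.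
have gc (j : 'I_(N l)) : positive_cell mu G (cp l j) by exact: positive_cell_copy.
have := @weakL_int_test_le _ _ _ mu p p1 u M (e l) (N l) (fun j => cell G (cp l j))
  (fun j => e l / weight mu G (cp l j)) t M0 (e0 l) uM.
apply => //.
- by move=> j; exact: measurable_cell.
- by move=> j; have [w0 _] := positive_cell_weight (gc j); rewrite divr_ge0// ltW.
- move=> x; rewrite (sum_copies mu G (fun s => e l / weight mu G s * \1_(cell G s) x)).
  under eq_bigr do rewrite mulrA.
  rewrite (sum_indic_cells G (fun s => (ncopies mu G s)%:R * (e l / weight mu G s))).
  have [gx|ngx] := boolP (positive_cell mu G (code G l x)).
    have [w0 _] := positive_cell_weight gx; have [_ me _] := ncopiesP gx.
    by rewrite mulrA ler_pdivrMr// mul1r.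
  by rewrite /ncopies (negbTE ngx) mul0r.
- move=> j; have [w0 ->] := positive_cell_weight (gc j).
  by rewrite -EFinM divfK// gt_eqF.
Qed.

(** The proportions of the copies that are covered by A, halved because a copy may
represent a mass of up to 2 e l, are admissible test weights. *)
Lemma step_charge_le l M z A : 0 < M -> gball M z -> measurable A ->
  (mu A < +oo)%E -> `|step_charge l z A| <= 2 * M * fine (mu A) `^ q.
Proof.
move=> M0 Mz mA Aoo.
have mAc s : measurable (A `&` cell G (l := l) s).
  by apply: measurableI => //; exact: measurable_cell.
have gc (j : 'I_(N l)) : positive_cell mu G (cp l j) by exact: positive_cell_copy.
pose t (j : 'I_(N l)) :=
  fine (mu (A `&` cell G (cp l j))) / (2 * (ncopies mu G (cp l j))%:R * e l).
have el := e0 l.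
have t01 j : 0 <= t j <= 1.
  have [m0 _ mw] := ncopiesP (gc j); have [w0 wE] := positive_cell_weight (gc j).
  have m0' : 0 < (ncopies mu G (cp l j))%:R :> R by rewrite ltr0n.
  have d0 : 0 < 2 * (ncopies mu G (cp l j))%:R * e l by rewrite !mulr_gt0.
  rewrite divr_ge0 ?fine_ge0 ?(ltW d0)//= ler_pdivrMr// mul1r.
  apply: le_trans mw; rewrite -lee_fin -wE fineK; last first.
    rewrite ge0_fin_numE//; apply: le_lt_trans Aoo.
    by rewrite le_measure ?inE//; exact: subIsetl.
  by rewrite le_measure ?inE//; exact: measurable_cell.
have := Mz l _ t t01.
have -> : step_charge l z A = 2 * e l `^ q * \sum_i z l (bidx i) * t i.
  rewrite /step_charge mulr_sumr; apply: eq_bigr => j _.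
  have [m0 _ _] := ncopiesP (gc j).
  have m0' : 0 < (ncopies mu G (cp l j))%:R :> R by rewrite ltr0n.
  rewrite /t /q powRD; last by rewrite (gt_eqF el) implybT.
  rewrite powRr1 ?(ltW el)//.
  by field; rewrite !gt_eqF.
have e20 : 0 <= 2 * e l `^ q by rewrite mulr_ge0// powR_ge0.
rewrite normrM (ger0_norm e20) => tM.
apply: (@le_trans _ _ (2 * e l `^ q * (M * (\sum_i t i) `^ q))); first by rewrite ler_wpM2l.
rewrite -!mulrA ler_pM2l// mulrCA ler_pM2l//.
have st0 : 0 <= \sum_i t i by apply: sumr_ge0 => j _; case/andP: (t01 j).
rewrite -powRM ?(ltW el)//; apply: ge0_ler_powR; rewrite ?nnegrE ?(ltW q0) ?fine_ge0//.
  by rewrite mulr_ge0// ltW.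
have -> : e l * \sum_i t i = \sum_(j < N l)
    (fun s => fine (mu (A `&` cell G s)) / (2 * (ncopies mu G s)%:R)) (cp l j).
  rewrite mulr_sumr; apply: eq_bigr => j _; rewrite /t.
  have [m0 _ _] := ncopiesP (gc j).
  have m0' : 0 < (ncopies mu G (cp l j))%:R :> R by rewrite ltr0n.
  by field; rewrite !gt_eqF.
rewrite (sum_copies mu G (fun s => fine (mu (A `&` cell G s)) / (2 * (ncopies mu G s)%:R))).
rewrite -(sum_measure_cells mG l mA Aoo); apply: ler_sum => s _.
have f0 : 0 <= fine (mu (A `&` cell G s)) by rewrite fine_ge0.
have [->|m0] := posnP (ncopies mu G s); first by rewrite mul0r.
have m0' : 0 < (ncopies mu G s)%:R :> R by rewrite ltr0n.
rewrite [leLHS](_ : _ = fine (mu (A `&` cell G s)) / 2).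
  by rewrite ler_pdivrMr// ler_peMr// ler1n.
by field; rewrite gt_eqF.
Qed.

Lemma step_charge_linear l a z z' A :
  step_charge l (a *: z + z') A = a * step_charge l z A + step_charge l z' A.
Proof.
rewrite /step_charge mulr_sumr -big_split/=; apply: eq_bigr => j _.
rewrite [(a *: z + z') l (bidx j)](_ : _ = a * z l (bidx j) + z' l (bidx j))//.
ring.
Qed.

Lemma step_chargeD l z A B : measurable A -> measurable B -> (mu A < +oo)%E ->
  (mu B < +oo)%E -> A `&` B = set0 ->
  step_charge l z (A `|` B) = step_charge l z A + step_charge l z B.
Proof.
move=> mA mB Aoo Boo AB; rewrite /step_charge -big_split/=; apply: eq_bigr => j _.
rewrite -mulrDr -mulrDr -mulrDl setIUl measureU.
- rewrite fineD// ge0_fin_numE//.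
    apply: le_lt_trans Aoo; rewrite le_measure ?inE//.
    by apply: measurableI => //; exact: measurable_cell.
  apply: le_lt_trans Boo; rewrite le_measure ?inE//.
  by apply: measurableI => //; exact: measurable_cell.
- by apply: measurableI => //; exact: measurable_cell.
- by apply: measurableI => //; exact: measurable_cell.
- by rewrite setIACA AB set0I.
Qed.

Lemma weakL_intU u A B : measurable A -> measurable B -> (mu A < +oo)%E ->
  (mu B < +oo)%E -> A `&` B = set0 -> weakL_int u (A `|` B) = weakL_int u A + weakL_int u B.
Proof.
move=> mA mB Aoo Boo AB; rewrite /weakL_int Rintegral_setU//.
  apply: weakL_integrable; first exact: measurableU.
  by apply: le_lt_trans (measureU2 _ mA mB) _; rewrite lte_add_pinfty.
exact/eqP.
Qed.

Lemma weakL_int0 u A : measurable A -> mu A = 0%E -> weakL_int u A = 0.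
Proof.
move=> mA A0; rewrite /weakL_int /Rintegral.
rewrite null_set_integral//.
by apply: measurable_funTS; exact/measurable_EFinP.
Qed.

Lemma weakL_int_cells u l A : measurable A -> (mu A < +oo)%E ->
  weakL_int u A = \sum_s weakL_int u (A `&` cell G (l := l) s).
Proof.
move=> mA Aoo.
pose F s := A `&` cell G (l := l) s.
have mF s : measurable (F s) by apply: measurableI => //; exact: measurable_cell.
have Foo B : measurable B -> B `<=` A -> (mu B < +oo)%E.
  by move=> mB BA; apply: le_lt_trans Aoo; rewrite le_measure ?inE.
suff sumF r : uniq r ->
    weakL_int u (\big[setU/set0]_(s <- r) F s) = \sum_(s <- r) weakL_int u (F s).
  rewrite -sumF ?index_enum_uniq//; congr (weakL_int u _).
  apply/seteqP; split=> [x Ax|x]; last first.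
    by rewrite -bigcup_seq => -[s _ []].
  by apply: (mem_bigsetU (i := code G l x)) => //; exact: mem_index_enum.
elim: r => [|s r IH]; first by rewrite !big_nil weakL_int0 ?measure0.
move=> /= /andP[sr ur]; rewrite !big_cons -IH//.
have mU : measurable (\big[setU/set0]_(s <- r) F s) by exact: bigsetU_measurable.
apply: weakL_intU => //.
- by apply: Foo => //; exact: subIsetl.
- by apply: Foo => //; rewrite -bigcup_seq => x [t _ []].
apply/seteqP; split=> // x; rewrite -bigcup_seq => -[[_ xs] [t /= tr [_ xt]]].
by move: tr; rewrite -xt xs (negbTE sr).
Qed.


(** Averaging and spreading back preserves integrals over unions of cells. *)
Lemma step_charge_averages u l (P : {ffun 'I_l -> bool} -> Prop) :
  (mu [set x | P (code G l x)] < +oo)%E ->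
  step_charge l (cell_averages u) [set x | P (code G l x)] =
  weakL_int u [set x | P (code G l x)].
Proof.
set A := [set x | _] => Aoo.
have mA : measurable A by exact: measurable_code.
rewrite (weakL_int_cells u l mA Aoo).
pose F s := weakL_int u (cell G s) *
  fine (mu (A `&` cell G (l := l) s)) / weight mu G s / (ncopies mu G s)%:R.
transitivity (\sum_(j < N l) F (cp l j)).
  rewrite /step_charge; apply: eq_bigr => j _.
  have gc : positive_cell mu G (cp l j) by exact: positive_cell_copy.
  have [m0 _ _] := ncopiesP gc; have [w0 _] := positive_cell_weight gc.
  have el := e0 l; have m0' : 0 < (ncopies mu G (cp l j))%:R :> R by rewrite ltr0n.
  rewrite /cell_averages /= eqxx /F powRN powRB; last by rewrite (gt_eqF el) implybT.
  rewrite powRr1 ?(ltW el)//.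
  have ep : 0 < e l `^ p^-1 by exact: powR_gt0.
  by field; rewrite !gt_eqF.
rewrite (sum_copies mu G F); apply: eq_bigr => s _.
have [Ps|nPs] := pselect (P s); last first.
  have A0 : A `&` cell G s = set0.
    by apply/seteqP; split=> // x [Ax xs]; apply: nPs; rewrite -xs; exact: Ax.
  by rewrite /F A0 measure0 /= mulr0 !mul0r mulr0 weakL_int0// measure0.
have AE : A `&` cell G s = cell G s by apply/setIidr => x /= xs; rewrite /A /= xs.
have mc : measurable (cell G s) by exact: measurable_cell.
rewrite AE; have [gs|ngs] := boolP (positive_cell mu G s); last first.
  rewrite /ncopies (negbTE ngs) mul0r weakL_int0//; apply/eqP.
  rewrite -measure_le0 leNgt; apply: contra ngs => s0; apply/asboolP; rewrite s0/=.
  apply: le_lt_trans Aoo; rewrite le_measure ?inE// -AE; exact: subIsetl.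
have [m0 _ _] := ncopiesP gs; have [w0 _] := positive_cell_weight gs.
have m0' : 0 < (ncopies mu G s)%:R :> R by rewrite ltr0n.
rewrite /F AE -/(weight mu G s).
by field; rewrite !gt_eqF.
Qed.

Lemma weakL_int_le u M A : 0 < M -> weakL_norm u <= M -> measurable A ->
  (mu A < +oo)%E -> `|weakL_int u A| <= kolmogorov_cst p * M * fine (mu A) `^ q.
Proof.
move=> M0 uM mA Aoo.
have muE : mu A = (fine (mu A))%:E by rewrite fineK// ge0_fin_numE.
have : 0 <= fine (mu A) by rewrite fine_ge0.
rewrite le_eqVlt => /predU1P[/esym A0|A0].
  rewrite weakL_int0 ?normr0 ?mulr_ge0 ?powR_ge0 ?(ltW M0) ?(ltW (kolmogorov_cst_gt0 p1))//.
  by rewrite muE A0.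
have := @weakL_int_test_le _ _ _ mu p p1 u M (fine (mu A)) 1 (fun=> A) (fun=> 1) (fun=> 1) M0 A0 uM.
rewrite !big_ord1 powR1 !mulr1 mul1r normrM (ger0_norm (powR_ge0 _ _)).
have -> : fine (mu A) `^ (p^-1 - 1) = (fine (mu A) `^ q)^-1 by rewrite -powRN opprB.
rewrite ler_pdivrMl ?powR_gt0// mulrC; apply => //.
- by move=> x; rewrite big_ord1 mul1r indicE; case: (_ \in _); rewrite ?lexx ?ler01.
- by move=> _; rewrite mul1e -muE.
- by move=> _; rewrite ler01 lexx.
Qed.

Variable L : (nat -> R) -> R.
Hypothesis L_le : forall (u : nat -> R) (M : R), (forall n, `|u n| <= M) -> `|L u| <= M.
Hypothesis L_linear : forall a (u v : nat -> R) (M M' : R), (forall n, `|u n| <= M) ->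
  (forall n, `|v n| <= M') -> L (fun n => a * u n + v n) = a * L u + L v.
Hypothesis L_stable : forall (u : nat -> R) c N, (forall n, (N <= n)%N -> u n = c) -> L u = c.

Definition limit_charge z (A : set T) : R := L (fun l => step_charge l z A).

Lemma limit_charge_le M z A : 0 < M -> gball M z -> measurable A ->
  (mu A < +oo)%E -> `|limit_charge z A| <= 2 * M * fine (mu A) `^ q.
Proof. by move=> M0 Mz mA Aoo; apply: L_le => l; exact: step_charge_le. Qed.

Lemma limit_charge_linear a z z' A : gbounded z -> gbounded z' -> measurable A ->
  (mu A < +oo)%E ->
  limit_charge (a *: z + z') A = a * limit_charge z A + limit_charge z' A.
Proof.
move=> [M M0 Mz] [M' M'0 Mz'] mA Aoo.
rewrite -(@L_linear a _ _ (2 * M * fine (mu A) `^ q) (2 * M' * fine (mu A) `^ q)).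
- by congr L; apply/funext => l; exact: step_charge_linear.
- by move=> l; exact: step_charge_le.
- by move=> l; exact: step_charge_le.
Qed.

Lemma limit_chargeD z A B : gbounded z -> measurable A -> measurable B ->
  (mu A < +oo)%E -> (mu B < +oo)%E -> A `&` B = set0 ->
  limit_charge z (A `|` B) = limit_charge z A + limit_charge z B.
Proof.
move=> [M M0 Mz] mA mB Aoo Boo AB.
rewrite -[X in X + _]mul1r.
rewrite -(@L_linear 1 _ _ (2 * M * fine (mu A) `^ q) (2 * M * fine (mu B) `^ q)).
- by congr L; apply/funext => l; rewrite mul1r step_chargeD.
- by move=> l; exact: step_charge_le.
- by move=> l; exact: step_charge_le.
Qed.

(** Restricting to subsets of the pieces D m keeps all integrals finite. *)
Definition represents z u := forall m A, measurable A -> A `<=` D m ->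
  weakL_int u A = limit_charge z A.

Let subD_lty m A : measurable A -> A `<=` D m -> (mu A < +oo)%E.
Proof. by move=> mA AD; apply: le_lt_trans (Doo m); rewrite le_measure ?inE. Qed.

Lemma represents_inj z u v : represents z u -> represents z v -> u = v.
Proof.
move=> zu zv; apply: weakL_fun_inj.
have aeD m : ae_eq mu (D m) (EFin \o weakL_fun u) (EFin \o weakL_fun v).
  apply: integral_ae_eq => //.
  - exact: weakL_integrable.
  - by apply/measurable_EFinP; exact: measurable_funTS.
  move=> A AD mA; have Aoo := subD_lty mA AD.
  have := zu m A mA AD; rewrite -(zv m A mA AD) /weakL_int /Rintegral => E.
  rewrite -[LHS]fineK ?E ?fineK//; apply: integrable_fin_num => //;
  exact: weakL_integrable.
have /ae_foralln := aeD; apply: filterS => x uv.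
by have [m Dx] := covD x; have [] := uv m Dx.
Qed.

Lemma represents_linear a z z' u u' : gbounded z -> gbounded z' ->
  represents z u -> represents z' u' -> represents (a *: z + z') (a *: u + u').
Proof.
move=> bz bz' zu zu' m A mA AD; have Aoo := subD_lty mA AD.
by rewrite weakL_int_linear// (zu m)// (zu' m)// limit_charge_linear.
Qed.

(** On a union of cells of D m the step charges are eventually equal to the
integral, hence so is their limit; both sides then agree on all measurable sets. *)
Lemma represents_averages u : represents (cell_averages u) u.
Proof.
have bS : bounded_linear cell_averages := bounded_linear_cell_averages.
have bu : gbounded u := gbounded_weakL u.
have bSu : gbounded (cell_averages u) := gbounded_linear bS bu.
have [M M0 uM] := bu; have [M' M'0 uM'] := bSu.
move=> m A mA AD; apply/eqP; rewrite -subr_eq0; apply/eqP.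
pose nu B := weakL_int u B - limit_charge (cell_averages u) B.
apply: (charge_eq0 gen (D := D m)
  (K := kolmogorov_cst p * M + 2 * M') (q := q) (nu := nu)) => //.
- move=> B C mB mC BD CD BC; rewrite /nu.
  have Boo := subD_lty mB BD; have Coo := subD_lty mC CD.
  by rewrite weakL_intU// limit_chargeD// opprD addrACA.
- move=> B mB BD; have Boo := subD_lty mB BD.
  apply: le_trans (ler_normB _ _) _; rewrite mulrDl; apply: lerD.
    exact: weakL_int_le.
  exact: limit_charge_le.
- move=> k P; rewrite /nu; apply/eqP; rewrite subr_eq0 eq_sym; apply/eqP.
  have [_ _ _ _ [/(_ m)[i DG] _]] := gen.
  have Boo : (mu ([set x | P (code G k x)] `&` D m) < +oo)%E.
    apply: (subD_lty (m := m)); last exact: subIsetr.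
    by apply: measurableI => //; exact: measurable_code.
  apply: (@L_stable _ _ (maxn k i.+1)) => l; rewrite geq_max => /andP[kl il].
  pose Q (s : {ffun 'I_l -> bool}) := exists x, [/\ code G l x = s, P (code G k x) & G i x].
  have QE : [set x | P (code G k x)] `&` D m = [set x | Q (code G l x)].
    apply/seteqP; split=> [x [/= Px]|x [y [yx Py Gy]]]; first by rewrite DG => Gx; exists x.
    split; first by rewrite /= -(code_le kl yx).
    by rewrite DG; move/codeP : yx => /(_ i il)[+ _]; apply.
  by rewrite QE step_charge_averages// -QE.
Qed.

(** The densities found on the pieces D m are glued. On the set where the density
exceeds c the charge is at least c times the measure, which with the bound
2 M mu(A)^(1-1/p) gives the weak estimate; both signs contribute. *)
Lemma represents_exists M z : sigma_finite [set: T] mu -> 0 < M -> gball M z ->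
  exists2 u, weakL_norm u <= 4 * M & represents z u.
Proof.
move=> sf M0 Mz; have bz : gbounded z by exists M.
have /choice[h hP] : forall m, exists h : T -> R,
    [/\ measurable_fun setT h, mu.-integrable (D m) (EFin \o h) &
      forall A, measurable A -> A `<=` D m -> limit_charge z A = \int[mu]_(x in A) h x].
  move=> m; apply: (@density_of_charge _ _ _ mu (D m) (2 * M) q) => //.
  - move=> A B mA mB AD BD AB; apply: limit_chargeD => //; exact: (subD_lty (m := m)).
  - by move=> A mA AD; apply: limit_charge_le => //; exact: (subD_lty (m := m)).
have mh m : measurable_fun (D m) (h m) by apply: measurable_funTS; have [] := hP m.
pose f : {mfun T >-> R} := glue_mfun tD mD mh.
have Uoo (F : nat -> set T) K : (forall k, measurable (F k)) -> (forall k, F k `<=` D k) ->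
    (mu (\big[setU/set0]_(k < K) F k) < +oo)%E.
  move=> mF FD; apply: le_lt_trans (measure_bigsetU_le _ _ _ _) _ => //.
  by apply: lte_sum_pinfty => k _; exact: subD_lty (FD k).
have limU (F : nat -> set T) K : (forall k, measurable (F k)) -> (forall k, F k `<=` D k) ->
    limit_charge z (\big[setU/set0]_(k < K) F k) = \sum_(k < K) limit_charge z (F k).
  move=> mF FD; elim: K => [|K IH].
    rewrite !big_ord0; have := limit_charge_le M0 Mz measurable0.
    by rewrite measure0 /= powR0 ?gt_eqF// mulr0 normr_le0 => /(_ (ltry _))/eqP.
  rewrite !big_ord_recr/= -IH limit_chargeD//.
  - exact: bigsetU_measurable.
  - exact: Uoo.
  - exact: subD_lty (FD K).
  apply/seteqP; split=> // x [+ Kx]; rewrite -bigcup_mkord => -[k /= kK kx].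
  have kK' : k = K by apply: tD => //; exists x; split; [exact: FD kx|exact: FD Kx].
  by rewrite kK' ltnn in kK.
have half (s c : R) K : s \in [:: 1; -1] -> 0 < c ->
    (\sum_(k < K) mu (D k `&` [set x | (c < s * h k x)%R]) <= ((2 * M / c) `^ p)%:E)%E.
  move=> s1 c0; pose Y k := D k `&` [set x | c < s * h k x].
  have mY k : measurable (Y k).
    have [mhk _ _] := hP k; have mshk : measurable_fun (D k) (fun x => s * h k x).
      by apply: measurable_funM => //; exact: measurable_funTS.
    have := mshk (mD k) _ (measurable_itv `]c, +oo[); congr measurable.
    by apply/seteqP; split=> x /=; rewrite in_itv/= andbT.
  have YD k : Y k `<=` D k by exact: subIsetl.
  have yE k : mu (Y k) = (fine (mu (Y k)))%:E.
    by rewrite fineK// ge0_fin_numE//; exact: subD_lty (YD k).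
  under eq_bigr do rewrite -/(Y _) yE.
  rewrite sumEFin lee_fin; set y := \sum_(k < K) _.
  have yU : y = fine (mu (\big[setU/set0]_(k < K) Y k)).
    rewrite measure_bigsetU//; last first.
      by move=> i j _ _ [x [[Di _] [Dj _]]]; apply: tD => //; exists x.
    rewrite (eq_bigr (fun k : 'I_K => (fine (mu (Y k)))%:E)) ?sumEFin// => k _.
    exact: yE.
  apply: le_powR_of_mul => //; [by rewrite mulr_gt0|by rewrite /y sumr_ge0|].
  have mU : measurable (\big[setU/set0]_(k < K) Y k) by exact: bigsetU_measurable.
  have := limit_charge_le M0 Mz mU (Uoo Y K mY YD).
  rewrite -yU; apply: le_trans.
  apply: (@le_trans _ _ (s * limit_charge z (\big[setU/set0]_(k < K) Y k))); last first.
    apply: le_trans (ler_norm _) _; rewrite normrM.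
    by move: s1; rewrite !inE => /orP[]/eqP ->; rewrite ?normrN normr1 mul1r.
  rewrite limU// /y !mulr_sumr; apply: ler_sum => k _.
  have [_ hint ->//] := hP k.
  have hY : mu.-integrable (Y k) (EFin \o h k) by exact: integrableS hint.
  rewrite -RintegralZl// -Rintegral_cst//; apply: le_Rintegral => //.
  - apply/integrableP; split; first exact/measurable_EFinP.
    rewrite (eq_integral (cst `|c|%:E))//= integral_cst//.
    by rewrite lte_mul_pinfty//; exact: subD_lty (YD k).
  - exact: (integrableZl (mY k) s hY).
  - by move=> x [_ /= /ltW].
have fM : (weak_norm mu p f <= (4 * M)%:E)%E.
  have M40 : 0 < 4 * M by rewrite mulr_gt0.
  apply: (weak_norm_glue tD mD mh p1 M40) => c c0 K.
  have L2 : (4 * M / c) `^ p = 2 `^ p * (2 * M / c) `^ p.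
    rewrite -powRM//; last by rewrite divr_ge0 ?mulr_ge0 ?(ltW M0) ?(ltW c0).
    by congr (_ `^ _); field; rewrite gt_eqF.
  have L0 : 0 <= (2 * M / c) `^ p by exact: powR_ge0.
  apply: (@le_trans _ _ (2 * (2 * M / c) `^ p)%:E); last first.
    by rewrite lee_fin L2 ler_wpM2r// le1r_powR ?(ltW p1)// ler1n.
  rewrite mulr_natl mulr2n EFinD.
  have h1 := half 1 c K; have h2 := half (- 1) c K.
  apply: le_trans (leeD (h1 _ c0) (h2 _ c0)); rewrite ?inE ?eqxx ?orbT//.
  rewrite -big_split/=; apply: lee_sum => k _.
  have [mhk _ _] := hP k.
  have mset (s : R) : measurable (D k `&` [set x | c < s * h k x]).
    have mshk : measurable_fun (D k) (fun x => s * h k x).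
      by apply: measurable_funM => //; exact: measurable_funTS.
    have := mshk (mD k) _ (measurable_itv `]c, +oo[); congr measurable.
    by apply/seteqP; split=> x /=; rewrite in_itv/= andbT.
  apply: le_trans (measureU2 _ (mset 1) (mset (- 1))).
  rewrite le_measure ?inE//; last 2 first.
  - exact: measurableU.
  - move=> x [Dx /=]; rewrite ltr_normr mul1r mulN1r => /orP[hx|hx]; [left|right]; split => //=.
  have mnk : measurable_fun (D k) (fun x => `|h k x|) by exact: measurableT_comp.
  have := mnk (mD k) _ (measurable_itv `]c, +oo[); congr measurable.
  by apply/seteqP; split=> x /=; rewrite in_itv/= andbT.
have foo : (weak_norm mu p f < +oo)%E by apply: le_lt_trans fM (ltry _).
exists (to_weakL mu p1 f); first by rewrite -lee_fin to_weakL_norm.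
move=> m A mA AD.
rewrite (weakL_int_ae mA _ (to_weakLE p1 foo)); last exact: measurable_funTS.
have [_ _ ->//] := hP m.
by apply: eq_Rintegral => x; rewrite inE => /AD Dx; rewrite /= (glueE _ tD Dx).
Qed.

End embedding.

(** The representing function is unique, so choosing it defines a linear map. *)
Lemma gretract_blocks d (T : measurableType d) (R : realType)
    (mu : {measure set T -> \bar R}) (p : R) (p1 : 1 < p) :
  sigma_finite [set: T] mu -> countably_generated mu ->
  gretract (gweakL mu p1) (gseq (gblocks p)).
Proof.
move=> sf /(generating_exists sf)[G [D gen]].
have [L [L_le L_lin L_st]] := generalized_limit R.
pose rep := @represents _ _ _ mu p p1 G D L.
pose Q (z : gseq (gblocks p)) : gweakL mu p1 :=
  if pselect (exists u, rep z u) is left H then projT1 (cid H) else 0.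
have QE z u : rep z u -> Q z = u.
  move=> zu; rewrite /Q; case: pselect => [H|[]]; last by exists u.
  by case: cid => v zv /=; exact: (represents_inj gen zv zu).
have rex := represents_exists p1 gen L_le L_lin sf.
exists (@cell_averages _ _ _ mu p p1 G), Q; split.
- exact: (bounded_linear_cell_averages p1 gen).
- split=> [a z w bz bw|].
    have [[M M0 Mz] [M' M'0 Mw]] := (bz, bw).
    have [u _ zu] := rex _ _ M0 Mz; have [v _ wv] := rex _ _ M'0 Mw.
    rewrite (QE _ _ zu) (QE _ _ wv); apply: QE.
    exact: (represents_linear gen L_lin).
  by exists 4 => // M z M0 Mz; have [u uM zu] := rex _ _ M0 Mz; rewrite (QE _ _ zu).
- move=> u _; apply: QE; exact: (represents_averages gen).
Qed.

(** * Purely atomic measures with few atoms of each size *)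

Section atomic.
Context d (T : measurableType d) (R : realType).
Variables (mu : {measure set T -> \bar R}) (p : R) (p1 : 1 < p).
Variables (C : nat -> set T) (c : nat -> R).
Hypothesis mC : forall j, measurable (C j).
Hypothesis tC : trivIset setT C.
Hypothesis muC : forall j, mu (C j) = (c j)%:E.
Hypothesis c0 : forall j, 0 < c j.
Hypothesis C_full : mu (~` (\bigcup_j C j)) = 0%E.
Hypothesis C_const : forall (u : weakL mu p1) j,
  \forall x \ae mu, C j x -> weakL_fun u x = weakL_int u (C j) / c j.
Variable N : nat.
Hypothesis few : forall e : R, 0 < e -> forall s : seq nat, uniq s ->
  (forall j, j \in s -> e <= c j <= 2 * e) -> (size s <= N)%N.

Let p0 : 0 < p. Proof. exact: lt_trans p1. Qed.

Let coef (u : weakL mu p1) j := c j `^ (p^-1 - 1) * weakL_int u (C j).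

Let Coo j : (mu (C j) < +oo)%E. Proof. by rewrite muC ltry. Qed.

Let coef_le u M j : 0 < M -> weakL_norm u <= M -> `|coef u j| <= kolmogorov_cst p * M.
Proof.
move=> M0 uM; rewrite /coef normrM ger0_norm ?powR_ge0//.
have := weakL_int_le M0 uM (mC j) (Coo j); rewrite muC/= => le.
apply: (@le_trans _ _ (c j `^ (p^-1 - 1) * (kolmogorov_cst p * M * c j `^ (1 - p^-1)))).
  by rewrite ler_wpM2l// powR_ge0.
by rewrite mulrCA -powRD ?addrA ?subrK ?subrr ?powRr0 ?mulr1// (gt_eqF (c0 j)) implybT.
Qed.

Let coef_bounded u : coef u \in @linfty_pred R.
Proof.
have [M M0 uM] := gbounded_weakL (u : gweakL mu p1).
by apply/linfty_predP; exists (kolmogorov_cst p * M) => n; exact: coef_le.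
Qed.

Let Phi (u : gweakL mu p1) : glinfty R := exist _ (coef u) (coef_bounded u).

Let h (w : linfty R) j (x : T) : R := val w j * c j `^ (- p^-1).
Let mh w j : measurable_fun (C j) (h w j). Proof. exact: measurable_cst. Qed.
Let F w : {mfun T >-> R} := glue_mfun tC mC (mh w).

(** Only the sets C j with c j <= (M / a)^p can meet the set where |F w| > a, and
sparse_sum bounds their total mass. *)
Let F_le M w : 0 < M -> `|w| <= M -> (weak_norm mu p (F w) <= ((2 * N%:R + 1) * M)%:E)%E.
Proof.
move=> M0 wM; have n0 : 0 <= N%:R :> R by [].
have M10 : 0 < (2 * N%:R + 1) * M by rewrite mulr_gt0//; lra.
apply: (weak_norm_glue tC mC (mh w) p1 M10) => a a0 K.
pose L := (M / a) `^ p; have L0 : 0 < L by rewrite powR_gt0// divr_gt0.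
pose P j := c j <= L.
apply: (@le_trans _ _ (\sum_(j < K) (if P j then c j else 0)%:E)%E).
  apply: lee_sum => j _; have cj := c0 j.
  have cp0 : 0 < c j `^ p^-1 by exact: powR_gt0.
  have [aw|wa] := ltP a (`|val w j| * c j `^ (- p^-1)); last first.
    rewrite (_ : _ `&` _ = set0) ?measure0 ?lee_fin; first by case: ifP => _; rewrite ?lexx ?ltW.
    apply/seteqP; split=> // x [_ /=]; rewrite /h normrM (ger0_norm (powR_ge0 _ _)).
    by rewrite ltNge wa.
  have -> : P j.
    rewrite /P (_ : c j = (c j `^ p^-1) `^ p); last first.
      by rewrite -powRrM mulVf ?gt_eqF// powRr1// ltW.
    apply: ge0_ler_powR; rewrite ?nnegrE ?powR_ge0 ?(ltW p0) ?divr_ge0 ?(ltW M0) ?(ltW a0)//.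
    rewrite ler_pdivlMr// mulrC -ler_pdivlMr// -powRN.
    apply: le_trans (ltW aw) _; rewrite ler_wpM2r ?powR_ge0//.
    exact: le_trans (le_linfty_norm w j) wM.
  rewrite -muC le_measure ?inE//.
  have : measurable_fun (C j) (fun x => `|h w j x|) by apply: measurableT_comp => //; exact: mh.
  move=> /(_ (mC j) _ (measurable_itv `]a, +oo[)); congr measurable.
  by apply/seteqP; split=> x /=; rewrite in_itv/= andbT.
rewrite sumEFin lee_fin -big_mkcond -(big_mkord P c) /index_iota subn0 -big_filter.
apply: (@le_trans _ _ (2 * N%:R * L)).
  apply: sparse_sum; first exact: ltW.
    by move=> j; rewrite mem_filter c0 => /andP[].
  move=> e e0; rewrite -size_filter; apply: (few e0).
    by rewrite !filter_uniq// iota_uniq.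
  by move=> j; rewrite mem_filter => /andP[].
have -> : ((2 * N%:R + 1) * M / a) `^ p = (2 * N%:R + 1) `^ p * L.
  by rewrite -mulrA powRM ?divr_ge0 ?(ltW M0) ?(ltW a0) ?addr_ge0 ?mulr_ge0.
rewrite ler_pM2r//; have n1 : 1 <= 2 * N%:R + 1 :> R by lra.
apply: le_trans (le1r_powR n1 (ltW p1)); lra.
Qed.

Let Foo w : (weak_norm mu p (F w) < +oo)%E.
Proof.
have [M M0 wM] := gbounded_linfty (w : glinfty R).
exact: le_lt_trans (F_le M0 wM) (ltry _).
Qed.

Let FP a w w' x : F (a *: w + w') x = a * F w x + F w' x.
Proof.
have [[j Cx]|nC] := pselect (exists j, C j x); last first.
  by rewrite /= !glue_out ?mulr0 ?addr0// => j Cx; apply: nC; exists j.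
rewrite /= !(glueE _ tC Cx) /h.
rewrite [val (a *: w + w') j](_ : _ = a * val w j + val w' j)//.
by rewrite mulrDl mulrA.
Qed.

Let Psi (w : glinfty R) : gweakL mu p1 := to_weakL mu p1 (F w).

Lemma giso_atomic_linfty : giso (gweakL mu p1) (glinfty R).
Proof.
exists Phi, Psi; split.
- split=> [a u v _ _|].
    apply/val_inj/funext => j.
    rewrite [RHS](_ : _ = a * coef u j + coef v j)//=.
    rewrite /coef weakL_int_linear//; ring.
  exists (kolmogorov_cst p); first exact: kolmogorov_cst_gt0.
  by move=> M u M0 uM; apply: linfty_norm_le => j; exact: coef_le.
- split=> [a w w' _ _|]; first exact: to_weakL_linear.
  exists (2 * N%:R + 1); first by have : 0 <= N%:R :> R by []; lra.
  by move=> M w M0 wM; rewrite /= /weakL_ball -lee_fin to_weakL_norm//; exact: F_le.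
- move=> u _; apply: weakL_fun_inj.
  have /ae_foralln aeC := C_const u.
  have aeU : \forall x \ae mu, (\bigcup_j C j) x.
    by exists (~` (\bigcup_j C j)); split=> //; apply: measurableC; exact: bigcup_measurable.
  have := to_weakLE p1 (Foo (Phi u)).
  apply: filterS3 aeC aeU => x xC [j _ Cx] ->.
  rewrite (xC j Cx) /= (glueE _ tC Cx) /h /= /coef.
  have cj := c0 j; have cp0 : 0 < c j `^ p^-1 by exact: powR_gt0.
  rewrite powRN powRB; last by rewrite (gt_eqF cj) implybT.
  rewrite powRr1 ?(ltW cj)//.
  by field; rewrite !gt_eqF.
- move=> w _; apply/val_inj/funext => j /=.
  rewrite /coef (weakL_int_ae (mC j) _ (to_weakLE p1 (Foo w))); last exact: measurable_funTS.
  rewrite (@eq_Rintegral _ _ _ mu (C j) (fun=> val w j * c j `^ (- p^-1))); last first.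
    by move=> x; rewrite inE => Cx; rewrite /= (glueE _ tC Cx).
  rewrite Rintegral_cst// muC/=.
  have cj := c0 j; have cp0 : 0 < c j `^ p^-1 by exact: powR_gt0.
  rewrite powRN powRB; last by rewrite (gt_eqF cj) implybT.
  rewrite powRr1 ?(ltW cj)//.
  by field; rewrite !gt_eqF.
Qed.

End atomic.

Lemma weak_norm_indic_lty d (T : measurableType d) (R : realType)
    (mu : {measure set T -> \bar R}) (p : R) (A : set T) : 1 < p ->
  measurable A -> (mu A < +oo)%E -> (weak_norm mu p (\1_A) < +oo)%E.
Proof.
move=> p1 mA Aoo; have p0 : 0 < p by exact: lt_trans p1.
have muE : mu A = (fine (mu A))%:E by rewrite fineK// ge0_fin_numE.
pose M := fine (mu A) `^ p^-1 + 1.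
have M0 : 0 < M by rewrite ltr_wpDl// powR_ge0.
apply: (@le_lt_trans _ _ M%:E); last exact: ltry.
apply/(weak_norm_leP _ p1 _ M0) => c c0.
have [c1|c1] := leP 1 c.
  rewrite (_ : [set x | _] = set0) ?measure0 ?lee_fin ?powR_ge0//.
  apply/seteqP; split=> // x /=; rewrite indicE; case: (x \in A).
    by rewrite normr1 ltNge c1.
  by rewrite normr0 ltNge (ltW c0).
apply: (@le_trans _ _ (mu A)).
  rewrite le_measure ?inE//; first exact: (measurable_norm_gt (mindic R mA)).
  move=> x /=; rewrite indicE; have [|xA] := boolP (x \in A); first by rewrite inE.
  by rewrite normr0 ltNge (ltW c0).
rewrite muE lee_fin; have -> : fine (mu A) = (fine (mu A) `^ p^-1) `^ p.
  by rewrite -powRrM mulVf ?gt_eqF// powRr1// fine_ge0.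
apply: ge0_ler_powR; rewrite ?nnegrE ?powR_ge0 ?(ltW p0) ?divr_ge0 ?(ltW M0) ?(ltW c0)//.
have Mc : M <= M / c by rewrite ler_peMr ?(ltW M0)// invf_ge1// ltW.
by apply: le_trans Mc; rewrite /M lerDl.
Qed.

Lemma weakL_fun_sum d (T : measurableType d) (R : realType)
    (mu : {measure set T -> \bar R}) (p : R) (p1 : 1 < p) n (a : 'I_n -> R)
    (e : 'I_n -> weakL mu p1) :
  \forall x \ae mu, weakL_fun (\sum_i a i *: e i) x = \sum_i a i * weakL_fun (e i) x.
Proof.
elim: n a e => [|n IH] a e.
  have := weakL_funP (-1) (0 : weakL mu p1) 0; rewrite scaler0 addr0 !big_ord0.
  by apply: filterS => x; rewrite big_ord0 mulN1r addNr.
rewrite big_ord_recl.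
have := weakL_funP (a ord0) (e ord0) (\sum_i a (lift ord0 i) *: e (lift ord0 i)).
have := IH (a \o lift ord0) (e \o lift ord0).
by apply: filterS2 => x /= sx ->; rewrite sx big_ord_recl.
Qed.

(** * Atoms of a countably generated measure *)

Section atoms.
Context d (T : measurableType d) (R : realType).
Variables (mu : {measure set T -> \bar R}) (p : R) (p1 : 1 < p).
Variables (G D : nat -> set T).
Hypothesis gen : generating mu G D.

Let mG i : measurable (G i). Proof. by have [] := gen. Qed.
Let mD m : measurable (D m). Proof. by have [_ /(_ m)[]] := gen. Qed.
Let Doo m : (mu (D m) < +oo)%E. Proof. by have [_ /(_ m)[]] := gen. Qed.
Let tD : trivIset setT D. Proof. by have [] := gen. Qed.
Let covD x : exists m, D m x.
Proof. by have [_ _ _ DT _] := gen; have : setT x by []; rewrite -DT => -[m _]; exists m. Qed.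

(** The set of points that the generators do not distinguish from x. *)
Definition atom x : set T := \bigcap_l cell G (code G l x).

Lemma atomP x y : atom x y <-> forall i, G i x <-> G i y.
Proof.
split=> [xy i|xy l _].
  have /esym/codeP := xy i.+1 I; exact.
by apply/esym/codeP => i _; exact: xy.
Qed.

Lemma measurable_atom x : measurable (atom x).
Proof. by apply: bigcap_measurable => // l _; exact: measurable_cell. Qed.

Lemma atom_refl x : atom x x. Proof. exact/atomP. Qed.

Lemma atom_eq x y z : atom x z -> atom y z -> atom x = atom y.
Proof.
move=> /atomP xz /atomP yz; apply/seteqP; split=> t /atomP h; apply/atomP => i.
  exact: iff_trans (iff_trans (yz i) (iff_sym (xz i))) (h i).
exact: iff_trans (iff_trans (xz i) (iff_sym (yz i))) (h i).
Qed.

Lemma atom_sub x m : D m x -> atom x `<=` D m.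
Proof.
have [_ _ _ _ [/(_ m)[i ->] _]] := gen.
by move=> Gx y /atomP/(_ i)[+ _]; apply.
Qed.

Lemma atom_lty x : (mu (atom x) < +oo)%E.
Proof.
have [m Dx] := covD x; apply: le_lt_trans (Doo m).
by rewrite le_measure ?inE//; [exact: measurable_atom|exact: atom_sub].
Qed.

(** The sets A with this property form a sigma-algebra which contains the
generators and the null sets. *)
Lemma atom_dichotomy A x : measurable A ->
  mu (A `&` atom x) = 0%E \/ mu (atom x `\` A) = 0%E.
Proof.
have mx := measurable_atom x.
pose S := [set A | measurable A /\ (mu (A `&` atom x) = 0%E \/ mu (atom x `\` A) = 0%E)].
suff : @measurable d T `<=` S by move=> h /h[].
have [_ _ _ _ [_ msub]] := gen; apply: subset_trans msub _.
apply: smallest_sub; first split.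
- by split => //; left; rewrite set0I measure0.
- move=> B [mB h]; split; first exact: measurableD.
  case: h => h; [right|left].
    by rewrite setTD setDE setCK setIC.
  by rewrite setTD setIC -setDE.
- move=> F FS; have mF n : measurable (F n) by case: (FS n).
  have mU : measurable (\bigcup_n F n) by exact: bigcup_measurable.
  split => //; have [[n Fn]|nF] := pselect (exists n, mu (atom x `\` F n) = 0%E).
    right; apply: (subset_measure0 _ _ _ Fn); [exact: measurableD..|].
    by apply: setDS => y Fy; exists n.
  left; rewrite setI_bigcupl; apply/eqP; rewrite -measure_le0.
  apply: le_trans (measure_sigma_subadditive _ _ _ (@subset_refl _ _)) _.
  + by move=> n; exact: measurableI.
  + by apply: bigcup_measurable => n _; exact: measurableI.
  rewrite eseries0// => n _ _; case: (FS n) => _ [//|Fn].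
  by case: nF; exists n.
move=> B [[i _ <-]|[mB B0]].
  split=> //; have [Gx|nGx] := pselect (G i x); [right|left].
    rewrite (_ : _ `\` _ = set0) ?measure0//.
    by apply/seteqP; split=> // y [/atomP/(_ i)[h _]] []; exact: h.
  rewrite (_ : _ `&` _ = set0) ?measure0//.
  by apply/seteqP; split=> // y [Gy /atomP/(_ i)[_ h]]; case: nGx; exact: h.
split => //; left; apply: (subset_measure0 _ _ _ B0) => //; exact: measurableI.
Qed.

(** Every measurable subset of the atom is null or of full measure in it, so f and
its average have the same integrals over all of them. *)
Lemma atom_const (u : weakL mu p1) x : (0 < mu (atom x))%E ->
  \forall y \ae mu, atom x y -> weakL_fun u y = weakL_int u (atom x) / fine (mu (atom x)).
Proof.
move=> x0; have mx := measurable_atom x; have xoo := atom_lty x.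
set k := weakL_int _ _ / _.
have muE : mu (atom x) = (fine (mu (atom x)))%:E by rewrite fineK// ge0_fin_numE.
have m0 : 0 < fine (mu (atom x)) by rewrite -lte_fin -muE.
suff : ae_eq mu (atom x) (EFin \o weakL_fun u) (cst k%:E).
  by apply: filterS => y h /h [].
apply: integral_ae_eq => //; first exact: weakL_integrable.
move=> A Ax mA; have Aoo : (mu A < +oo)%E.
  by apply: le_lt_trans xoo; rewrite le_measure ?inE.
have -> : (\int[mu]_(y in A) (EFin \o weakL_fun u) y)%E = (weakL_int u A)%:E.
  by rewrite /weakL_int /Rintegral fineK//; apply: integrable_fin_num => //; exact: weakL_integrable.
rewrite integral_cst//; have [] := atom_dichotomy x mA; rewrite ?setIidl// => A0.
  by rewrite A0 mule0 weakL_int0.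
have mxA : measurable (atom x `\` A) by exact: measurableD.
have xAoo : (mu (atom x `\` A) < +oo)%E by rewrite A0.
have wE : weakL_int u (atom x) = weakL_int u A.
  by rewrite -(setDUK Ax) weakL_intU// ?(weakL_int0 _ mxA A0) ?addr0// setDIK.
have -> : mu A = mu (atom x).
  by rewrite -[in RHS](setDUK Ax) measureU0.
by rewrite muE -EFinM /k -wE divfK// gt_eqF.
Qed.

Definition atoms : set (set T) := [set A | exists2 x, A = atom x & (0 < mu A)%E].

Lemma cell_cvg H x : measurable H -> (mu H < +oo)%E ->
  mu (H `&` cell G (code G l x)) @[l --> \oo] --> mu (H `&` atom x).
Proof.
move=> mH Hoo; have mHc l : measurable (H `&` cell G (code G l x)).
  by apply: measurableI => //; exact: measurable_cell.
have -> : H `&` atom x = \bigcap_l (H `&` cell G (code G l x)).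
  apply/seteqP; split=> [y [Hy xy] l _|y xy]; first by split=> //; exact: xy l I.
  by split=> [|l _]; [have [] := xy 0%N I|have [] := xy l I].
apply: nonincreasing_cvg_mu => //.
- by apply: le_lt_trans Hoo; rewrite le_measure ?inE.
- exact: bigcap_measurable.
- move=> k l kl; apply/subsetPset; apply: setIS => y /= yx.
  exact: code_le kl yx.
Qed.

Let code_type := (nat * {l : nat & {ffun 'I_l -> bool}})%type.
Let patch (w : code_type) := D w.1 `&` cell G (tagged w.2).

Let mpatch w : measurable (patch w).
Proof. by apply: measurableI => //; exact: measurable_cell. Qed.

(** A cell with less than twice the mass of an atom that it contains determines this
atom: there is no room for a second one. Since cells are countably many, so are the
atoms of positive measure. *)
Let isolates (w : code_type) x :=
  atom x `<=` patch w /\ (mu (patch w) < mu (atom x) + mu (atom x))%E.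

Let isolates_exists x : (0 < mu (atom x))%E -> exists w, isolates w x.
Proof.
move=> x0; have [m Dx] := covD x; have xoo := atom_lty x.
have := cell_cvg (x := x) (mD m) (Doo m).
rewrite (setIidr (atom_sub Dx)).
have muE : mu (atom x) = (fine (mu (atom x)))%:E by rewrite fineK// ge0_fin_numE.
have m0 : 0 < fine (mu (atom x)) by rewrite -lte_fin -muE.
rewrite {1}muE => /fine_cvg /cvgr_lt => /(_ (fine (mu (atom x)) + fine (mu (atom x)))).
rewrite ltrDl => /(_ m0)[l _ /(_ l (leqnn l)) /= ll].
exists (m, Tagged (fun l => {ffun 'I_l -> bool}) (code G l x)); split.
  move=> y xy; split; first exact: (atom_sub Dx).
  exact: xy l I.
rewrite muE -EFinD -[ltLHS]fineK ?lte_fin// ge0_fin_numE//.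
by apply: le_lt_trans (Doo m); rewrite le_measure ?inE//; exact: subIsetl.
Qed.

Let isolates_inj w x y : isolates w x -> isolates w y -> atom x = atom y.
Proof.
move=> [xw muw] [yw muw'].
have [[z [xz yz]]|nz] := pselect (exists z, atom x z /\ atom y z).
  exact: atom_eq xz yz.
exfalso.
have xE : mu (atom x) = (fine (mu (atom x)))%:E.
  by rewrite fineK// ge0_fin_numE//; exact: atom_lty.
have yE : mu (atom y) = (fine (mu (atom y)))%:E.
  by rewrite fineK// ge0_fin_numE//; exact: atom_lty.
have : (mu (atom x) + mu (atom y) <= mu (patch w))%E.
  rewrite -measureU ?le_measure ?inE//.
  - by apply: measurableU; exact: measurable_atom.
  - by rewrite subUset.
  - exact: measurable_atom.
  - exact: measurable_atom.
  by apply/seteqP; split=> // z [xz yz]; case: nz; exists z.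
move: muw muw'; rewrite xE yE -!EFinD => wx wy xyw.
have := le_lt_trans xyw wx; have := le_lt_trans xyw wy; rewrite !lte_fin; lra.
Qed.

Let atom_of (w : code_type) : set T :=
  if pselect (exists x, (0 < mu (atom x))%E /\ isolates w x) is left H
  then atom (projT1 (cid H)) else set0.

Let matom_of w : measurable (atom_of w).
Proof. by rewrite /atom_of; case: pselect => // H; exact: measurable_atom. Qed.

Let atom_ofP w y : atom_of w y -> (0 < mu (atom y))%E.
Proof.
rewrite /atom_of; case: pselect => // H; case: cid => x /= [x0 _] xy.
by rewrite (atom_eq (atom_refl y) xy).
Qed.

Let atom_of_onto x : (0 < mu (atom x))%E -> exists w, atom_of w = atom x.
Proof.
move=> x0; have [w wx] := isolates_exists x0; exists w.
rewrite /atom_of; case: pselect => [H|[]]; last by exists x.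
by case: cid => y /= [_ wy]; exact: isolates_inj wy wx.
Qed.

Lemma countable_atoms : countable (atoms).
Proof.
apply: (@sub_countable _ _ _ (range atom_of)).
  by apply: subset_card_le => A [x -> x0]; have [w <-] := atom_of_onto x0; exists w.
by apply: sub_countable (card_image_le _ _) _; exact: countableP.
Qed.

Definition diffuse_part := [set x | mu (atom x) = 0%E].

Lemma measurable_diffuse_part : measurable diffuse_part.
Proof.
rewrite (_ : diffuse_part = ~` \bigcup_n
  (if unpickle n is Some w then atom_of w else set0)).
  by apply: measurableC; apply: bigcupT_measurable => n; case: unpickle.
apply/seteqP; split=> x /=.
  by move=> x0 [n _]; case: unpickle => // w /atom_ofP; rewrite x0 ltxx.
move=> nx; apply/eqP; rewrite -measure_le0 leNgt; apply/negP => x0.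
have [w wx] := atom_of_onto x0; apply: nx; exists (pickle w) => //.
by rewrite pickleK wx; exact: atom_refl.
Qed.

(** The measure of the part of H in the cell around x decreases to 0 for each x,
so the set of the points whose cell has H-measure above e becomes small; as it is a
union of such cells it is eventually empty. *)
Lemma divisible_diffuse H : measurable H -> (mu H < +oo)%E -> H `<=` diffuse_part ->
  divisible mu H.
Proof.
move=> mH Hoo Hdiff e e0.
pose big l := [set x | (e%:E < mu (H `&` cell G (code G l x)))%E].
have mbig l : measurable (H `&` big l).
  apply: measurableI => //.
  exact: (measurable_code (G := G) mG (fun s => (e%:E < mu (H `&` cell G s))%E)).
have mHc l s : measurable (H `&` cell G (l := l) s).
  by apply: measurableI => //; exact: measurable_cell.
have bigcap0 : \bigcap_l (H `&` big l) = set0.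
  apply/seteqP; split=> // x xbig; have [Hx _] := xbig 0%N I.
  have := cell_cvg (x := x) mH Hoo.
  rewrite (_ : mu (H `&` atom x) = 0%:E); last first.
    by apply: (subset_measure0 _ _ _ (Hdiff x Hx)) => //;
      [apply: measurableI => //|]; exact: measurable_atom.
  move=> /fine_cvg/cvgr_lt/(_ e e0)[l _ /(_ l (leqnn l)) /= le].
  have [_] := xbig l I; rewrite /big /= ltNge => /negP; apply.
  rewrite -[leLHS]fineK ?lee_fin ?(ltW le)// ge0_fin_numE//.
  by apply: le_lt_trans Hoo; rewrite le_measure ?inE.
have : mu (H `&` big l) @[l --> \oo] --> mu (\bigcap_l (H `&` big l)).
  apply: nonincreasing_cvg_mu => //.
  - by apply: le_lt_trans Hoo; rewrite le_measure ?inE.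
  - exact: bigcap_measurable.
  move=> k l kl; apply/subsetPset => x [Hx /= bx]; split => //=.
  apply: lt_le_trans bx _; rewrite le_measure ?inE//.
  by apply: setIS => y /= yx; exact: code_le kl yx.
rewrite bigcap0 measure0 => /fine_cvg/cvgr_lt/(_ e e0)[l _ /(_ l (leqnn l)) /= le].
have small s : (mu (H `&` cell G (l := l) s) <= e%:E)%E.
  rewrite leNgt; apply/negP => es.
  have : (mu (H `&` cell G s) <= mu (H `&` big l))%E.
    rewrite le_measure ?inE// => x [Hx /= xs]; split => //=.
    by rewrite /big /= xs.
  apply/negP; rewrite -ltNge; apply: lt_trans es.
  rewrite -[ltLHS]fineK ?lte_fin// ge0_fin_numE//.
  by apply: le_lt_trans Hoo; rewrite le_measure ?inE.
pose cs := enum {: {ffun 'I_l -> bool}}; pose s0 : {ffun 'I_l -> bool} := [ffun=> false].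
exists (size cs), (fun i => cell G (nth s0 cs i)); split.
- by move=> i; exact: measurable_cell.
- move=> x Hx; exists (index (code G l x) cs); first by rewrite /= index_mem mem_enum.
  by rewrite /cell /= nth_index// mem_enum.
- by move=> i _; exact: small.
Qed.

Lemma rich_diffuse : (0 < mu diffuse_part)%E -> rich mu.
Proof.
move=> N0; have mN := measurable_diffuse_part.
have [m m0] : exists m, (0 < mu (diffuse_part `&` D m))%E.
  apply: contrapT => /forallNP nm; move: N0; rewrite ltNge => /negP; apply.
  have [_ _ _ DT _] := gen.
  rewrite -(setIT diffuse_part) -DT setI_bigcupr.
  apply: le_trans (measure_sigma_subadditive _ _ _ (@subset_refl _ _)) _.
  + by move=> n; exact: measurableI.
  + by apply: bigcup_measurable => n _; exact: measurableI.
  rewrite eseries0// => n _ _; apply/eqP; rewrite -measure_le0 leNgt.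
  exact/negP/nm.
have mH : measurable (diffuse_part `&` D m) by exact: measurableI.
have Hoo : (mu (diffuse_part `&` D m) < +oo)%E.
  by apply: le_lt_trans (Doo m); rewrite le_measure ?inE.
apply: (rich_divisible mH); first by rewrite m0.
by apply: divisible_diffuse => //; exact: subIsetl.
Qed.

Lemma finite_dimensional_atoms : mu diffuse_part = 0%E -> finite_set (atoms) ->
  finite_dimensional (weakL mu p1).
Proof.
move=> N0 /finite_setP[n]; rewrite card_eq_sym => /card_set_bijP[C [CA Cinj Csurj]].
have Cx (j : 'I_n) : exists2 x, C j = atom x & (0 < mu (C j))%E := CA j (ltn_ord j).
have Coo (j : 'I_n) : (mu (C j) < +oo)%E.
  by have [x -> _] := Cx j; exact: atom_lty.
have mC (j : 'I_n) : measurable (C j).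
  by have [x -> _] := Cx j; exact: measurable_atom.
pose e (j : 'I_n) := to_weakL mu p1 (mindic R (mC j)).
have eE (j : 'I_n) : \forall x \ae mu, weakL_fun (e j) x = \1_(C j) x.
  by apply: to_weakLE; apply: weak_norm_indic_lty.
exists n, e => u.
pose a (j : 'I_n) := weakL_int u (C j) / fine (mu (C j)).
exists a; apply: weakL_fun_inj.
have aeC : \forall x \ae mu, forall j : 'I_n, C j x -> weakL_fun u x = a j.
  have : forall j : nat, \forall x \ae mu,
      forall i : 'I_n, i = j :> nat -> C i x -> weakL_fun u x = a i.
    move=> j; have [jn|nj] := ltnP j n; last first.
      by apply: aeW => x i ij; have := ltn_ord i; rewrite ij ltnNge nj.
    have [y jy y0] := Cx (Ordinal jn).
    have := @atom_const u y; rewrite -jy => /(_ y0).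
    apply: filterS => x h i ij; have -> : i = Ordinal jn by exact: val_inj.
    exact: h.
  by move=> /ae_foralln; apply: filterS => x h j; exact: h.
have aeN : \forall x \ae mu, exists j : 'I_n, C j x.
  exists diffuse_part; split => //; first exact: measurable_diffuse_part.
  move=> x /= nC; apply/eqP; rewrite -measure_le0 leNgt; apply/negP => x0.
  have [|j jn jx] := Csurj (atom x); first by exists x.
  by apply: nC; exists (Ordinal jn); rewrite jx; exact: atom_refl.
have aeE : \forall x \ae mu, forall j : 'I_n, weakL_fun (e j) x = \1_(C j) x.
  have : forall j : nat, \forall x \ae mu,
      forall i : 'I_n, i = j :> nat -> weakL_fun (e i) x = \1_(C i) x.
    move=> j; have [jn|nj] := ltnP j n; last first.
      by apply: aeW => x i ij; have := ltn_ord i; rewrite ij ltnNge nj.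
    apply: filterS (eE (Ordinal jn)) => x h i ij.
    by have -> : i = Ordinal jn by exact: val_inj.
  by move=> /ae_foralln; apply: filterS => x h j; exact: h.
have aeS := weakL_fun_sum a e.
have aeCN : \forall x \ae mu, exists2 j : 'I_n, C j x & weakL_fun u x = a j.
  by apply: filterS2 aeC aeN => x h [j jx]; exists j => //; exact: h.
apply: filterS3 aeCN aeE aeS => x [j jx ->] Ex ->.
rewrite (bigD1 j)//= Ex indicE mem_set// mulr1 big1 ?addr0// => i ij.
rewrite Ex indicE memNset ?mulr0// => ix.
have ijC : C i = C j.
  have [[y iy _] [z jz _]] := (Cx i, Cx j).
  by rewrite iy jz; rewrite iy in ix; rewrite jz in jx; exact: atom_eq ix jx.
have := Cinj i j; rewrite !inE /= !ltn_ord => /(_ isT isT ijC) /val_inj eij.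
by rewrite eij eqxx in ij.
Qed.

Lemma giso_dichotomy : ~ finite_dimensional (weakL mu p1) ->
  rich mu \/ giso (gweakL mu p1) (glinfty R).
Proof.
move=> infdim.
have [N0|] := boolP (0 < mu diffuse_part)%E; first by left; exact: rich_diffuse.
rewrite -leNgt measure_le0 => /eqP N0.
have inf : infinite_set (atoms).
  by move=> fin; apply: infdim; exact: finite_dimensional_atoms.
have /card_set_bijP[C [CA Cinj Csurj]] : ([set: nat] #= atoms)%card.
  by rewrite card_eq_sym; exact: eq_card_nat countable_atoms inf.
have Cx j : exists2 x, C j = atom x & (0 < mu (C j))%E := CA j I.
have Coo j : (mu (C j) < +oo)%E by have [x -> _] := Cx j; exact: atom_lty.
have mC j : measurable (C j) by have [x -> _] := Cx j; exact: measurable_atom.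
pose c j := fine (mu (C j)).
have muC j : mu (C j) = (c j)%:E by rewrite fineK// ge0_fin_numE.
have c0 j : 0 < c j by have [_ _] := Cx j; rewrite muC lte_fin.
have tC : trivIset setT C.
  move=> i j _ _ [z [iz jz]]; apply: Cinj; rewrite ?inE//.
  have [[x ix _] [y jy _]] := (Cx i, Cx j).
  by rewrite ix jy; rewrite ix in iz; rewrite jy in jz; exact: atom_eq iz jz.
have [many|] := pselect (forall N, exists2 e : R, 0 < e & exists s : seq nat,
    [/\ uniq s, size s = N & forall j, j \in s -> e <= c j <= 2 * e]).
  by left; exact: (rich_family mC tC muC many).
move=> /existsNP[N nN]; right.
apply: (@giso_atomic_linfty _ _ _ mu p p1 C c mC tC muC c0 _ _ N).
- rewrite (_ : ~` _ = diffuse_part)//; apply/seteqP; split=> x /=.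
    move=> nx; apply/eqP; rewrite -measure_le0 leNgt; apply/negP => x0.
    have [|j _ jx] := Csurj (atom x); first by exists x.
    by apply: nx; exists j => //; rewrite jx; exact: atom_refl.
  move=> x0 [j _]; have [y -> ] := Cx j => y0 yx.
  by move: y0; rewrite (atom_eq yx (atom_refl x)) x0 ltxx.
- move=> u j; have [x jx] := Cx j; rewrite /c jx => x0.
  exact: atom_const.
- move=> e e0 s us sP; rewrite leqNgt; apply/negP => Ns; apply: nN.
  exists e => //; exists (take N s); split; first exact: take_uniq.
    by rewrite size_takel// ltnW.
  by move=> j /mem_take; exact: sP.
Qed.

End atoms.

(** * The isomorphism theorem *)

Section counting_measure.
Variable R : realType.

Lemma countably_generated_counting : countably_generated (@counting nat R).
Proof.
exists (fun n => [set n]) => //; apply/seteqP; split=> // A _ M [[M0 MC MU] XM].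
rewrite (_ : A = \bigcup_n ([set n] `&` A)); last first.
  by apply/seteqP; split=> [n An|n [m _ [-> Am]]//]; exists n.
apply: MU => n; have [An|nAn] := pselect (A n).
  by rewrite setIidl => [|m ->//]; apply: XM; left; exists n.
by rewrite (_ : _ `&` _ = set0)//; apply/seteqP; split=> // m [-> /nAn].
Qed.

Lemma rich_counting : rich (@counting nat R).
Proof.
apply: (@rich_family _ _ _ (@counting nat R) (fun j => [set j]) (fun=> 1)) => //.
- by move=> i j _ _ [x [-> ->]].
- move=> j; change (@counting nat R [set j] = 1%E).
  rewrite /counting asboolT//.
  by rewrite fset_set1 finmap.cardfs1.
- move=> N; exists 1 => //; exists (iota 0 N); rewrite iota_uniq size_iota; split => // j _.
  by rewrite lexx/= mulr1 ler1n.
Qed.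

End counting_measure.

Theorem theorem7 (R : realType) (d : measure_display) (T : measurableType d)
    (mu : {measure set T -> \bar R}) (p : R) (p1 : 1 < p)
    (mu_sigma_finite : sigma_finite [set: T] mu)
    (mu_countably_generated : countably_generated mu)
    (weakL_infinite_dimensional : ~ finite_dimensional (weakL mu p1)) :
  isomorphic (weakL mu p1) (weakL (@counting nat R) p1) \/
  isomorphic (weakL mu p1) (linfty R).
Proof.
have [G [D gen]] := generating_exists mu_sigma_finite mu_countably_generated.
have [rich_mu|iso] := giso_dichotomy gen weakL_infinite_dimensional; last first.
  by right; exact: isomorphic_weakL_linfty.
left; apply: isomorphic_weakL.
pose W := gseq (gseq (gblocks p)).
have Wmu : giso (gweakL mu p1) W.
  by apply: pelczynski_decomposition; [exact: gretract_blocks|exact: gretract_rich].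
have Wcount : giso (gweakL (@counting nat R) p1) W.
  apply: pelczynski_decomposition.
    apply: gretract_blocks; first exact: sigma_finite_counting.
    exact: countably_generated_counting.
  exact/gretract_rich/rich_counting.
exact: giso_trans Wmu (giso_sym Wcount).
Qed.
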